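(* Let $D$ be a period domain for polarized Hodge structures of weight $n$, let $\mathcal O$ be a $G_{\mathbb R}$-orbit of real codimension one in $\check D$ contained in $\mathrm{bd}(D)$, and let $(N,F^{\bullet})$ be a minimal degeneration whose reduced limit $F^{\bullet}_{\infty}$ lies in $\mathcal O$. Let $i^{p,q}=\dim I^{p,q}$ be the Deligne–Hodge numbers of its limit mixed Hodge structure. Suppose that there exists $r\in\mathbb Z$ with $i^{r,n-r}\neq0$ satisfying one of the following conditions: (i) $(N,F^{\bullet})$ is of type I and $r=p_o+2\ell$ or $r=p_o-2\ell+1$ for some integer $\ell\ge1$; (ii) $(N,F^{\bullet})$ is of type II (so $n=2m$) and $r=m+2\ell+1$ for some $\ell\in\mathbb Z$. Then $\mathcal O$ is a pseudoconcave boundary orbit of $D$.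
   Context: Period domain. $V_{\mathbb R}$ is a finite-dimensional real vector space with complexification $V_{\mathbb C}$, $Q$ is a nondegenerate $(-1)^n$-symmetric bilinear form on $V_{\mathbb R}$, and $h^{p,q}$ ($p+q=n$) are fixed Hodge numbers. $D$ parametrizes Hodge structures $F^\bullet$ of weight $n$ on $V_{\mathbb R}$ with these Hodge numbers polarized by $Q$, i.e. $Q(F^p,F^{n-p+1})=0$ and $Q(Cv,\bar v)>0$ for $0\ne v\in V_{\mathbb C}$, where $C$ acts on $V^{p,q}$ by $\mathbf i^{p-q}$, $\mathbf i=\sqrt{-1}$. $G_{\mathbb R}=\mathrm{Aut}(V_{\mathbb R},Q)$ and $G=\mathrm{Aut}(V_{\mathbb C},Q)$ (symplectic groups if $n$ is odd, special orthogonal groups if $n$ is even). Choosing a reference point, $D$ is its $G_{\mathbb R}$-orbit, an open subset of the flag manifold $\check D$, the $G$-orbit of that point. $\mathrm{bd}(D)$ and $\mathrm{cl}(D)$ denote boundary and closure in $\check D$; $\mathrm{bd}(D)$ is a disjoint union of finitely many $G_{\mathbb R}$-orbits. Nilpotent orbits. A nilpotent orbit is a pair $(N,F^\bullet)$ with $N\in\mathfrak g_{\mathbb R}=\mathrm{Lie}(G_{\mathbb R})$ nilpotent and $F^\bullet\in\check D$ such that $NF^p\subset F^{p-1}$ for all $p$ and $\exp(zN)F^\bullet\in D$ for $\mathrm{Im}(z)$ sufficiently large. Let $W_\bullet=W_\bullet(N)[-n]$ be the monodromy weight filtration centered at $n$: $NW_\ell\subset W_{\ell-2}$ and $N^j:\mathrm{Gr}^W_{n+j}\to\mathrm{Gr}^W_{n-j}$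 is an isomorphism for $j\geq 0$. Then $(W_\bullet,F^\bullet)$ is a mixed Hodge structure (the limit mixed Hodge structure), with Deligne decomposition $V_{\mathbb C}=\bigoplus_{p,q}I^{p,q}$. The reduced limit is $F^\bullet_\infty=\lim_{\mathrm{Im}(z)\to\infty}\exp(zN)F^\bullet\in\check D$. $(N,F^\bullet)$ is a minimal degeneration if $F^\bullet_\infty$ lies in a $G_{\mathbb R}$-orbit of real codimension one in $\mathrm{bd}(D)$. Types (known classification of Green–Griffiths–Robles). Every minimal degeneration is of exactly one of two types. Type I: $N\neq0$, $N^2=0$, $\mathrm{rank}\,N\in\{1,2\}$; then there is a unique integer $p_o$ with $2p_o<n$ and $i^{p_o+1,n-p_o}=i^{p_o,n-p_o-1}=1$. Type II: $N^2\neq0$, $N^3=0$, $\mathrm{rank}\,N=2$; then $n=2m$ is even and $i^{m-1,m-1}=i^{m+1,m+1}=1$. Pseudoconcave boundary orbit. A codimension-one $G_{\mathbb R}$-orbit $\mathcal O\subset\mathrm{bd}(D)$ is a pseudoconcave boundary orbit of $D$ if there is a continuous map $\rho$ from the closed unit disk into $\mathrm{cl}(D)$, holomorphic on the open unit disk, with $\rho(0)\in\mathcal O$ and with $\rho$ mapping the boundary circle into $D$. *)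

(* Defs.v *)
From HB Require Import structures.
From mathcomp Require Import all_boot all_order all_algebra.
From mathcomp Require Import complex.
From mathcomp Require Import all_classical all_reals all_analysis.
Import Order.TTheory GRing.Theory Num.Theory numFieldNormedType.Exports.

Set Implicit Arguments.
Unset Strict Implicit.
Unset Printing Implicit Defensive.

Local Open Scope classical_set_scope.
Local Open Scope ring_scope.

(* V_R is 'rV[R]_d, where d = dim V, with complexification 'rV[R[i]]_d.
   Matrices act on row vectors from the right, so all group actions below
   are right actions.  Filtrations are indexed by int, and the
   Hodge number h^{p,n-p} is written h p. *)

HB.instance Definition _ (R : rcfType) := GRing.ComAlgebra.copy R[i] R[i]^o.
HB.instance Definition _ (R : rcfType) := Vector.copy R[i] R[i]^o.
HB.instance Definition _ (R : rcfType) := NormedModule.copy R[i] R[i]^o.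

Section Subspaces.
Context {K : fieldType}.

(* The subspace with underlying set P, when P is a linear subspace. *)
Definition vspace_of (V : vectType K) (P : set V) : {vspace V} :=
  xget 0%VS [set U : {vspace V} | forall v, v \in U <-> P v].

Lemma vspace_ofP (V : vectType K) (P : set V) :
    P 0 -> (forall a u v, P u -> P v -> P (a *: u + v)) ->
  forall v, v \in vspace_of P <-> P v.
Proof.
move=> P0 Plin.
pose inP (U : {vspace V}) := forall v, v \in U -> P v.
have ex0 : exists k, `[< exists2 U, inP U & \dim U = k >].
  exists 0%N; apply/asboolP; exists 0%VS; last exact: dimv0.
  by move=> v; rewrite memv0 => /eqP ->.
have bnd k : `[< exists2 U, inP U & \dim U = k >] -> (k <= \dim {:V})%N.
  by move=> /asboolP[U _ <-]; exact: dimvS (subvf U).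
case: (ex_maxnP ex0 bnd) => k /asboolP[U UP dimU] kmax.
rewrite /vspace_of; case: xgetP => [W _ //|] /(_ U) [] v.
split=> [/UP //|Pv]; apply: contrapT => /negP vU.
have : (\dim (U + <[v]>) <= k)%N.
  apply: kmax; apply/asboolP; exists (U + <[v]>)%VS => //.
  move=> _ /memv_addP[u uU [_ /vlineP[a ->] ->]].
  by rewrite addrC; apply: Plin => //; exact: UP.
rewrite -dimU => le_dim.
have /eqP UE : U == (U + <[v]>)%VS by rewrite eqEdim addvSl le_dim.
by move: vU; rewrite UE (subvP (addvSr U <[v]>)) // memv_line.
Qed.

(* The sum of the A t with P t, for an index type that need not be finite. *)
Definition lsum (V : vectType K) (T : Type) (P : set T) (A : T -> {vspace V}) :
    {vspace V} :=
  vspace_of [set v | forall U : {vspace V},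
                  (forall t, P t -> (A t <= U)%VS) -> v \in U].

Lemma lsumP (V : vectType K) (T : Type) (P : set T) (A : T -> {vspace V}) U :
  (lsum P A <= U)%VS <-> forall t, P t -> (A t <= U)%VS.
Proof.
have memE v : v \in lsum P A <->
    forall U, (forall t, P t -> (A t <= U)%VS) -> v \in U.
  apply: vspace_ofP => [W _|a u w Hu Hw W AW]; first exact: mem0v.
  by rewrite rpredD ?rpredZ ?Hu ?Hw.
split=> [sU t Pt|AU]; last by apply/subvP => v /memE; exact.
apply: subv_trans sU; apply/subvP => v vA; apply/memE => W AW.
exact: subvP (AW t Pt) v vA.
Qed.

Context {d : nat}.
Implicit Types (Q X g : 'M[K]_d).

(* On a symplectic space the condition on the determinant is automatic. *)
Definition isometry_group Q : set 'M[K]_d :=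
  [set g | g *m Q *m g^T = Q /\ \det g = 1].

Definition lie_algebra Q : {vspace 'M[K]_d} :=
  vspace_of [set X | X *m Q + Q *m X^T = 0].

Lemma mem_lie_algebra Q X : X \in lie_algebra Q <-> X *m Q + Q *m X^T = 0.
Proof.
apply: vspace_ofP => /= [|a Y Z HY HZ].
  by rewrite trmx0 mul0mx mulmx0 addr0.
rewrite linearD linearZ /= mulmxDl mulmxDr -scalemxAl -scalemxAr addrACA.
by rewrite -scalerDr HY HZ scaler0 addr0.
Qed.

Definition nilpotent_mx X := exists k, X ^+ k = 0.

(* The exponential of z X for nilpotent X, for which X ^+ d = 0. *)
Definition exp_nilp (z : K) X : 'M[K]_d :=
  \sum_(k < d.+1) (z ^+ k / k`!%:R) *: X ^+ k.

(* W is the monodromy weight filtration of N centered at n.  The last two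
   clauses say that N ^+ j maps Gr_{n+j} to Gr_{n-j} injectively and
   surjectively. *)
Definition weight_filtration (n : int) (N : 'M[K]_d)
    (W : int -> {vspace 'rV[K]_d}) : Prop :=
  [/\ forall l, (W l <= W (l + 1)%R)%VS,
      (exists l, W l = 0%VS) /\ (exists l, W l = fullv),
      forall l v, v \in W l -> v *m N \in W (l - 2),
      forall (j : nat) v, v \in W (n + j%:Z) ->
        v *m N ^+ j \in W (n - j%:Z - 1) -> v \in W (n + j%:Z - 1)
    & forall (j : nat) w, w \in W (n - j%:Z) ->
        exists2 v, v \in W (n + j%:Z) & w - v *m N ^+ j \in W (n - j%:Z - 1)].

End Subspaces.

Section Complexification.
Context {R : realType}.

Definition cplx (m n : nat) (A : 'M[R]_(m, n)) : 'M[R[i]]_(m, n) :=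
  map_mx (real_complex R) A.

Definition conj_mx (m n : nat) (A : 'M[R[i]]_(m, n)) : 'M[R[i]]_(m, n) :=
  map_mx (@conjc R) A.

Context {d : nat}.

Definition conjv (U : {vspace 'rV[R[i]]_d}) : {vspace 'rV[R[i]]_d} :=
  vspace_of [set v | conj_mx v \in U].

Lemma mem_conjv U v : v \in conjv U <-> conj_mx v \in U.
Proof.
apply: (vspace_ofP (P := [set v | conj_mx v \in U])) => /= [|a u w uU wU].
  by rewrite /conj_mx map_mx0 mem0v.
by rewrite /conj_mx map_mxD map_mxZ memvD // memvZ.
Qed.

Definition cplxv (U : {vspace 'rV[R]_d}) : {vspace 'rV[R[i]]_d} :=
  vspace_of [set v | map_mx (@complex.Re R) v \in U /\
                     map_mx (@complex.Im R) v \in U].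

Lemma mem_cplxv U v : v \in cplxv U <->
  map_mx (@complex.Re R) v \in U /\ map_mx (@complex.Im R) v \in U.
Proof.
apply: (vspace_ofP (P := [set v | map_mx (@complex.Re R) v \in U /\
                     map_mx (@complex.Im R) v \in U])) => /=.
  by split; rewrite (_ : map_mx _ _ = 0) ?mem0v //; apply/matrixP => i j;
     rewrite !mxE.
move=> [a b] u w [uRe uIm] [wRe wIm]; split.
- rewrite (_ : map_mx _ _ = a *: map_mx (@complex.Re R) u
    - b *: map_mx (@complex.Im R) u + map_mx (@complex.Re R) w).
    by rewrite memvD ?memvB ?memvZ.
  by apply/matrixP => i j; rewrite !mxE /=; case: (u i j); case: (w i j).
- rewrite (_ : map_mx _ _ = a *: map_mx (@complex.Im R) u
    + b *: map_mx (@complex.Re R) u + map_mx (@complex.Im R) w).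
    by rewrite memvD ?memvD ?memvZ.
  by apply/matrixP => i j; rewrite !mxE /=; case: (u i j); case: (w i j).
Qed.

End Complexification.

Section Flags.
Context {R : realType} {d : nat}.

(* Filtrations of V_C.  Q is recorded in the type because the topology
   depends on it. *)
Definition flag (Q : 'M[R]_d) : Type := int -> {vspace 'rV[R[i]]_d}.

Context {Q : 'M[R]_d}.
Implicit Types (F : flag Q) (g : 'M[R[i]]_d).

Definition act F g : flag Q := fun p => (linfun (mulmxr g) @: F p)%VS.

Definition GC : set 'M[R[i]]_d := isometry_group (cplx Q).
Definition GR : set 'M[R]_d := isometry_group Q.

Definition orbC F : set (flag Q) := [set F' | exists2 g, GC g & F' = act F g].
Definition orbR F : set (flag Q) :=
  [set F' | exists2 g, GR g & F' = act F (cplx g)].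

(* Each G-orbit is open, and carries the topology of the homogeneous space
   G / Stab(F): the sets [set act F g | g in GC & near 1] form a basis of
   neighbourhoods of F. *)
Definition flag_open (U : set (flag Q)) : Prop :=
  forall F, U F -> \forall g \near nbhs (1%:M : 'M[R[i]]_d), GC g -> U (act F g).

Lemma flag_openT : flag_open setT.
Proof. by move=> F _; exact: nearW. Qed.

Lemma flag_openI : setI_closed flag_open.
Proof.
move=> A B oA oB F [AF BF].
by apply: filterS2 (oA F AF) (oB F BF) => g HA HB Gg; split; [exact: HA|exact: HB].
Qed.

Lemma flag_open_bigU (I : Type) (f : I -> set (flag Q)) :
  (forall i, flag_open (f i)) -> flag_open (\bigcup_i f i).
Proof.
move=> of_ F [i _ fiF]; apply: filterS (of_ i F fiF) => g Hg Gg.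
by exists i => //; exact: Hg.
Qed.

HB.instance Definition _ := gen_eqMixin (flag Q).
HB.instance Definition _ := gen_choiceMixin (flag Q).
HB.instance Definition _ :=
  isOpenTopological.Build (flag Q) flag_openT flag_openI flag_open_bigU.

Definition stabC F : {vspace 'M[R[i]]_d} :=
  vspace_of [set X | X \in lie_algebra (cplx Q) /\
    forall p v, v \in F p -> v *m X \in F p].

Definition stabR F : {vspace 'M[R]_d} :=
  vspace_of [set X | X \in lie_algebra Q /\
    forall p v, v \in F p -> v *m cplx X \in F p].

Lemma mem_stabC F X : X \in stabC F <->
  X \in lie_algebra (cplx Q) /\ forall p v, v \in F p -> v *m X \in F p.
Proof.
apply: (vspace_ofP (P := [set X | X \in lie_algebra (cplx Q) /\
    forall p v, v \in F p -> v *m X \in F p])) => /=.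
  by split=> [|p v _]; rewrite ?mulmx0 mem0v.
move=> a Y Z [Yg YF] [Zg ZF]; split=> [|p v vF]; first by rewrite memvD ?memvZ.
by rewrite mulmxDr -scalemxAr memvD ?memvZ ?YF ?ZF.
Qed.

Lemma mem_stabR F X : X \in stabR F <->
  X \in lie_algebra Q /\ forall p v, v \in F p -> v *m cplx X \in F p.
Proof.
apply: (vspace_ofP (P := [set X | X \in lie_algebra Q /\
    forall p v, v \in F p -> v *m cplx X \in F p])) => /=.
  by split=> [|p v _]; rewrite /cplx ?map_mx0 ?mulmx0 mem0v.
move=> a Y Z [Yg YF] [Zg ZF]; split=> [|p v vF]; first by rewrite memvD ?memvZ.
rewrite /cplx map_mxD map_mxZ mulmxDr -scalemxAr memvD ?memvZ //.
- exact: YF.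
- exact: ZF.
Qed.

(* The dimensions of the homogeneous manifolds G . F and G_R . F, over the
   complex numbers and over R respectively. *)
Definition cdim_orbC F : nat := (\dim (lie_algebra (cplx Q)) - \dim (stabC F))%N.
Definition rdim_orbR F : nat := (\dim (lie_algebra Q) - \dim (stabR F))%N.

(* Real codimension of G_R . F in G . F. *)
Definition rcodim_orbR F : nat := (2 * cdim_orbC F - rdim_orbR F)%N.

End Flags.

Section PeriodDomain.
Context {R : realType} {d : nat} {Q : 'M[R]_d}.
Implicit Types (F o : flag Q) (n : int) (h : int -> nat).

Definition form (u v : 'rV[R[i]]_d) : R[i] := (u *m cplx Q *m v^T) 0 0.

Definition hodge_filtration n F : Prop :=
  [/\ forall p, (F (p + 1)%R <= F p)%VS,
      (exists p, F p = fullv) /\ (exists p, F p = 0%VS)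
    & forall p, (F p + conjv (F (n - p + 1)%R))%VS = fullv /\
                (F p :&: conjv (F (n - p + 1)%R))%VS = 0%VS].

Definition hodge_piece n F (p : int) : {vspace 'rV[R[i]]_d} :=
  (F p :&: conjv (F (n - p)%R))%VS.

Definition weil_operator n F (C : 'M[R[i]]_d) : Prop :=
  forall p v, v \in hodge_piece n F p -> v *m C = ('i%C ^ (p - (n - p))) *: v.

Definition polarized n F : Prop :=
  (forall p u v, u \in F p -> v \in F (n - p + 1) -> form u v = 0) /\
  exists2 C, weil_operator n F C &
    forall v, v != 0 -> 0 < form (v *m C) (conj_mx v).

Definition polarized_hodge_structure n h F : Prop :=
  [/\ hodge_filtration n F,
      forall p, \dim (hodge_piece n F p) = h p
    & polarized n F].

(* D inside its compact dual orbC o, for a reference point o.  It is the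
   G_R-orbit of o; when n = 2m and h m = 0 the polarized Hodge structures form
   two orbits of the special orthogonal group, and D is the one through o. *)
Definition period_domain n h o : set (flag Q) :=
  orbC o `&` [set F | polarized_hodge_structure n h F].

Definition im_pinfty : set_system R[i] :=
  filter_from setT (fun c : R => [set z | c < complex.Im z]).

Definition bd (D : set (flag Q)) : set (flag Q) := closure D `\` D°.

(* O is a G_R-orbit in bd(D) of real codimension one in the compact dual. *)
Definition codim1_boundary_orbit n h o (O : set (flag Q)) : Prop :=
  [/\ exists F, [/\ orbC o F, O = orbR F & rcodim_orbR F = 1%N]
    & O `<=` bd (period_domain n h o)].

Definition nilpotent_orbit n h o (N : 'M[R]_d) F : Prop :=
  [/\ N \in lie_algebra Q /\ nilpotent_mx N,
      orbC o F,
      forall p v, v \in F p -> v *m cplx N \in F (p - 1)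
    & \forall z \near im_pinfty,
        period_domain n h o (act F (exp_nilp z (cplx N)))].

Definition reduced_limit (N : 'M[R]_d) F (Finf : flag Q) : Prop :=
  act F (exp_nilp z (cplx N)) @[z --> im_pinfty] --> Finf.

Definition minimal_degeneration n h o (N : 'M[R]_d) F : Prop :=
  nilpotent_orbit n h o N F /\
  exists Finf O, [/\ reduced_limit N F Finf, codim1_boundary_orbit n h o O
                   & O Finf].

(* The Deligne bigrading of the mixed Hodge structure (W, F): the unique
   decomposition of V_C that splits both filtrations and satisfies
     conj I^{p,q} = I^{q,p}  modulo the sum of the I^{r,s}, r < q, s < p. *)
Definition deligne_splitting (W : int -> {vspace 'rV[R]_d}) F
    (I : int -> int -> {vspace 'rV[R[i]]_d}) : Prop :=
  let I' k := I k.1 k.2 in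
  [/\ lsum setT I' = fullv /\
      (forall k, (I' k :&: lsum [set k' | k' <> k] I')%VS = 0%VS),
      forall p, F p = lsum [set k | p <= k.1] I',
      forall l, cplxv (W l) = lsum [set k | k.1 + k.2 <= l] I'
    & forall p q, let M := lsum [set k | k.1 < q /\ k.2 < p] I' in
        (conjv (I p q) + M)%VS = (I q p + M)%VS].

Definition typeI (N : 'M[R]_d) : Prop :=
  [/\ N <> 0, N ^+ 2 = 0 & \rank N = 1%N \/ \rank N = 2%N].

Definition typeII (N : 'M[R]_d) : Prop :=
  [/\ N ^+ 2 <> 0, N ^+ 3 = 0 & \rank N = 2%N].

(* Holomorphy on an open set U of a map to a homogeneous complex manifold of
   G: locally rho is the translate of a point by a holomorphic map to G. *)
Definition flag_holomorphic (U : set R[i]) (rho : R[i] -> flag Q) : Prop :=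
  forall z0, U z0 -> exists g : R[i] -> 'M[R[i]]_d,
    \forall z \near z0,
      [/\ GC (Q := Q) (g z), rho z = act (rho z0) (g z)
        & forall i j, derivable (fun w => g w i j) z 1].

Definition pseudoconcave_boundary_orbit n h o (O : set (flag Q)) : Prop :=
  codim1_boundary_orbit n h o O /\
  exists rho : R[i] -> flag Q,
    [/\ {within [set z | `|z| <= 1], continuous rho},
        flag_holomorphic [set z | `|z| < 1] rho,
        forall z, `|z| <= 1 -> closure (period_domain n h o) (rho z),
        O (rho 0)
      & forall z, `|z| = 1 -> period_domain n h o (rho z)].

End PeriodDomain.

(* Main.v *)
(* Let H(u, v) = i^(-n) Q(u, conj v), a hermitian form, and for a sign s let
   ind s U be the largest dimension of a subspace of U on which (-1)^s H is
   positive.  A point F of the compact dual lies in D if and only if ind s (F^p)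
   is at least its value at the reference point, for all p and s.  This index is
   lower semicontinuous, and at a boundary point it drops by at most the
   dimension of the radical of H on F^p, the intersection of F^p with the
   conjugate of F^(n-p+1).

   At the reduced limit F_oo of a minimal degeneration this radical is a line
   <e> for p = j0 and p = n - j0 + 1, where j0 = n - p_o in type I and
   j0 = m + 1 in type II, and zero for the other p, because F_oo^j and the
   conjugate of F_oo^k together contain all but one or two of the pieces I^{a,b}
   of the limit mixed Hodge structure.  The levels with zero radical stay correct
   near F_oo.  Hence it suffices to find X in the Lie algebra with X^3 = 0 such that
   F_oo^j0 exp(zX) contains, for every z <> 0, a definite subspace of sign
   (-1)^j0 with one dimension more than those of F_oo^j0: then
   z |-> F_oo exp(delta z X) is the required disc for small delta > 0.

   The hypothesis i^{r,n-r} <> 0 yields, for t = r or t = n - r, a vector f in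
   the intersection of F_oo^t and the conjugate of F_oo^(n-t) with
   (-1)^t H(f, f) > 0, and the condition on the parity of r gives H(f, f) the
   sign for which X = a /\ b works, with a = f or a = conj f and b a vector
   pairing nontrivially with e or with conj e. *)
From Pilot Require Import Defs.
From mathcomp Require Import all_boot all_order all_algebra.
From mathcomp Require Import complex.
From mathcomp Require Import all_classical all_reals all_analysis.
From mathcomp Require Import zify ring lra.
Import Order.TTheory GRing.Theory Num.Theory numFieldNormedType.Exports.
Import Pilot.Defs.
Local Open Scope classical_set_scope.
Local Open Scope ring_scope.

Set Implicit Arguments.
Unset Strict Implicit.
Unset Printing Implicit Defensive.

(** * Signature of Hermitian forms *)

Section ConjRules.
Context {R : realType}.
Implicit Types x y : R[i].

(** The gain has to hold at every nonzero z of a complex disc, and an infinitesimal isometry cannot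
    move [e] alone: [a /\ b] moves whatever pairs with [a] or with [b]. The sign of [f] decides how
    this is turned to advantage. If [f] lies in F^j0 with the wrong sign, nothing is lost by
    spoiling it: it is made to pair with the null vector [e], and a nondegenerate plane containing a
    null vector has a line of either sign. If [f] has the right sign and is orthogonal to F^j0, then
    [e] itself is pushed towards [f]. If 2 j0 = n + 1, the weight is odd, conjugation reverses
    signs, and [e] is pushed towards conj [f]. In type II [e] is real, hence orthogonal to all of
    F^m, and the partner used in type I does not exist. There [e] is pushed towards conj [f] by
    means of a real [y] pairing with [e], at the price of moving [f]; a second real vector [e0], of
    sign (-1)^(m+1) in the piece of level m, keeps the plane of the two images from degenerating. *)

Lemma cjM x y : (x * y)^* = x^* * y^*. Proof. exact: rmorphM. Qed.
Lemma cjD x y : (x + y)^* = x^* + y^*. Proof. exact: rmorphD. Qed.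
Lemma cjN x : (- x)^* = - x^*. Proof. exact: rmorphN. Qed.
Lemma cjB x y : (x - y)^* = x^* - y^*. Proof. exact: rmorphB. Qed.
Lemma cjV x : (x^-1)^* = (x^*)^-1. Proof. exact: fmorphV. Qed.
Lemma cj1 : (1 : R[i])^* = 1. Proof. exact: rmorph1. Qed.
Lemma cj0 : (0 : R[i])^* = 0. Proof. exact: rmorph0. Qed.
Lemma cj_nat n : (n%:R : R[i])^* = n%:R. Proof. exact: rmorph_nat. Qed.
Lemma cjX x n : (x ^+ n)^* = x^* ^+ n. Proof. exact: rmorphXn. Qed.
Lemma cj_sign n : ((-1) ^+ n : R[i])^* = (-1) ^+ n.
Proof. by rewrite cjX cjN cj1. Qed.

End ConjRules.

Section HermitianForm.
Context {R : realType} {d : nat} (H : 'M[R[i]]_d).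
Hypothesis Hherm : H^T = conj_mx H.
Implicit Types (u v w : 'rV[R[i]]_d) (s : bool) (U W P : {vspace 'rV[R[i]]_d}).

Definition hf u v : R[i] := (u *m H *m (conj_mx v)^T) 0 0.

Lemma hfDl u v w : hf (u + v) w = hf u w + hf v w.
Proof. by rewrite /hf !mulmxDl mxE. Qed.

Lemma hfZl a u w : hf (a *: u) w = a * hf u w.
Proof. by rewrite /hf -!scalemxAl mxE. Qed.

Lemma hfDr u v w : hf u (v + w) = hf u v + hf u w.
Proof. by rewrite /hf /conj_mx map_mxD linearD mulmxDr mxE. Qed.

Lemma hfZr a u w : hf u (a *: w) = a^* * hf u w.
Proof. by rewrite /hf /conj_mx map_mxZ linearZ -scalemxAr mxE. Qed.

Lemma hf0l w : hf 0 w = 0.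
Proof. by rewrite -(scale0r w) hfZl mul0r. Qed.

Lemma hf0r u : hf u 0 = 0.
Proof. by rewrite -(scale0r u) hfZr rmorph0 mul0r. Qed.

Lemma hfNl u w : hf (- u) w = - hf u w.
Proof. by rewrite -scaleN1r hfZl mulN1r. Qed.

Lemma hfNr u w : hf u (- w) = - hf u w.
Proof. by rewrite -scaleN1r hfZr rmorphN1 mulN1r. Qed.

Lemma hfZ2 a u : hf (a *: u) (a *: u) = a * a^* * hf u u.
Proof. by rewrite hfZl hfZr mulrA. Qed.

Lemma hf_sumr u (I : Type) (r : seq I) (F : I -> 'rV[R[i]]_d) :
  hf u (\sum_(i <- r) F i) = \sum_(i <- r) hf u (F i).
Proof. exact: (big_morph (hf u) (hfDr u) (hf0r u)). Qed.

Lemma hfBl u v w : hf (u - v) w = hf u w - hf v w.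
Proof. by rewrite hfDl hfNl. Qed.

Lemma hfBr u v w : hf u (v - w) = hf u v - hf u w.
Proof. by rewrite hfDr hfNr. Qed.

Lemma conj_mxK (m n : nat) : involutive (@conj_mx R m n).
Proof. by move=> A; apply/matrixP => i j; rewrite !mxE conjcK. Qed.

Lemma conj_mxM (m n p : nat) (A : 'M[R[i]]_(m, n)) (B : 'M[R[i]]_(n, p)) :
  conj_mx (A *m B) = conj_mx A *m conj_mx B.
Proof. by rewrite /conj_mx map_mxM. Qed.

Lemma conj_mx_tr (m n : nat) (A : 'M[R[i]]_(m, n)) :
  (conj_mx A)^T = conj_mx A^T.
Proof. by rewrite /conj_mx map_trmx. Qed.

Lemma hf_conj u v : (hf u v)^* = hf v u.
Proof.
rewrite /hf; set A := u *m H *m _.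
have -> : (A 0 0)^* = (conj_mx A)^T 0 0 by rewrite !mxE.
rewrite /A !conj_mxM conj_mx_tr conj_mxK !trmx_mul trmxK !conj_mx_tr.
by rewrite Hherm conj_mxK mulmxA.
Qed.

Lemma hf_real u : hf u u \is Num.real.
Proof. by apply/CrealP; rewrite hf_conj. Qed.

Lemma hf_eq0C u v : hf u v = 0 -> hf v u = 0.
Proof. by move=> h0; rewrite -hf_conj h0 rmorph0. Qed.

Definition definite s U := forall v, v \in U -> v != 0 -> 0 < (-1) ^+ s * hf v v.
Definition semidefinite s U := forall v, v \in U -> 0 <= (-1) ^+ s * hf v v.

Lemma definite_semi s U : definite s U -> semidefinite s U.
Proof.
move=> dU v vU; have [->|v0] := eqVneq v 0; first by rewrite hf0l mulr0.
exact/ltW/dU.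
Qed.

Lemma definiteS s U W : (U <= W)%VS -> definite s W -> definite s U.
Proof. by move=> /subvP UW dW v /UW; exact: dW. Qed.

Lemma definite0 s : definite s 0%VS.
Proof. by move=> v; rewrite memv0 => ->. Qed.

Lemma signN s (x : R[i]) : (-1) ^+ (~~ s) * x = - ((-1) ^+ s * x).
Proof. by case: s; rewrite !(expr0, expr1) ?mulN1r ?mul1r ?opprK. Qed.

Lemma definite_semi_cap0 s U W :
  definite s U -> semidefinite (~~ s) W -> (U :&: W)%VS = 0%VS.
Proof.
move=> dU sW; apply/eqP; rewrite -subv0; apply/subvP => v /memv_capP[vU vW].
rewrite memv0; apply: contraT => v0.
by have := sW v vW; rewrite signN oppr_ge0 lt_geF // dU.
Qed.

Definition perp P : {vspace 'rV[R[i]]_d} :=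
  vspace_of [set v | forall p, p \in P -> hf v p = 0].

Lemma mem_perp P v : v \in perp P <-> forall p, p \in P -> hf v p = 0.
Proof.
apply: (vspace_ofP (P := [set v | forall p, p \in P -> hf v p = 0])).
  by move=> p _; rewrite hf0l.
by move=> a x y Hx Hy p pP; rewrite hfDl hfZl Hx // Hy // mulr0 addr0.
Qed.

(** Membership in [perp P] amounts to [\dim P] linear equations, one for each basis vector, and
    rank-nullity applies. *)
Lemma dim_cap_perp U P : (\dim U <= \dim (U :&: perp P) + \dim P)%N.
Proof.
pose B : 'M[R[i]]_(\dim P, d) := \matrix_i (vbasis P)`_i.
pose f := linfun (mulmxr (H *m (conj_mx B)^T)) : 'Hom('rV[R[i]]_d, 'rV[R[i]]_(\dim P)).
rewrite -(limg_ker_dim f U) leq_add //.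
  apply/dimvS/subvP => v /memv_capP[vU]; rewrite memv_ker lfunE /= => /eqP v0.
  apply/memv_capP; split=> //; apply/mem_perp => p /coord_vbasis ->.
  have vB (i : 'I_(\dim P)) : hf v (vbasis P)`_i = 0.
    have := congr1 (fun x : 'rV[R[i]]_(\dim P) => x 0 i) v0; rewrite mulmxA.
    rewrite [RHS]mxE => <-; rewrite /hf !mxE; apply: eq_bigr => j _.
    by rewrite !mxE.
  by rewrite hf_sumr big1 // => i _; rewrite hfZr vB mulr0.
by rewrite (leq_trans (dimvS (subvf _))) // dimvf /dim /= mul1n.
Qed.

Definition rad U := (U :&: perp U)%VS.

(** The degenerate case of Cauchy-Schwarz: if [hf v w] were nonzero, moving [w] far enough along the
    null vector [v] would give the form a value of the wrong sign. *)
Lemma semi_null s U v : semidefinite s U -> v \in U -> hf v v = 0 ->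
  forall w, w \in U -> hf v w = 0.
Proof.
move=> sU vU v0 w wU; apply: contraTeq isT => a0; set a := hf v w in a0.
pose b := (-1) ^+ s * hf w w.
have aa0 : a * a^* != 0 by rewrite mulf_neq0 // conjC_eq0.
(* Since [v] is isotropic, the form is affine in [l] along the line considered below; this [l] makes
   its signed value equal to -1. *)
pose l := (-1) ^+ s * ((b + 1) / (2 * (a * a^*))).
have bR : b^* = b by apply/CrealP; rewrite realM ?hf_real // realrEsign //.
have sR : ((-1) ^+ s : R[i])^* = (-1) ^+ s by rewrite rmorphXn rmorphN1.
have lR : l^* = l.
  by rewrite /l !(cjM, cjV, cjD, cj1, cj_nat, bR, sR, conjCK) [a^* * a]mulrC.
have ss : (-1) ^+ s * (-1) ^+ s = 1 :> R[i].
  by rewrite -expr2 sqrr_sign.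
have := sU (w - (l * a^*) *: v).
rewrite rpredB ?rpredZ // => /(_ isT).
rewrite hfBl !hfBr !hfZl !hfZr v0 -[hf w v]hf_conj -/a cjM conjCK lR.
rewrite !mulr0 subr0.
have -> : (-1) ^+ s * (hf w w - l * a * a^* - l * a^* * a) = -1.
  have -> : (-1) ^+ s * (hf w w - l * a * a^* - l * a^* * a) =
     b - ((-1) ^+ s * (-1) ^+ s) * ((b + 1) / (2 * (a * a^*)) * (2 * (a * a^*))).
    have E (K : comNzRingType) (sg h b' a' a'' iv : K) : sg * (h - sg * ((b' + 1) * iv) * a' * a''
        - sg * ((b' + 1) * iv) * a'' * a') = sg * h - sg * sg * ((b' + 1) * iv * (2 * (a' * a''))).
      ring.
    exact: E.
  by rewrite ss mul1r divfK ?opprD ?addNKr // mulf_neq0 ?pnatr_eq0.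
by rewrite oppr_ge0 ler10.
Qed.

Lemma ind_subproof s U :
  exists k, `[< exists2 P, (P <= U)%VS & \dim P = k /\ definite s P >].
Proof.
exists 0%N; apply/asboolP; exists 0%VS; first exact: sub0v.
by split; [exact: dimv0 | exact: definite0].
Qed.

Lemma ind_bound s U k :
  `[< exists2 P, (P <= U)%VS & \dim P = k /\ definite s P >] -> (k <= \dim U)%N.
Proof. by move=> /asboolP[P PU [<- _]]; exact: dimvS. Qed.

Definition ind s U := ex_maxn (ind_subproof s U) (@ind_bound s U).

Lemma ind_ex s U : exists P, [/\ (P <= U)%VS, \dim P = ind s U & definite s P].
Proof. by rewrite /ind; case: ex_maxnP => k /asboolP[P PU [dP sP]] _; exists P. Qed.

Lemma ind_max s U P : (P <= U)%VS -> definite s P -> (\dim P <= ind s U)%N.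
Proof.
rewrite /ind; case: ex_maxnP => k _ kmax PU dP.
by apply: kmax; apply/asboolP; exists P.
Qed.

Lemma indS s U W : (U <= W)%VS -> (ind s U <= ind s W)%N.
Proof.
have [P [PU <- dP]] := ind_ex s U => UW.
exact: ind_max (subv_trans PU UW) dP.
Qed.

(** A definite subspace meets a semidefinite one of the opposite sign only in 0, so dimensions add
    up inside [U]. *)
Lemma ind_semi s U W : (W <= U)%VS -> semidefinite (~~ s) W ->
  (\dim W + ind s U <= \dim U)%N.
Proof.
have [P [PU <- dP]] := ind_ex s U => WU sW.
rewrite addnC -dimv_disjoint_sum ?(definite_semi_cap0 dP sW) //.
by apply: dimvS; rewrite subv_add PU.
Qed.

Definition orth U W := forall u w, u \in U -> w \in W -> hf u w = 0.

Lemma hf_add_orth u w : hf u w = 0 -> hf (u + w) (u + w) = hf u u + hf w w.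
Proof. by move=> uw; rewrite hfDl !hfDr uw (hf_eq0C uw) addr0 add0r. Qed.

Lemma orth_semi s U W : orth U W -> semidefinite s U -> semidefinite s W ->
  semidefinite s (U + W).
Proof.
move=> oUW sU sW _ /memv_addP[u uU [w wW ->]].
rewrite (hf_add_orth (oUW _ _ uU wW)).
by rewrite mulrDr; apply: addr_ge0; [exact: sU | exact: sW].
Qed.

Lemma orth_definite s U W : orth U W -> definite s U -> definite s W ->
  definite s (U + W).
Proof.
move=> oUW sU sW _ /memv_addP[u uU [w wW ->]].
rewrite (hf_add_orth (oUW _ _ uU wW)).
rewrite mulrDr.
have [->|u0] := eqVneq u 0; first by rewrite add0r hf0l mulr0 add0r; exact: sW.
by move=> _; apply: ltr_wpDr; [exact: (definite_semi sW) | exact: sU].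
Qed.

Lemma orth_cap0 s U W : orth U W -> definite s U -> (U :&: W)%VS = 0%VS.
Proof.
move=> oUW sU; apply/eqP; rewrite -subv0; apply/subvP => v /memv_capP[vU vW].
rewrite memv0; apply: contraT => v0.
by have := sU v vU v0; rewrite (oUW v v) // mulr0 ltxx.
Qed.

Lemma ind_orth s U W : orth U W -> (ind s U + ind s W <= ind s (U + W))%N.
Proof.
have [P [PU <- dP]] := ind_ex s U; have [N [NW <- dN]] := ind_ex s W => oUW.
have oPN : orth P N.
  by move=> u w uP wN; apply: oUW; [exact: subvP PU u uP|exact: subvP NW w wN].
rewrite -dimv_disjoint_sum ?(orth_cap0 oPN dP) //; apply: ind_max; first exact: addvS.
exact: orth_definite.
Qed.

Lemma mem_rad U v : v \in rad U <-> v \in U /\ forall w, w \in U -> hf v w = 0.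
Proof.
split=> [/memv_capP[vU /mem_perp]//|[vU vp]].
by apply/memv_capP; split=> //; exact/mem_perp.
Qed.

Lemma rad_semi s U : semidefinite s (rad U).
Proof. by move=> v /mem_rad[vU vp]; rewrite vp // mulr0. Qed.

(** Sylvester's law of inertia with a radical. The harder inequality comes from the orthogonal
    complement [U'] in [U] of a maximal definite [P]: maximality makes [U'] semidefinite of the
    other sign, and its null vectors are radical by [semi_null]. *)
Lemma ind_sum s U : (ind s U + ind (~~ s) U + \dim (rad U))%N = \dim U.
Proof.
have [P [PU dimP dP]] := ind_ex s U.
have oPr : orth P (rad U).
  by move=> u w uP /mem_rad[_ /(_ u)] wu; rewrite hf_eq0C // wu // (subvP PU).
apply/eqP; rewrite eqn_leq; apply/andP; split.
  rewrite -dimP addnAC -dimv_disjoint_sum ?(orth_cap0 oPr dP) //.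
  apply: ind_semi; first by rewrite subv_add PU capvSl.
  rewrite negbK; apply: orth_semi oPr _ _; [exact: definite_semi|exact: rad_semi].
pose U' := (U :&: perp P)%VS.
have oPU' : orth P U'.
  by move=> u w uP /memv_capP[_ /mem_perp] wp; rewrite hf_eq0C // wp.
have PU'0 := orth_cap0 oPU' dP.
have PU' : (P + U')%VS = U.
  apply/eqP; rewrite eqEdim subv_add PU capvSl /= dimv_disjoint_sum // addnC.
  exact: dim_cap_perp.
have sU' : semidefinite (~~ s) U'.
  move=> v vU'; rewrite signN oppr_ge0.
  have svR : (-1) ^+ s * hf v v \is Num.real by rewrite realM ?hf_real.
  rewrite real_leNgt ?real0 //; apply/negP => v_gt0.
  have v0 : v != 0 by apply: contraTneq v_gt0 => ->; rewrite hf0l mulr0 ltxx.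
  have dPv : definite s (P + <[v]>).
    apply: orth_definite dP _.
      by move=> u w uP /vlineP[a ->]; rewrite hfZr oPU' // mulr0.
    move=> _ /vlineP[a ->]; rewrite scaler_eq0 negb_or => /andP[a0 _].
    by rewrite hfZ2 mulrCA mulr_gt0 // mul_conjC_gt0.
  have : (\dim (P + <[v]>) <= ind s U)%N.
    apply: ind_max dPv; rewrite -PU'; apply: addvS; first exact: subvv.
    by rewrite -memvE.
  rewrite dimv_disjoint_sum ?dim_vline ?v0 ?dimP ?addn1 ?ltnn //.
  apply/eqP; rewrite -subv0 -PU'0; apply: capvS; first exact: subvv.
  by rewrite -memvE.
have radU' : (rad U' <= rad U)%VS.
  apply/subvP => v /mem_rad[vU' vp]; apply/mem_rad; split.
    by move: vU' => /memv_capP[].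
  move=> w; rewrite -PU' => /memv_addP[p pP [w' w'U' ->]].
  by rewrite hfDr (vp w') // (hf_eq0C (oPU' _ _ pP vU')) addr0.
pose N := (U' :\: rad U')%VS.
have dN : definite (~~ s) N.
  move=> v vN v0; have vU' : v \in U' by apply: subvP (diffvSl _ _) v vN.
  rewrite lt_def sU' // andbT; apply: contraNneq v0 => /eqP.
  rewrite mulf_eq0 signr_eq0 /= => /eqP hv.
  have vr : v \in rad U' by apply/mem_rad; split=> //; exact: semi_null sU' vU' hv.
  by rewrite -memv0 -(capv_diff U' (rad U')); apply/memv_capP; split.
have <- : (\dim P + \dim U' = \dim U)%N by rewrite -dimv_disjoint_sum ?PU'.
rewrite dimP -addnA leq_add2l.
rewrite -(dimv_cap_compl U' (rad U')) addnC leq_add //.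
  by apply: ind_max dN; rewrite (subv_trans (diffvSl _ _)) // capvSl.
by apply: dimvS; apply: subv_trans radU'; exact: capvSr.
Qed.

Lemma ind_nondeg s U : rad U = 0%VS -> (ind s U + ind (~~ s) U)%N = \dim U.
Proof. by move=> r0; rewrite -(ind_sum s U) r0 dimv0 addn0. Qed.

(** Positivity on images of nonzero vectors also makes [M] injective on [P], whence the
    dimension. *)
Lemma definite_image s P (M : 'M[R[i]]_d) :
  (forall u, u \in P -> u != 0 -> 0 < (-1) ^+ s * hf (u *m M) (u *m M)) ->
  definite s (linfun (mulmxr M) @: P)%VS /\
  \dim (linfun (mulmxr M) @: P) = \dim P.
Proof.
move=> pos; split=> [_ /memv_imgP[v vP ->]|]; first rewrite lfunE /=.
  by move=> vg0; apply: pos => //; apply: contraNneq vg0 => ->; rewrite mul0mx.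
have := limg_ker_dim (linfun (mulmxr M)) P.
have -> : (P :&: lker (linfun (mulmxr M)) = 0)%VS; last by rewrite dimv0.
apply/eqP; rewrite -subv0; apply/subvP => v /memv_capP[vP].
rewrite memv_ker lfunE /= memv0 => /eqP vg; apply: contraT => v0.
by have := pos v vP v0; rewrite vg hf0l mulr0 ltxx.
Qed.

End HermitianForm.

(** * Quantitative openness of definiteness *)

Section Coercivity.
Context {R : realType} {d : nat} (H : 'M[R[i]]_d).
Hypothesis Hherm : H^T = conj_mx H.
Implicit Types (u v w : 'rV[R[i]]_d) (s : bool) (U W P : {vspace 'rV[R[i]]_d}).
Implicit Types (g E : 'M[R[i]]_d).

(** Valued in [R[i]], whose partial order already compares the real values taken by [hf]. *)
Definition l1norm v : R[i] := \sum_j `|v 0 j|.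

Lemma l1norm_ge0 v : 0 <= l1norm v.
Proof. exact: sumr_ge0. Qed.

Lemma l1norm0 : l1norm 0 = 0.
Proof. by rewrite /l1norm big1 // => j _; rewrite mxE normr0. Qed.

Lemma l1norm_gt0 v : v != 0 -> 0 < l1norm v.
Proof.
move=> v0; rewrite lt_def l1norm_ge0 andbT; apply: contra v0.
rewrite /l1norm psumr_eq0 // => /allP v0; apply/eqP/rowP => j; rewrite mxE.
by apply: normr0_eq0; apply/eqP; exact: (v0 j (mem_index_enum j)).
Qed.

Lemma l1normD u v : l1norm (u + v) <= l1norm u + l1norm v.
Proof.
by rewrite /l1norm -big_split ler_sum // => j _; rewrite mxE ler_normD.
Qed.

Lemma l1normZ a v : l1norm (a *: v) = `|a| * l1norm v.
Proof. by rewrite /l1norm big_distrr; apply: eq_bigr => j _; rewrite mxE normrM. Qed.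

Lemma l1norm_mul v E e : 0 <= e -> (forall i j, `|E i j| <= e) ->
  l1norm (v *m E) <= e * d%:R * l1norm v.
Proof.
move=> e0 Ee; rewrite /l1norm mulrC.
apply: (@le_trans _ _ (\sum_(j < d) \sum_(i < d) e * `|v 0 i|)); last first.
  by rewrite sumr_const card_ord -mulr_sumr -[leLHS]mulr_natr [e * \sum_i _]mulrC mulrA.
apply: ler_sum => j _; rewrite mxE; apply: le_trans (ler_norm_sum _ _ _) _.
by apply: ler_sum => i _; rewrite normrM mulrC ler_wpM2r.
Qed.

Definition entry_sum : R[i] := \sum_i \sum_j `|H i j|.

Lemma entry_sum_ge0 : 0 <= entry_sum.
Proof. by apply: sumr_ge0 => i _; exact: sumr_ge0. Qed.

Lemma norm_coord_le v j : `|v 0 j| <= l1norm v.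
Proof. by rewrite /l1norm (bigD1 j) //= lerDl sumr_ge0. Qed.

Lemma hf_bound u v : `|hf H u v| <= entry_sum * l1norm u * l1norm v.
Proof.
have -> : hf H u v = \sum_i \sum_j u 0 i * H i j * (v 0 j)^*.
  rewrite /hf mxE exchange_big; apply: eq_bigr => j _ /=.
  by rewrite !mxE big_distrl.
rewrite /entry_sum !big_distrl; apply: le_trans (ler_norm_sum _ _ _) _.
apply: ler_sum => i _; rewrite !big_distrl; apply: le_trans (ler_norm_sum _ _ _) _.
apply: ler_sum => j _ /=; rewrite !normrM norm_conjC [`|u _ _| * _]mulrC.
by rewrite !ler_pM ?mulr_ge0 ?norm_coord_le.
Qed.

(** Induction on the dimension takes the place of compactness of the unit sphere. One vector [w] is
    split off; the constant for [P] is half the smaller of those for [w] and for its orthogonal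
    complement in [P], because (a + b)^2 <= 2 a^2 + 2 b^2. *)
Lemma definite_coercive s P : definite H s P ->
  exists2 c, 0 < c & forall v, v \in P -> c * l1norm v ^+ 2 <= (-1) ^+ s * hf H v v.
Proof.
have [n] := ubnP (\dim P); elim: n P => // n IH P dimP dP.
have [->|P0] := eqVneq P 0%VS.
  exists 1 => // v; rewrite memv0 => /eqP ->.
  by rewrite l1norm0 hf0l mulr0 expr0n mulr0.
pose w := vpick P; have w0 : w != 0 by rewrite vpick0.
have wP : w \in P := memv_pick P.
have hw : 0 < (-1) ^+ s * hf H w w := dP w wP w0.
have hw0 : hf H w w != 0 by apply: contraTneq hw => ->; rewrite mulr0 ltxx.
pose P' := (P :&: perp H <[w]>)%VS.
have P'P : (P' <= P)%VS := capvSl _ _.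
have [|c' c'0 Hc'] := IH P' _ (definiteS P'P dP).
  have : (\dim P' < \dim P)%N.
    rewrite ltn_neqAle dimvS // andbT; apply: contraNneq hw0 => dd.
    have PE : P' = P by apply/eqP; rewrite eqEdim P'P dd leqnn.
    have : w \in P' by rewrite PE.
    by move=> /memv_capP[_ /mem_perp/(_ w)]; rewrite memv_line => /(_ isT) ->.
  by move=> lt; rewrite (leq_trans lt).
pose c'' := (-1) ^+ s * hf H w w / l1norm w ^+ 2.
have lw : 0 < l1norm w ^+ 2 by rewrite exprn_gt0 ?l1norm_gt0.
have c''0 : 0 < c'' by rewrite divr_gt0.
have [c [c0 cc' cc'']] : exists c, [/\ 0 < c, c * 2 <= c' & c * 2 <= c''].
  have := real_leVge (gtr0_real c'0) (gtr0_real c''0) => /orP[le|le].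
    by exists (c' / 2); rewrite divfK ?pnatr_eq0 // divr_gt0 // ltr0n.
  by exists (c'' / 2); rewrite divfK ?pnatr_eq0 // divr_gt0 // ltr0n.
exists c => // v vP.
pose a := hf H v w / hf H w w; pose v' := v - a *: w.
have v'w : hf H v' w = 0 by rewrite /v' hfBl hfZl /a divfK // subrr.
have v'P' : v' \in P'.
  apply/memv_capP; split; first by rewrite rpredB ?rpredZ.
  by apply/mem_perp => _ /vlineP[b ->]; rewrite hfZr v'w mulr0.
have vE : v = v' + a *: w by rewrite subrK.
have -> : hf H v v = hf H v' v' + a * a^* * hf H w w.
  by rewrite {1 2}vE hf_add_orth ?hfZ2 // hfZr v'w mulr0.
have tri : l1norm v ^+ 2 <= 2 * l1norm v' ^+ 2 + 2 * (a * a^* * l1norm w ^+ 2).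
  have le1 : l1norm v <= l1norm v' + `|a| * l1norm w.
    by rewrite {1}vE -l1normZ l1normD.
  apply: (@le_trans _ _ ((l1norm v' + `|a| * l1norm w) ^+ 2)).
    by rewrite lerXn2r // nnegrE ?l1norm_ge0 // addr_ge0 ?mulr_ge0 ?l1norm_ge0.
  rewrite -normCK -subr_ge0.
  have -> : 2 * l1norm v' ^+ 2 + 2 * (`|a| ^+ 2 * l1norm w ^+ 2) -
    (l1norm v' + `|a| * l1norm w) ^+ 2 = (l1norm v' - `|a| * l1norm w) ^+ 2.
    by ring.
  rewrite -realEsqr realB ?realM ?normr_real // ger0_real ?l1norm_ge0 //.
apply: le_trans (ler_wpM2l (ltW c0) tri) _.
rewrite mulrDr [X in _ <= X]mulrDr; apply: lerD.
  by apply: le_trans (Hc' v' v'P'); rewrite mulrA ler_wpM2r // exprn_ge0 ?l1norm_ge0.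
rewrite [X in X <= _]mulrA (mulrCA (c * 2)) [X in _ <= X](mulrCA _ (a * a^*)).
rewrite ler_wpM2l ?mul_conjC_ge0 //.
by rewrite -[X in _ <= X](divfK (lt0r_neq0 lw)) ler_wpM2r // ltW.
Qed.

Definition close_to_1 (e : R[i]) g := forall i j, `|(g - 1%:M) i j| < e.

Lemma definite_open s P : definite H s P ->
  exists2 e, 0 < e & forall g, close_to_1 e g ->
    definite H s (linfun (mulmxr g) @: P)%VS /\
    \dim (linfun (mulmxr g) @: P) = \dim P.
Proof.
move=> dP; have [c c0 Hc] := definite_coercive dP.
pose K := entry_sum + 1; have K0 : 0 < K by rewrite ltr_wpDl ?entry_sum_ge0.
(* The perturbation changes the form by three terms, each at most [entry_sum * t * l1norm v ^+ 2]
   with t <= c / D. The summand 3 K keeps their total below the coercivity bound; the summand [c]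
   gives t <= 1, used for the term quadratic in [x]. *)
pose D := c + 3 * K.
have D0 : 0 < D by rewrite addr_gt0 // mulr_gt0.
(* [d.+1] rather than [d] keeps [e] positive when [d] is 0. *)
pose e := c / D / d.+1%:R.
have e0 : 0 < e by rewrite !divr_gt0.
exists e => // g Hg.
have pos v : v \in P -> v != 0 -> 0 < (-1) ^+ s * hf H (v *m g) (v *m g).
  move=> vP v0; pose E := g - 1%:M; pose x := v *m E.
  have -> : v *m g = v + x by rewrite /x mulmxBr mulmx1 addrC subrK.
  have lv := l1norm_gt0 v0.
  pose t := e * d%:R.
  have t0 : 0 <= t by rewrite mulr_ge0 // ltW.
  have tle : t <= c / D.
    rewrite /t /e -mulrA ger_pMr ?divr_gt0 //.
    by rewrite mulrC ler_pdivrMr ?ltr0n // mul1r ler_nat.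
  have t1 : t <= 1.
    apply: le_trans tle _; rewrite ler_pdivrMr // mul1r lerDl ltW // mulr_gt0 //.
  have xle : l1norm x <= t * l1norm v.
    by apply: l1norm_mul => [|i j]; apply: ltW.
  have bnd : `|hf H v x + hf H x v + hf H x x| < c * l1norm v ^+ 2.
    apply: (@le_lt_trans _ _ (entry_sum * (3 * t) * l1norm v ^+ 2)).
      have b1 : `|hf H v x| <= entry_sum * t * l1norm v ^+ 2.
        apply: le_trans (hf_bound _ _) _.
        have -> : entry_sum * t * l1norm v ^+ 2 = entry_sum * l1norm v * (t * l1norm v).
          by ring.
        by rewrite ler_wpM2l ?mulr_ge0 ?entry_sum_ge0 ?l1norm_ge0.
      have b2 : `|hf H x v| <= entry_sum * t * l1norm v ^+ 2.
        by rewrite -(hf_conj Hherm) norm_conjC.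
      have b3 : `|hf H x x| <= entry_sum * t * l1norm v ^+ 2.
        apply: le_trans (hf_bound _ _) _.
        have -> : entry_sum * t * l1norm v ^+ 2 = entry_sum * (t * l1norm v) * l1norm v.
          by ring.
        rewrite ler_pM ?mulr_ge0 ?entry_sum_ge0 ?l1norm_ge0 //.
          by rewrite ler_wpM2l ?entry_sum_ge0.
        by apply: le_trans xle _; rewrite ler_piMl ?l1norm_ge0.
      apply: le_trans (ler_normD _ _) _.
      have -> : entry_sum * (3 * t) * l1norm v ^+ 2 =
        (entry_sum * t * l1norm v ^+ 2 + entry_sum * t * l1norm v ^+ 2) +
         entry_sum * t * l1norm v ^+ 2 by ring.
      rewrite lerD //; apply: le_trans (ler_normD _ _) _; exact: lerD.
    rewrite ltr_pM2r ?exprn_gt0 //.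
    apply: (@le_lt_trans _ _ (entry_sum * (3 * (c / D)))).
      by rewrite ler_wpM2l ?entry_sum_ge0 // ler_wpM2l.
    have -> : entry_sum * (3 * (c / D)) = c * (entry_sum * 3 / D).
      by ring.
    rewrite gtr_pMr // ltr_pdivrMr // mul1r /D mulrC.
    apply: (@lt_le_trans _ _ (3 * K)); first by rewrite ltr_pM2l // /K ltrDl.
    by rewrite lerDr ltW.
  have -> : hf H (v + x) (v + x) = hf H v v + (hf H v x + hf H x v + hf H x x).
    by rewrite hfDl !hfDr; ring.
  set r := hf H v x + _ + _ in bnd *.
  have rR : r^* = r.
    by rewrite /r !cjD !(hf_conj Hherm) [hf H x v + _]addrC.
  rewrite mulrDr -ltrBlDr add0r.
  apply: lt_le_trans (Hc v vP); apply: le_lt_trans bnd.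
  have -> : `|r| = `|(-1) ^+ s * r| by rewrite normrM normrX normrN1 expr1n mul1r.
  rewrite -normrN; apply: real_ler_norm.
  by rewrite realN realM ?realX ?realN ?real1 //; apply/CrealP.
exact: definite_image pos.
Qed.

Lemma ind_open s U : exists2 e, 0 < e & forall g, close_to_1 e g ->
  (ind H s U <= ind H s (linfun (mulmxr g) @: U)%VS)%N.
Proof.
have [P [PU <- /definite_open[e e0 He]]] := ind_ex H s U.
exists e => // g /He[dPg <-].
by apply: ind_max dPg; exact: limgS.
Qed.

End Coercivity.

(** * The topology of the compact dual *)

Section FlagTopology.
Context {R : realType} {d : nat} {Q : 'M[R]_d}.
Implicit Types (F : flag Q) (g X : 'M[R[i]]_d).

Lemma mem_act F g p v :
  reflect (exists2 u, u \in F p & v = u *m g) (v \in act F g p).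
Proof.
apply: (iffP memv_imgP) => [[u uF ->]|[u uF ->]]; exists u => //;
  by rewrite lfunE.
Qed.

Lemma act_comp F g g' : act (act F g) g' = act F (g *m g').
Proof.
apply: funext => p; apply/vspaceP => v; apply/mem_act/mem_act.
  by move=> [_ /mem_act[u uF ->] ->]; exists u => //; rewrite mulmxA.
by move=> [u uF ->]; exists (u *m g); [apply/mem_act; exists u|rewrite mulmxA].
Qed.

Lemma act1 F : act F 1%:M = F.
Proof.
apply: funext => p; apply/vspaceP => v; apply/mem_act/idP.
  by move=> [u uF ->]; rewrite mulmx1.
by move=> vF; exists v; rewrite ?mulmx1.
Qed.

Lemma GC1 : GC (Q := Q) 1%:M.
Proof. by split; rewrite ?det1 // trmx1 mul1mx mulmx1. Qed.

Lemma GCM g g' : GC (Q := Q) g -> GC (Q := Q) g' -> GC (Q := Q) (g *m g').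
Proof.
move=> [gQ dg] [gQ' dg']; split; last by rewrite det_mulmx dg dg' mulr1.
by rewrite trmx_mul mulmxA -(mulmxA g) -(mulmxA g) gQ' gQ.
Qed.

Lemma GC_inj g (v : 'rV[R[i]]_d) : GC (Q := Q) g -> v *m g = 0 -> v = 0.
Proof.
move=> [_ dg] vg; have gU : g \in unitmx by rewrite unitmxE dg unitr1.
by rewrite -[v](mulmxK gU) vg mul0mx.
Qed.

Lemma dim_act F g p : GC (Q := Q) g -> \dim (act F g p) = \dim (F p).
Proof.
move=> Gg; have := limg_ker_dim (linfun (mulmxr g)) (F p).
have -> : (F p :&: lker (linfun (mulmxr g)) = 0)%VS; last by rewrite dimv0.
apply/eqP; rewrite -subv0; apply/subvP => v /memv_capP[_].
by rewrite memv_ker lfunE /= memv0 => /eqP /(GC_inj Gg) ->.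
Qed.

Lemma orbC_act o F g : orbC o F -> GC (Q := Q) g -> orbC o (act F g).
Proof.
by move=> [g0 Gg0 ->] Gg; exists (g0 *m g); rewrite ?act_comp //; exact: GCM.
Qed.

Lemma nbhs_mxP g (A : set 'M[R[i]]_d) : nbhs g A <->
  exists2 e, 0 < e & forall g', (forall i j, `|(g' - g) i j| < e) -> A g'.
Proof.
split=> [/nbhs_ballP[e /= e0 H]|[e e0 H]].
  exists e => // g' Hg; apply: H; split=> // i j.
  by rewrite -ball_normE /= distrC; have := Hg i j; rewrite !mxE.
apply/nbhs_ballP; exists e => // g' [_ Hg]; apply: H => i j.
by have := Hg i j; rewrite -ball_normE /= distrC !mxE.
Qed.

Lemma entry_le (A : 'M[R[i]]_d) i j : `|A i j| <= entry_sum A.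
Proof.
rewrite /entry_sum (bigD1 i) //= (bigD1 j) //= -addrA lerDl.
by rewrite addr_ge0 ?sumr_ge0 // => k _; exact: sumr_ge0.
Qed.

(** Open sets are given by a condition at each of their points, so small translates of [F] have to
    be shown to contain an open set around [F]. The translates by an open [B] around 1 form one: for
    [g0] in [B], [g0 *m g] stays in [B] when [g] is close to 1. *)
Lemma nbhs_flagP F (A : set (flag Q)) : nbhs F A <->
  exists2 e, 0 < e & forall g, close_to_1 e g -> GC (Q := Q) g -> A (act F g).
Proof.
split.
  rewrite nbhsE => -[U [oU UF] UA].
  have /nbhs_mxP[e e0 He] := oU F UF.
  by exists e => // g cg Gg; apply/UA/He.
move=> [e e0 He]; rewrite nbhsE.
have : nbhs (1%:M : 'M[R[i]]_d) (close_to_1 e) by apply/nbhs_mxP; exists e.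
rewrite nbhsE => -[B [oB B1] Be].
exists [set F' | exists2 g, GC (Q := Q) g /\ B g & F' = act F g]; last first.
  by move=> _ [g [Gg Bg] ->]; apply: He => //; exact: Be.
split; last by exists 1%:M; [split; [exact: GC1|]|rewrite act1].
move=> _ [g0 [Gg0 Bg0] ->].
have /nbhs_mxP[e1 e10 He1] : nbhs g0 B by apply: open_nbhs_nbhs; split.
pose K := entry_sum g0 * d%:R + 1.
have K0 : 0 < K by rewrite ltr_wpDl ?mulr_ge0 ?entry_sum_ge0.
apply/nbhs_mxP; exists (e1 / K); first exact: divr_gt0.
move=> g cg Gg; exists (g0 *m g); last by rewrite act_comp.
split; first exact: GCM.
apply: He1 => i j; have -> : g0 *m g - g0 = g0 *m (g - 1%:M).
  by rewrite mulmxBr mulmx1.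
rewrite mxE; apply: le_lt_trans (ler_norm_sum _ _ _) _.
apply: (@le_lt_trans _ _ (\sum_(k < d) entry_sum g0 * (e1 / K))).
  by apply: ler_sum => k _; rewrite normrM ler_pM // ?entry_le // ltW.
rewrite sumr_const card_ord -[ltLHS]mulr_natr.
have -> : entry_sum g0 * (e1 / K) * d%:R = e1 * (entry_sum g0 * d%:R / K) by ring.
by rewrite gtr_pMr // ltr_pdivrMr // mul1r /K ltrDl.
Qed.

Lemma open_flagP (A : set (flag Q)) F : A° F <->
  exists2 e, 0 < e & forall g, close_to_1 e g -> GC (Q := Q) g -> A (act F g).
Proof. exact: nbhs_flagP. Qed.

Lemma closure_flagP (A : set (flag Q)) F : closure A F ->
  forall e, 0 < e -> exists g, [/\ close_to_1 e g, GC (Q := Q) g & A (act F g)].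
Proof.
move=> clA e e0.
have /clA[F' [AF' [g [[cg Gg] FE]]]] : nbhs F
    [set F' | exists g, (close_to_1 e g /\ GC (Q := Q) g) /\ F' = act F g].
  by apply/nbhs_flagP; exists e => // g cg Gg; exists g.
by exists g; split=> //; rewrite -FE.
Qed.

End FlagTopology.

(** * One-parameter groups generated by matrices of cube zero *)

Section QuadraticExponential.
Context {R : realType} {d : nat}.
Implicit Types (X g : 'M[R[i]]_d) (z w : R[i]).

Definition texp X z : 'M[R[i]]_d := 1%:M + z *: X + (z ^+ 2 / 2) *: (X *m X).

Lemma texp0 X : texp X 0 = 1%:M.
Proof. by rewrite /texp expr0n mul0r !scale0r !addr0. Qed.

Lemma texpD X z w : X *m X *m X = 0 -> texp X z *m texp X w = texp X (z + w).
Proof.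
move=> X3; have X4 : X *m X *m (X *m X) = 0 by rewrite mulmxA X3 mul0mx.
have X3' : X *m (X *m X) = 0 by rewrite mulmxA.
rewrite /texp !mulmxDl !mulmxDr !mul1mx !mulmx1 -!scalemxAl -!scalemxAr !scalerA.
rewrite X3 X3' X4 !scaler0 !addr0.
apply/matrixP => i j; rewrite !mxE; move: (X i j) (\sum_(k < d) _) => x y.
by field.
Qed.

Lemma texp_close X e : 0 < e ->
  exists2 r, 0 < r & forall z, `|z| <= r -> close_to_1 e (texp X z).
Proof.
move=> e0; pose K := entry_sum X + entry_sum (X *m X).
have K0 : 0 <= K by rewrite addr_ge0 ?entry_sum_ge0.
pose D := K + e + 1.
have D0 : 0 < D by rewrite ltr_wpDl // addr_ge0 // ltW.
exists (e / D); first exact: divr_gt0.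
move=> z zr i j.
have z1 : `|z| <= 1.
  by apply: le_trans zr _; rewrite ler_pdivrMr // mul1r /D addrAC lerDr addr_ge0.
have -> : (texp X z - 1%:M) i j = z * X i j + z ^+ 2 / 2 * (X *m X) i j.
  have -> : texp X z - 1%:M = z *: X + (z ^+ 2 / 2) *: (X *m X).
    by rewrite /texp [LHS]addrC -addrA addKr.
  by rewrite !mxE.
apply: le_lt_trans (ler_normD _ _) _.
apply: (@le_lt_trans _ _ (`|z| * K)).
  rewrite mulrDr lerD //; first by rewrite normrM ler_wpM2l // entry_le.
  rewrite normrM ler_pM ?entry_le // normrM normrX normfV normr_nat expr2 -mulrA.
  rewrite ler_piMr // ler_pdivrMr // mul1r (le_trans z1) // ler1n //.
apply: (@le_lt_trans _ _ (e / D * K)); first by rewrite ler_wpM2r.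
rewrite -mulrA gtr_pMr // mulrC ltr_pdivrMr // mul1r /D -addrA ltrDl.
by rewrite addr_gt0.
Qed.

(** [exp_nilp] stops at the power [d], so it has a quadratic term as soon as [d] is at least 2. *)
Lemma texp_exp_nilp X z : (1 < d)%N -> X *m X *m X = 0 -> exp_nilp z X = texp X z.
Proof.
move=> d1 X3; rewrite /exp_nilp (bigID (fun k : 'I_d.+1 => (k < 3)%N)) /=.
rewrite [X in _ + X]big1 ?addr0; last first.
  move=> k; rewrite -leqNgt => k3; rewrite -(subnKC k3) [X in _ *: X]exprD.
  have -> : X ^+ 3 = 0 by rewrite !exprS expr0 mulr1 -!mulmxE mulmxA.
  by rewrite mul0r scaler0.
have d3 : (3 <= d.+1)%N by [].
rewrite -(big_ord_widen _ (fun k => (z ^+ k / k`!%:R) *: X ^+ k) d3).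
rewrite !big_ord_recl big_ord0 /= addr0 addrA /texp.
by rewrite !expr0 divr1 scale1r !expr1 divr1 expr2 mulmxE.
Qed.

End QuadraticExponential.

(** * Isometries close to 1 and limits of vectors in varying flags *)

Section Limits.
Context {R : realType} {d : nat} {Q : 'M[R]_d}.
Hypothesis Qnondeg : Q \in unitmx.
Implicit Types (F : flag Q) (g X : 'M[R[i]]_d).

Lemma cQ_unit : cplx Q \in unitmx.
Proof. by rewrite /cplx map_unitmx. Qed.

Lemma GC_texp X z : X *m cplx Q + cplx Q *m X^T = 0 -> X *m X *m X = 0 ->
  GC (Q := Q) (texp X z).
Proof.
move=> XQ X3.
have comm : X *m cplx Q = - (cplx Q *m X^T) by apply/eqP; rewrite -addr_eq0 XQ.
have iso w : texp X w *m cplx Q *m (texp X w)^T = cplx Q.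
  have -> : texp X w *m cplx Q = cplx Q *m (texp X (- w))^T.
    rewrite /texp !linearD /= !linearZ /= trmx_mul trmx1 ?mulmxDl ?mulmxDr.
    rewrite mul1mx mulmx1 -?scalemxAl -?scalemxAr -!mulmxA comm !mulmxN.
    by rewrite (mulmxA X) comm mulNmx opprK sqrrN scalerN -scaleNr -!mulmxA.
  by rewrite -mulmxA -trmx_mul texpD // subrr texp0 trmx1 mulmx1.
(* An isometry has determinant 1 or -1; being a square removes the sign. *)
split=> //; have -> : texp X z = texp X (z / 2) *m texp X (z / 2).
  by rewrite texpD // -splitr.
rewrite det_mulmx; have /(congr1 determinant) := iso (z / 2).
rewrite !det_mulmx det_tr mulrAC.
have := cQ_unit; rewrite unitmxE unitfE => dQ /(canRL (mulfK dQ)) ->.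
by rewrite divff.
Qed.

(** The inverse of an isometry, written linearly in [g], so that closeness of [g] to 1 passes to it
    with explicit constants. *)
Definition isometry_inv g := cplx Q *m g^T *m invmx (cplx Q).

Lemma isometry_invK g : GC (Q := Q) g -> g *m isometry_inv g = 1%:M.
Proof. by move=> [gQ _]; rewrite /isometry_inv !mulmxA gQ mulmxV // cQ_unit. Qed.

(** Near the limit the flag is [act Finf g] with [g] close to 1, so the inverse of [g] carries [w z]
    into [Finf p], the kernel of the projection [K]. Dropping [g] and replacing [w z] by [w0] costs
    arbitrarily little, so [K] kills [w0]. *)
Lemma limit_mem F (T : Type) (D : set_system T) (FD : ProperFilter D)
    (G : T -> 'M[R[i]]_d) (Finf : flag Q) p (w : T -> 'rV[R[i]]_d) w0 :
  act F (G z) @[z --> D] --> Finf ->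
  (\forall z \near D, w z \in act F (G z) p) ->
  (forall e, 0 < e -> \forall z \near D, l1norm (w z - w0) < e) ->
  w0 \in Finf p.
Proof.
move=> lim win wlim.
pose f : 'End('rV[R[i]]_d) := \1%VF - projv (Finf p).
pose K := lin1_mx f.
have KE v : v *m K = v - projv (Finf p) v.
  by rewrite mul_rV_lin1 /= /f add_lfunE opp_lfunE id_lfunE.
suff : w0 *m K = 0 by rewrite KE => /subr0_eq ->; exact: memv_proj.
apply: contraTeq isT => wK0.
have m0 := l1norm_gt0 wK0; set m := l1norm (w0 *m K) in m0.
pose A := cplx Q; pose B := invmx (cplx Q) *m K.
pose C1 := entry_sum K * d%:R.
pose C2 := entry_sum B * d%:R * (d%:R * (entry_sum A * d%:R * (l1norm w0 + 1))).
have C10 : 0 <= C1 by rewrite mulr_ge0 ?entry_sum_ge0.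
have C20 : 0 <= C2.
  by rewrite /C2 ?mulr_ge0 ?entry_sum_ge0 ?addr_ge0 ?l1norm_ge0.
(* The final estimate reads m <= eta (C1 + C2), which this value contradicts; being at most 1, it
   also bounds [w z]. *)
pose eta := m / (C1 + C2 + m + 1).
have D0 : 0 < C1 + C2 + m + 1 by rewrite ltr_wpDl // !addr_ge0 // ltW.
have eta0 : 0 < eta by exact: divr_gt0.
have eta1 : eta <= 1.
  rewrite ler_pdivrMr // mul1r -addrA (addrC m) addrA lerDr.
  by rewrite !addr_ge0.
have nF : nbhs Finf
    [set F' | exists g, (close_to_1 eta g /\ GC (Q := Q) g) /\ F' = act Finf g].
  by apply/nbhs_flagP; exists eta => // g cg Gg; exists g.
have Hz : \forall z \near D, [/\ exists g, (close_to_1 eta g /\ GC (Q := Q) g) /\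
     act F (G z) = act Finf g, w z \in act F (G z) p & l1norm (w z - w0) < eta].
  by near=> z; split; near: z; [exact: (lim _ nF)|exact: win|exact: wlim].
have [z [[g [[cg Gg] FE]] wz wzl]] := filter_ex Hz.
move: wz; rewrite FE => /mem_act[x xF wE].
have x0 : w z *m isometry_inv g *m K = 0.
  by rewrite wE -(mulmxA x) isometry_invK // mulmx1 KE projv_id // subrr.
have E : w0 *m K = (w0 - w z) *m K + w z *m A *m (1%:M - g)^T *m B.
  rewrite linearB /= trmx1 mulmxBr mulmx1 !mulmxBl /A /B.
  have -> : w z *m cplx Q *m g^T *m (invmx (cplx Q) *m K) = 0.
    by rewrite -x0 /isometry_inv !mulmxA.
  by rewrite mulmxA mulmxK ?cQ_unit // subr0 subrK.
have lw : l1norm (w0 - w z) < eta by rewrite -opprB -scaleN1r l1normZ normrN1 mul1r.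
have lwz : l1norm (w z) <= l1norm w0 + 1.
  have -> : w z = w0 + (w z - w0) by rewrite addrC subrK.
  apply: le_trans (l1normD _ _) _; rewrite lerD2l (le_trans _ eta1) // ltW //.
have : m <= eta * (C1 + C2).
  rewrite /m E; apply: le_trans (l1normD _ _) _; rewrite mulrDr lerD //.
    apply: le_trans (l1norm_mul _ (entry_sum_ge0 K) (entry_le K)) _.
    by rewrite mulrC ler_wpM2r // ltW.
  apply: le_trans (l1norm_mul _ (entry_sum_ge0 B) (entry_le B)) _.
  have -> : eta * C2 = entry_sum B * d%:R *
    (eta * d%:R * (entry_sum A * d%:R * (l1norm w0 + 1))) by rewrite /C2; ring.
  rewrite ler_wpM2l ?mulr_ge0 ?entry_sum_ge0 //.
  have le1 : l1norm (w z *m A *m (1%:M - g)^T) <= eta * d%:R * l1norm (w z *m A).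
    apply: (l1norm_mul _ (ltW eta0)) => i j; rewrite mxE -normrN.
    have -> : - (1%:M - g) j i = (g - 1%:M) j i by rewrite !mxE opprB.
    exact/ltW/cg.
  have le2 : l1norm (w z *m A) <= entry_sum A * d%:R * (l1norm w0 + 1).
    apply: le_trans (l1norm_mul _ (entry_sum_ge0 A) (entry_le A)) _.
    by rewrite ler_wpM2l ?mulr_ge0 ?entry_sum_ge0.
  have ed : 0 <= eta * d%:R by rewrite mulr_ge0 // ltW.
  exact: le_trans le1 (ler_wpM2l ed le2).
rewrite lt_geF // /eta -mulrA gtr_pMr // mulrC ltr_pdivrMr // mul1r.
by rewrite -addrA ltrDl addr_gt0.
Unshelve. all: by end_near.
Qed.

End Limits.

Section ImPinfty.
Context {R : realType} {d : nat}.

#[export] Instance im_pinfty_proper : ProperFilter (@im_pinfty R).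
Proof.
apply: filter_from_proper; last first.
  by move=> c _; exists (Complex 0 (c + 1)); rewrite /= ltrDl.
apply: filter_from_filter; first by exists 0.
move=> a b _ _; exists (Num.max a b) => // z /=.
by rewrite gt_max => /andP[].
Qed.

Lemma im_pinfty_inv (e : R[i]) : 0 < e -> \forall z \near @im_pinfty R, z != 0 /\ `|z^-1| < e.
Proof.
case: e => er ei; rewrite ltcE /= => /andP[/eqP ei0 er0]; rewrite ei0.
exists er^-1 => // z /= zc.
have iz : 0 < complex.Im z by apply: lt_trans zc; rewrite invr_gt0.
have z0 : z != 0 by apply: contraTneq iz => ->; rewrite ltxx.
split=> //; rewrite normfV.
have zn : (complex.Im z)%:C%C <= `|z|.
  rewrite normc_def lecR -[leLHS]ger0_norm; last exact: ltW.
  by rewrite -sqrtr_sqr ler_wsqrtr // lerDr sqr_ge0.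
have -> : (er +i* 0)%C = (er^-1)%:C%C^-1 by rewrite -fmorphV invrK.
have e'0 : 0 < (er^-1)%:C%C by rewrite (ltcR 0) invr_gt0.
rewrite ltf_pV2 ?posrE ?normr_gt0 //.
by apply: lt_le_trans zn; rewrite ltcR.
Qed.

Lemma im_pinfty_lim (w0 x y : 'rV[R[i]]_d) (w : R[i] -> 'rV[R[i]]_d) :
  (forall z, z != 0 -> w z = w0 + z^-1 *: x + z^-1 ^+ 2 *: y) ->
  forall e, 0 < e -> \forall z \near @im_pinfty R, l1norm (w z - w0) < e.
Proof.
move=> wE e e0; pose K := l1norm x + l1norm y.
have K0 : 0 <= K by rewrite addr_ge0 ?l1norm_ge0.
pose eta := e / (K + e + 1).
have D0 : 0 < K + e + 1 by rewrite ltr_wpDl // addr_ge0 // ltW.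
have eta0 : 0 < eta := divr_gt0 e0 D0.
have eta1 : eta <= 1 by rewrite ler_pdivrMr // mul1r addrAC lerDr addr_ge0.
apply: filterS (im_pinfty_inv eta0) => z [z0 zeta].
have -> : w z - w0 = z^-1 *: x + z^-1 ^+ 2 *: y by rewrite wE // [LHS]addrC -addrA addKr.
apply: le_lt_trans (l1normD _ _) _; rewrite !l1normZ normrX.
apply: (@le_lt_trans _ _ (eta * K)).
  rewrite mulrDr lerD // ler_wpM2r ?l1norm_ge0 ?(ltW zeta) //.
  rewrite expr2 (le_trans _ (ltW zeta)) // ler_piMr // (le_trans (ltW zeta)) //.
rewrite /eta -mulrA gtr_pMr // mulrC ltr_pdivrMr // mul1r -addrA ltrDl.
by rewrite addr_gt0.
Qed.

End ImPinfty.

Section Conjugation.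
Context {R : realType} {d : nat}.
Implicit Types (U W : {vspace 'rV[R[i]]_d}).

Lemma conj_mxD (u v : 'rV[R[i]]_d) : conj_mx (u + v) = conj_mx u + conj_mx v.
Proof. by rewrite /conj_mx map_mxD. Qed.

Lemma conj_mxZ (a : R[i]) (v : 'rV[R[i]]_d) : conj_mx (a *: v) = a^* *: conj_mx v.
Proof. by rewrite /conj_mx map_mxZ. Qed.

Lemma conj_mx0 : conj_mx (0 : 'rV[R[i]]_d) = 0.
Proof. by rewrite /conj_mx map_mx0. Qed.

Lemma conj_mxN (v : 'rV[R[i]]_d) : conj_mx (- v) = - conj_mx v.
Proof. by rewrite -scaleN1r conj_mxZ cjN cj1 scaleN1r. Qed.

Lemma conj_mxB (u v : 'rV[R[i]]_d) : conj_mx (u - v) = conj_mx u - conj_mx v.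
Proof. by rewrite conj_mxD conj_mxN. Qed.

Lemma conj_mx_eq0 (v : 'rV[R[i]]_d) : (conj_mx v == 0) = (v == 0).
Proof.
by apply/eqP/eqP => [v0|->]; rewrite ?conj_mx0 // -(conj_mxK v) v0 conj_mx0.
Qed.

Lemma conjvK U : conjv (conjv U) = U.
Proof.
by apply/vspaceP => v; apply/idP/idP => [/mem_conjv/mem_conjv|vU];
  [|apply/mem_conjv/mem_conjv]; rewrite conj_mxK.
Qed.

Lemma conjvS U W : (U <= W)%VS -> (conjv U <= conjv W)%VS.
Proof.
move=> /subvP UW; apply/subvP => v /mem_conjv vU; apply/mem_conjv; exact: UW.
Qed.

(** Conjugation is only antilinear, so dimensions are compared through the conjugates of a basis. *)
Lemma dim_conjv U : \dim (conjv U) = \dim U.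
Proof.
suff le (W : {vspace 'rV[R[i]]_d}) : (\dim (conjv W) <= \dim W)%N.
  by apply/eqP; rewrite eqn_leq le -{1}(conjvK U) le.
have <- : size (map (@conj_mx R 1 d) (vbasis W)) = \dim W.
  by rewrite size_map size_tuple.
apply: leq_trans (dim_span _); apply/dimvS/subvP => v /mem_conjv vW.
rewrite -(conj_mxK v) (coord_vbasis vW).
rewrite (big_morph (@conj_mx R 1 d) conj_mxD conj_mx0); apply: rpred_sum => i _.
rewrite conj_mxZ rpredZ // memv_span //; apply: map_f.
by rewrite mem_nth // size_tuple.
Qed.

End Conjugation.

Section Form.
Context {R : realType} {d : nat} {Q : 'M[R]_d}.
Implicit Types (u v w : 'rV[R[i]]_d) (a : R[i]) (n p q : int).

Local Notation form := (form (Q := Q)).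

Lemma formDl u v w : form (u + v) w = form u w + form v w.
Proof. by rewrite /form !mulmxDl mxE. Qed.

Lemma formZl a u w : form (a *: u) w = a * form u w.
Proof. by rewrite /form -!scalemxAl mxE. Qed.

Lemma formDr u v w : form u (v + w) = form u v + form u w.
Proof. by rewrite /form linearD mulmxDr mxE. Qed.

Lemma formZr a u w : form u (a *: w) = a * form u w.
Proof. by rewrite /form linearZ -scalemxAr mxE. Qed.

Lemma form0l w : form 0 w = 0.
Proof. by rewrite -(scale0r w) formZl mul0r. Qed.

Lemma form0r u : form u 0 = 0.
Proof. by rewrite -(scale0r u) formZr mul0r. Qed.

Lemma formNl u w : form (- u) w = - form u w.
Proof. by rewrite -scaleN1r formZl mulN1r. Qed.

Lemma formNr u w : form u (- w) = - form u w.
Proof. by rewrite -scaleN1r formZr mulN1r. Qed.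

Lemma formBl u v w : form (u - v) w = form u w - form v w.
Proof. by rewrite formDl formNl. Qed.

Lemma formBr u v w : form u (v - w) = form u v - form u w.
Proof. by rewrite formDr formNr. Qed.

Lemma form_act g u v : GC (Q := Q) g -> form (u *m g) (v *m g) = form u v.
Proof.
by move=> [gQ _]; rewrite /form trmx_mul !mulmxA -(mulmxA u) -(mulmxA u) gQ.
Qed.

Lemma conj_cplx (m k : nat) (A : 'M[R]_(m, k)) : conj_mx (cplx A) = cplx A.
Proof. by apply/matrixP => i j; rewrite !mxE /= oppr0. Qed.

Lemma form_conj u v : (form u v)^* = form (conj_mx u) (conj_mx v).
Proof.
have -> : (form u v)^* = (conj_mx (u *m cplx Q *m v^T)) 0 0 by rewrite [RHS]mxE.
by rewrite (conj_mxM _ v^T) (conj_mxM u) -(conj_mx_tr v) conj_cplx.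
Qed.

Lemma form_nondeg v : Q \in unitmx -> (forall u, form u v = 0) -> v = 0.
Proof.
move=> Qu v0; have QvT : cplx Q *m v^T = 0.
  apply/colP => i; have := v0 (delta_mx 0 i).
  by rewrite /form -mulmxA -rowE !mxE.
have cQu : cplx Q \in unitmx by rewrite /cplx map_unitmx.
by rewrite -(trmxK v) -[v^T](mulKmx cQu) QvT mulmx0 trmx0.
Qed.

(** Boolean, so that the sign (-1)^p attached to a level is itself an index [s] of [ind]. *)
Definition sg (p : int) : bool := odd `|p|%N.

Lemma signzE (K : unitRingType) p : (-1 : K) ^ p = (-1) ^+ sg p.
Proof.
case: p => k; rewrite /sg signr_odd //=.
by rewrite /exprz -exprVn invrN1.
Qed.

Lemma sgD p q : sg (p + q) = sg p (+) sg q.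
Proof. by rewrite /sg; lia. Qed.

Lemma sgN p : sg (- p) = sg p.
Proof. by rewrite /sg; lia. Qed.

Lemma sgM2 p : sg (2 * p) = false.
Proof. by rewrite /sg; lia. Qed.

Lemma sg1 : sg 1 = true. Proof. by []. Qed.

End Form.

(** * Period domains as flags with prescribed signatures *)

Section HodgeForm.
Context {R : realType} {d : nat} {Q : 'M[R]_d} {n : int}.
Implicit Types (u v w : 'rV[R[i]]_d) (a : R[i]) (p q : int).

Local Notation form := (form (Q := Q)).

Lemma iC_neq0 : ('i%C : R[i]) != 0.
Proof. by rewrite neq0Ci. Qed.

Lemma iCexp_neq0 p : ('i%C : R[i]) ^ p != 0.
Proof. by rewrite expfz_neq0 // iC_neq0. Qed.

Lemma cjXz (x : R[i]) p : (x ^ p)^* = x^* ^ p.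
Proof. by case: p => k; rewrite /exprz ?cjV cjX. Qed.

Lemma iCexp_conj p : (('i%C : R[i]) ^ p)^* = (-1) ^+ sg p * 'i%C ^ p.
Proof. by rewrite -signzE cjXz conjCi expNrz. Qed.

Lemma iCexp_weil p : ('i%C : R[i]) ^ (p - (n - p)) = (-1) ^+ sg p * 'i%C ^ (- n).
Proof.
have -> : p - (n - p) = 2 * p + - n by lia.
have i2 : ('i%C : R[i]) ^ (2 : int) = -1 by exact: sqrCi.
by rewrite (expfzDr _ _ iC_neq0) -exprz_exp i2 signzE.
Qed.

Hypothesis Qsym : Q^T = (-1) ^ n *: Q.

Lemma formC u v : form v u = (-1) ^+ sg n * form u v.
Proof.
have -> : form v u = (v *m cplx Q *m u^T)^T 0 0 by rewrite mxE.
have cQT : (cplx Q)^T = (-1) ^+ sg n *: cplx Q.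
  by rewrite /cplx map_trmx Qsym signzE map_mxZ rmorph_sign.
rewrite !trmx_mul trmxK cQT mulmxA.
by rewrite -scalemxAr -scalemxAl mxE.
Qed.

Lemma form_eq0C u v : form u v = 0 -> form v u = 0.
Proof. by move=> uv; rewrite formC uv mulr0. Qed.

(* Chosen so that i^(p-q) form v (conj v) = (-1)^p hf HQ v v when p + q = n. *)
Definition HQ : 'M[R[i]]_d := ('i%C ^ (- n)) *: cplx Q.

Lemma hfE u v : hf HQ u v = 'i%C ^ (- n) * form u (conj_mx v).
Proof. by rewrite /hf /HQ -scalemxAr -scalemxAl mxE. Qed.

Lemma HQ_herm : HQ^T = conj_mx HQ.
Proof.
have cQT : (cplx Q)^T = (-1) ^+ sg n *: cplx Q.
  by rewrite /cplx map_trmx Qsym signzE map_mxZ rmorph_sign.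
rewrite /HQ linearZ /= cQT scalerA.
have -> : conj_mx ('i%C ^ (- n) *: cplx Q) = ('i%C ^ (- n))^* *: conj_mx (cplx Q).
  by rewrite /conj_mx map_mxZ.
by rewrite iCexp_conj sgN conj_cplx mulrC.
Qed.

(** Conjugation preserves H in even weight and reverses its sign in odd weight: the source of the
    shifts by [sg n] below. *)
Lemma hf_conj_mx u v :
  hf HQ (conj_mx u) (conj_mx v) = (-1) ^+ sg n * hf HQ v u.
Proof. by rewrite !hfE conj_mxK (formC v) mulrCA. Qed.

Lemma hf_eq0E u v : hf HQ u v = 0 <-> form u (conj_mx v) = 0.
Proof.
rewrite hfE; split=> [/eqP|->]; last by rewrite mulr0.
by rewrite mulf_eq0 (negPf (iCexp_neq0 _)) => /eqP.
Qed.

Lemma definite_conjv s U : definite HQ s U -> definite HQ (s (+) sg n) (conjv U).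
Proof.
move=> dU v /mem_conjv vU v0; have := dU _ vU; rewrite conj_mx_eq0 => /(_ v0).
by rewrite hf_conj_mx mulrA signr_addb.
Qed.

Lemma ind_conjv s U : ind HQ s (conjv U) = ind HQ (s (+) sg n) U.
Proof.
suff le t W : (ind HQ t (conjv W) <= ind HQ (t (+) sg n) W)%N.
  apply/eqP; rewrite eqn_leq le -{1}(conjvK U).
  by rewrite (leq_trans (le _ _)) // addbK.
have [P [PW <- dP]] := ind_ex HQ t (conjv W).
rewrite -dim_conjv; apply: ind_max (definite_conjv dP).
by rewrite -(conjvK W); exact: conjvS.
Qed.

End HodgeForm.

Definition period_datum (R : realType) (d : nat) (Q : 'M[R]_d) (n : int)
    (h : int -> nat) (o : flag Q) :=
  [/\ Q \in unitmx, Q^T = (-1) ^ n *: Q & polarized_hodge_structure n h o].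

Section PeriodDatum.
Context {R : realType} {d : nat} {Q : 'M[R]_d} {n : int} {h : int -> nat} {o : flag Q}.
Hypothesis PD : period_datum n h o.
Implicit Types (u v w : 'rV[R[i]]_d) (p q : int) (F : flag Q).

Let Qnondeg : Q \in unitmx. Proof. by case: PD. Qed.
Let Qsym : Q^T = (-1) ^ n *: Q. Proof. by case: PD. Qed.
Let ho : polarized_hodge_structure n h o. Proof. by case: PD. Qed.

Local Notation form := (form (Q := Q)).
Local Notation H := (HQ (Q := Q) (n := n)).

Lemma H_herm : H^T = conj_mx H. Proof. exact: HQ_herm. Qed.

Lemma orb_decr F p q : orbC o F -> p <= q -> (F q <= F p)%VS.
Proof.
have step (r : int) : (o (r + 1)%R <= o r)%VS by have [[]] := ho.
have odecr (k : nat) (r : int) : (o (r + k%:Z)%R <= o r)%VS.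
  elim: k => [|k IH]; first by rewrite addr0.
  have -> : r + k.+1%:Z = r + k%:Z + 1 by lia.
  exact: subv_trans (step _) IH.
move=> [g _ ->] pq; apply: limgS.
have -> : q = p + `|q - p|%N by lia.
exact: odecr.
Qed.

Lemma orb_dim F p : orbC o F -> \dim (F p) = \dim (o p).
Proof. by move=> [g Gg ->]; exact: dim_act. Qed.

Lemma orbC_refl : orbC o o.
Proof. by exists 1%:M; [exact: GC1 | rewrite act1]. Qed.

Lemma dim_levels p : (\dim (o p) + \dim (o (n - p + 1)%R))%N = d.
Proof.
have [[_ _ /(_ p)[os oc]] _ _] := ho.
by rewrite -(dim_conjv (o (n - p + 1))) -dimv_disjoint_sum // os dimvf /dim /= mul1n.
Qed.

Lemma orb_form F p q u v : orbC o F -> n + 1 <= p + q -> u \in F p -> v \in F q ->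
  form u v = 0.
Proof.
move=> oF pq uF vFq; have pq' : n - p + 1 <= q by lia.
have vF := subvP (orb_decr oF pq') v vFq.
case: oF uF vF => g Gg -> /mem_act[u' u'o ->] /mem_act[v' v'o ->].
by rewrite form_act //; have [_ _ [oQ _]] := ho; exact: (oQ p).
Qed.

(** At the reference point V is F^p + conj F^(n-p+1), and the F^p-part of [conj_mx x], once
    conjugated, pairs to zero with both summands, so nondegeneracy kills it. Isometries carry this
    to the whole orbit. *)
Lemma orb_perp F p v : orbC o F -> (forall u, u \in F p -> form u v = 0) ->
  v \in F (n - p + 1).
Proof.
move=> oF; have [[_ _ /(_ p)[os _]] _ _] := ho.
have main x : (forall u, u \in o p -> form u x = 0) -> x \in o (n - p + 1).
  move=> x0; have : conj_mx x \in fullv by exact: memvf.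
  rewrite -os => /memv_addP[y yo [z /mem_conjv zo xE]].
  have xE' : x = conj_mx y + conj_mx z by rewrite -conj_mxD -xE conj_mxK.
  suff -> : x = conj_mx z by [].
  suff y0 : conj_mx y = 0 by rewrite xE' y0 add0r.
  apply: form_nondeg Qnondeg _ => u.
  have : u \in fullv by exact: memvf.
  rewrite -os => /memv_addP[a ao [b /mem_conjv bo ->]]; rewrite formDl.
  have -> : form a (conj_mx y) = 0.
    have -> : conj_mx y = x - conj_mx z by rewrite xE' addrK.
    rewrite formBr x0 // (orb_form orbC_refl _ ao zo) ?subrr //; lia.
  have -> : form b (conj_mx y) = (form (conj_mx b) y)^*.
    by rewrite form_conj conj_mxK.
  by rewrite (orb_form orbC_refl _ bo yo) ?cj0 ?addr0 //; lia.
case: oF => g Gg -> v0.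
have gU : g \in unitmx by rewrite unitmxE; case: Gg => _ ->; rewrite unitr1.
apply/mem_act; exists (v *m invmx g); last by rewrite mulmxKV.
apply: main => u uo; rewrite -(form_act _ _ Gg) mulmxKV //.
by apply: v0; apply/mem_act; exists u.
Qed.

Lemma mem_radF F p v : orbC o F ->
  v \in rad H (F p) <-> v \in F p /\ conj_mx v \in F (n - p + 1).
Proof.
move=> oF; rewrite (mem_rad _ _ _); split=> -[vF Hv]; split=> //.
  apply: (orb_perp oF) => u uF; apply/hf_eq0E.
  by apply: (hf_eq0C (HQ_herm Qsym)); exact: Hv.
move=> w wF; apply/(hf_eq0C (HQ_herm Qsym))/hf_eq0E.
by apply: (orb_form oF _ wF Hv); lia.
Qed.

Lemma radFE F p : orbC o F -> rad H (F p) = (F p :&: conjv (F (n - p + 1)%R))%VS.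
Proof.
move=> oF; apply/vspaceP => v; apply/idP/idP.
  by move=> /(mem_radF _ _ oF)[vF cv]; apply/memv_capP; split=> //; exact/mem_conjv.
by move=> /memv_capP[vF /mem_conjv cv]; apply/(mem_radF _ _ oF).
Qed.

Lemma rad_dual F p : orbC o F -> rad H (F (n - p + 1)) = conjv (rad H (F p)).
Proof.
move=> oF; apply/vspaceP => v; apply/idP/idP.
  move=> /(mem_radF _ _ oF)[vF cv]; apply/mem_conjv/(mem_radF _ _ oF).
  by rewrite conj_mxK; split=> //; move: cv; congr (_ \in F _); lia.
move=> /mem_conjv/(mem_radF _ _ oF)[]; rewrite conj_mxK => cv vF.
by apply/(mem_radF _ _ oF); split=> //; move: cv; congr (_ \in F _); lia.
Qed.

(** Dimensions are constant on the orbit, so one bound serves all its points. *)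
Lemma o_top : exists M : int, forall F p, orbC o F -> M <= p -> F p = 0%VS.
Proof.
have [[_ [_ [M oM]] _] _ _] := ho; exists M => F p oF Mp.
apply/eqP; rewrite -subv0 (subv_trans (orb_decr oF Mp)) // subv0 -dimv_eq0.
by rewrite (orb_dim _ oF) oM dimv0.
Qed.

Lemma o_bot : exists L : int, forall F p, orbC o F -> p <= L -> F p = fullv.
Proof.
have [[_ [[L oL] _] _] _ _] := ho; exists L => F p oF Lp.
apply/eqP; rewrite eqEdim subvf /=.
by apply: leq_trans (dimvS (orb_decr oF Lp)); rewrite (orb_dim _ oF) oL.
Qed.

End PeriodDatum.

Section SignatureCriterion.
Context {R : realType} {d : nat} {Q : 'M[R]_d} {n : int} {h : int -> nat} {o : flag Q}.
Hypothesis PD : period_datum n h o.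
Implicit Types (u v w : 'rV[R[i]]_d) (a : R[i]) (p q : int) (F : flag Q) (s : bool).

Local Notation H := (HQ (Q := Q) (n := n)).
Let Hherm : H^T = conj_mx H := H_herm PD.
Let ho : polarized_hodge_structure n h o. Proof. by case: PD. Qed.

Lemma mem_piece F p v : v \in hodge_piece n F p <-> v \in F p /\ conj_mx v \in F (n - p).
Proof.
split=> [/memv_capP[vF /mem_conjv]//|[vF cv]].
by apply/memv_capP; split=> //; exact/mem_conjv.
Qed.

Lemma hdim p : (h p + \dim (o (p + 1)%R))%N = \dim (o p).
Proof.
have oo := orbC_refl (o := o); have [[_ _ /(_ (p + 1)%R)[os oc]] /(_ p) <- _] := ho.
have nE : n - (p + 1) + 1 = n - p by lia.
rewrite nE in os oc.
have le : (o (p + 1)%R <= o p)%VS by apply: (orb_decr PD oo); lia.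
have <- : (o (p + 1)%R + hodge_piece n o p)%VS = o p.
  by rewrite /hodge_piece capvC vspace_modl // os capfv.
rewrite dimv_disjoint_sum 1?addnC //; apply/eqP; rewrite -subv0 -oc; apply: capvS => //.
exact: capvSr.
Qed.

(** Outside D the filtration and its conjugate need not be opposite, and the dimension formula only
    gives a lower bound. *)
Lemma piece_dim_ge F p : orbC o F -> (h p <= \dim (hodge_piece n F p))%N.
Proof.
move=> oF; have := dimv_sum_cap (F p) (conjv (F (n - p))).
rewrite -/(hodge_piece n F p) dim_conjv !(orb_dim _ oF).
have := dim_levels PD (p + 1); have -> : n - (p + 1) + 1 = n - p by lia.
have := dimvS (subvf (F p + conjv (F (n - p)))); rewrite dimvf /dim /= mul1n.
have := hdim p; lia.
Qed.

Lemma orb_piece_orth F p q u v : orbC o F -> p < q -> u \in F q ->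
  v \in hodge_piece n F p -> hf H u v = 0.
Proof.
move=> oF pq uF /mem_piece[_ cv]; apply/hf_eq0E.
by apply: (orb_form PD oF _ uF cv); lia.
Qed.

Lemma phs_piece_definite F p : polarized_hodge_structure n h F ->
  definite H (sg p) (hodge_piece n F p).
Proof.
move=> [_ _ [_ [C wC posC]]] v vE v0; have := posC v v0.
by rewrite (wC p v vE) formZl iCexp_weil hfE mulrA.
Qed.

Section Phs.
Context {F : flag Q}.
Hypothesis oF : orbC o F.
Hypothesis pF : polarized_hodge_structure n h F.

Lemma phs_rad p : rad H (F p) = 0%VS.
Proof. by rewrite (radFE PD _ oF); have [[_ _ /(_ p)[]]] := pF. Qed.

Lemma phs_split p : (F (p + 1)%R + hodge_piece n F p)%VS = F p.
Proof.
have [[_ _ /(_ (p + 1)%R)[Fs Fc]] _ _] := pF.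
have nE : n - (p + 1) + 1 = n - p by lia.
rewrite nE in Fs Fc.
have le : (F (p + 1)%R <= F p)%VS by apply: (orb_decr PD oF); lia.
by rewrite /hodge_piece capvC vspace_modl // Fs capfv.
Qed.

(** The orthogonal splitting of F^p into F^(p+1) and the Hodge piece bounds each index from below.
    The bounds for the two signs add up to the dimension, so both are equalities. *)
Lemma phs_ind_step s p :
  ind H s (F p) = (ind H s (F (p + 1)%R) + (if sg p == s then h p else 0))%N.
Proof.
have orthE : orth H (F (p + 1)%R) (hodge_piece n F p).
  by move=> u v uF vE; apply: (orb_piece_orth oF _ uF vE); lia.
have le t : (ind H t (F (p + 1)%R) + (if sg p == t then h p else 0) <= ind H t (F p))%N.
  rewrite -(phs_split p); apply: leq_trans (ind_orth Hherm t orthE).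
  rewrite leq_add2l; case: eqP => // <-.
  have [_ <- _] := pF; apply: ind_max (subvv _) _.
  exact: phs_piece_definite.
have s1 := ind_nondeg Hherm s (phs_rad p).
have s2 := ind_nondeg Hherm s (phs_rad (p + 1)).
rewrite !(orb_dim _ oF) in s1 s2.
have l1 := le s; have l2 := le (~~ s); have := hdim p.
have : ((if sg p == s then h p else 0) + (if sg p == ~~ s then h p else 0))%N = h p.
  by move: (s) (sg p) => [] []; rewrite /= ?addn0.
lia.
Qed.

End Phs.

Lemma phs_ind F s p : orbC o F -> polarized_hodge_structure n h F ->
  ind H s (F p) = ind H s (o p).
Proof.
move=> oF pF; have [M Mtop] := o_top PD; have oo := orbC_refl (o := o).
have [pM|Mp] := lerP p M; last by rewrite !(Mtop _ p) // ltW.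
have -> : p = M - `|M - p|%N%:Z by lia.
elim: `|M - p|%N => [|k IH]; first by rewrite subr0 !(Mtop _ M).
rewrite (phs_ind_step oF pF) (phs_ind_step oo ho).
have -> : M - k.+1%:Z + 1 = M - k%:Z by lia.
by rewrite IH.
Qed.

Section Converse.
Context {F : flag Q}.
Hypothesis oF : orbC o F.
Hypothesis indF : forall s p, (ind H s (o p) <= ind H s (F p))%N.

Let oo := orbC_refl (o := o).

(** The lower bounds for the two signs already exhaust [\dim (F p)]. *)
Lemma good_rad p : rad H (F p) = 0%VS.
Proof.
apply/eqP; rewrite -dimv_eq0.
have := ind_sum Hherm true (F p); rewrite (orb_dim _ oF) /=.
have := ind_nondeg Hherm true (phs_rad oo ho p); rewrite /=.
have := indF true p; have := indF false p; lia.
Qed.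

Lemma good_ind s p : ind H s (F p) = ind H s (o p).
Proof.
have := ind_nondeg Hherm s (good_rad p); rewrite (orb_dim _ oF).
have := ind_nondeg Hherm s (phs_rad oo ho p).
have := indF s p; have := indF (~~ s) p; lia.
Qed.

Lemma good_cap p : (F p :&: conjv (F (n - p + 1)%R))%VS = 0%VS.
Proof. by rewrite -(radFE PD _ oF) good_rad. Qed.

Lemma good_sum p : (F p + conjv (F (n - p + 1)%R))%VS = fullv.
Proof.
apply/eqP; rewrite eqEdim subvf dimv_disjoint_sum ?good_cap // dim_conjv !(orb_dim _ oF).
by rewrite (dim_levels PD) dimvf /dim /= mul1n.
Qed.

Lemma good_split p : (F (p + 1)%R + hodge_piece n F p)%VS = F p.
Proof.
have Fs := good_sum (p + 1).
have nE : n - (p + 1) + 1 = n - p by lia.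
rewrite nE in Fs.
have le : (F (p + 1)%R <= F p)%VS by apply: (orb_decr PD oF); lia.
by rewrite /hodge_piece capvC vspace_modl // Fs capfv.
Qed.

Lemma good_split_cap p : (F (p + 1)%R :&: hodge_piece n F p)%VS = 0%VS.
Proof.
apply/eqP; rewrite -subv0 -(good_cap (p + 1)); apply: capvS => //.
have -> : n - (p + 1) + 1 = n - p by lia.
exact: capvSr.
Qed.

Lemma good_dim_piece p : \dim (hodge_piece n F p) = h p.
Proof.
have := dimv_disjoint_sum (good_split_cap p); rewrite good_split !(orb_dim _ oF).
have := hdim p; lia.
Qed.

(** Otherwise [v] and a maximal subspace of F^(p+1) of sign -(-1)^p would span a semidefinite
    subspace of F^p that is too large, since the index for that sign is the same at levels p and p +
    1. *)
Lemma good_piece_definite p : definite H (sg p) (hodge_piece n F p).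
Proof.
move=> v vE v0; apply: contraT => npos.
have svR : (-1) ^+ sg p * hf H v v \is Num.real by rewrite realM ?(hf_real Hherm).
have vneg : semidefinite H (~~ sg p) <[v]>%VS.
  move=> _ /vlineP[a ->]; rewrite signN oppr_ge0 hfZ2 mulrCA.
  by rewrite mulr_ge0_le0 ?mul_conjC_ge0 // real_leNgt ?real0.
have [P [PF dimP dP]] := ind_ex H (~~ sg p) (F (p + 1)%R).
have oPv : orth H P <[v]>%VS.
  move=> u _ uP /vlineP[a ->]; rewrite hfZr.
  by rewrite (orb_piece_orth oF (_ : p < p + 1) (subvP PF u uP) vE) ?mulr0 //; lia.
have le : (F (p + 1)%R <= F p)%VS by apply: (orb_decr PD oF); lia.
have := @ind_semi _ _ H (sg p) (F p) (P + <[v]>)%VS.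
rewrite subv_add (subv_trans PF le) -memvE => /(_ _ _).
rewrite (dimv_disjoint_sum (orth_cap0 oPv dP)) dim_vline v0 dimP.
have -> : v \in F p by have [] := proj1 (mem_piece F p v) vE.
move=> /(_ isT (orth_semi Hherm oPv (definite_semi dP) vneg)).
have := ind_nondeg Hherm (sg p) (good_rad p).
have e1 := good_ind (~~ sg p) p; have e2 := good_ind (~~ sg p) (p + 1)%R.
have := phs_ind_step oo ho (~~ sg p) p.
have -> : (sg p == ~~ sg p) = false by case: (sg p).
lia.
Qed.

End Converse.
End SignatureCriterion.

(** * Construction of the Weil operator from the indices *)

Section WeilOperator.
Context {R : realType} {d : nat} {Q : 'M[R]_d} {n : int} {h : int -> nat} {o : flag Q}.
Hypothesis PD : period_datum n h o.
Context {F : flag Q}.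
Hypothesis oF : orbC o F.
Local Notation H := (HQ (Q := Q) (n := n)).
Hypothesis indF : forall s p, (ind H s (o p) <= ind H s (F p))%N.
Implicit Types (u v w : 'rV[R[i]]_d) (p q : int).

Let Hherm : H^T = conj_mx H := H_herm PD.
Let ho : polarized_hodge_structure n h o. Proof. by case: PD. Qed.

Lemma hodge_projections : exists proj : int -> 'End('rV[R[i]]_d),
  [/\ forall p v, v \in F p -> proj p v = v,
      forall p v, proj p v \in F p,
      forall p v, v - proj p v \in conjv (F (n - p + 1)%R)
    & forall p v, v \in conjv (F (n - p + 1)%R) -> proj p v = 0].
Proof.
exists (fun p => daddv_pi (F p) (conjv (F (n - p + 1)%R))).
have C_mem p v :
    v - daddv_pi (F p) (conjv (F (n - p + 1)%R)) v \in conjv (F (n - p + 1)%R).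
  have vF : v \in (F p + conjv (F (n - p + 1)%R))%VS.
    by rewrite (good_sum PD oF indF) memvf.
  rewrite -{1}(daddv_pi_add (good_cap PD oF indF p) vF) addrC addKr.
  exact: memv_pi.
split=> // p v; first exact: daddv_pi_id (good_cap PD oF indF p).
  exact: memv_pi.
move=> vF; apply/eqP; rewrite -memv0 -(good_cap PD oF indF p).
apply/memv_capP; split; first exact: memv_pi.
by rewrite -(subKr v (daddv_pi _ _ v)) memvB.
Qed.

(** The components are differences of consecutive projections onto F^p along conj F^(n-p+1), and
    their sum telescopes. Levels are counted downwards from a level [M] at which the filtration
    vanishes. *)
Lemma hodge_components : exists (K : nat) (lev : nat -> int)
    (piece : nat -> 'End('rV[R[i]]_d)),
  [/\ injective lev,
      forall k v, piece k v \in hodge_piece n F (lev k),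
      forall k v q, v \in hodge_piece n F q ->
        piece k v = if lev k == q then v else 0
    & forall v, v = \sum_(k < K) piece k v].
Proof.
have [proj [proj_id proj_mem projC_mem proj0]] := hodge_projections.
have [M Mtop] := o_top PD; have [L Lbot] := o_bot PD.
pose lev (k : nat) : int := M - k.+1%:Z.
exists `|M - L|%N, lev, (fun k => proj (lev k) - proj (lev k + 1)).
have pieceE p v : (proj p - proj (p + 1)) v = proj p v - proj (p + 1) v.
  by rewrite add_lfunE opp_lfunE.
split.
- by move=> j k; rewrite /lev; lia.
- move=> k v; move: (lev k) => p; rewrite pieceE; apply/memv_capP; split.
    have le : (F (p + 1)%R <= F p)%VS by apply: (orb_decr PD oF); lia.
    by rewrite memvB ?proj_mem // (subvP le) ?proj_mem.
  have -> : proj p v - proj (p + 1) v = (v - proj (p + 1) v) - (v - proj p v).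
    by rewrite opprB [RHS]addrC addrA subrK.
  have := projC_mem (p + 1) v; have -> : n - (p + 1) + 1 = n - p by lia.
  move=> m1; apply: memvB m1 _.
  have le : (F (n - p + 1)%R <= F (n - p)%R)%VS by apply: (orb_decr PD oF); lia.
  exact: subvP (conjvS le) _ (projC_mem p v).
- move=> k v q /memv_capP[vF cv]; move: (lev k) => p.
  have pr r : proj r v = if r <= q then v else 0.
    case: ifPn => rq; first by apply: proj_id; exact: subvP (orb_decr PD oF rq) v vF.
    apply: proj0; apply: subvP cv; apply: conjvS; apply: (orb_decr PD oF).
    by lia.
  rewrite pieceE !pr; have -> : (p <= q) = (p == q) || (p + 1 <= q) by lia.
  have [->|_] /= := eqVneq p q; last by rewrite subrr.
  have -> : (q + 1 <= q) = false by lia.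
  by rewrite subr0.
move=> v.
have tel k : \sum_(i < k) (proj (lev i) v - proj (lev i + 1) v) =
    proj (M - k%:Z) v - proj M v.
  elim: k => [|k IH]; first by rewrite big_ord0 subr0 subrr.
  rewrite big_ord_recr /= IH /lev.
  have -> : M - k.+1%:Z + 1 = M - k%:Z by lia.
  by rewrite addrC addrA subrK.
have pM : proj M v = 0.
  by apply/eqP; rewrite -memv0 -(Mtop F M oF (lexx _)) proj_mem.
under eq_bigr do rewrite pieceE.
rewrite tel pM subr0; have [ML|ML] := lerP L M.
  rewrite proj_id // (Lbot F _ oF) ?memvf //; lia.
(* Here F^M is both zero and everything, so V is zero. *)
have : v \in F M by rewrite (Lbot F _ oF) ?memvf // ltW.
by rewrite (Mtop F _ oF) // memv0 => /eqP ->; rewrite linear0.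
Qed.

Lemma weil_operator_exists : exists2 C, weil_operator n F C &
  forall v, v != 0 -> 0 < form (Q := Q) (v *m C) (conj_mx v).
Proof.
have [K [lev [piece [lev_inj piece_mem piece_id sumE]]]] := hodge_components.
pose wt p : R[i] := 'i%C ^ (p - (n - p)).
pose C := \sum_(k < K) wt (lev k) *: lin1_mx (piece k).
have CE v : v *m C = \sum_(k < K) wt (lev k) *: piece k v.
  rewrite /C mulmx_sumr; apply: eq_bigr => k _.
  by rewrite -scalemxAr mul_rV_lin1.
exists C.
  move=> p v vE; rewrite CE.
  have wtE k : wt (lev k) *: piece k v = wt p *: piece k v.
    by rewrite (piece_id _ _ _ vE); case: eqP => [->//|_]; rewrite !scaler0.
  by under eq_bigr do rewrite wtE; rewrite -scaler_sumr -sumE.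
move=> v v0.
have -> : form (Q := Q) (v *m C) (conj_mx v) =
    \sum_(k < K) (-1) ^+ sg (lev k) * hf H (piece k v) (piece k v).
  rewrite CE.
  rewrite (big_morph (fun x => form (Q := Q) x (conj_mx v))
    (fun x y => formDl x y _) (form0l _)); apply: eq_bigr => k _.
  rewrite formZl /wt iCexp_weil -mulrA -hfE; congr (_ * _).
  rewrite {2}[v]sumE hf_sumr (bigD1 k) //= big1 ?addr0 // => l lk.
  have lk' : lev l <> lev k by move/lev_inj/ord_inj/eqP; rewrite (negPf lk).
  have [lt|lt|//] := ltgtP (lev l) (lev k).
    apply: (orb_piece_orth PD oF lt _ (piece_mem _ _)).
    by have /memv_capP[] := piece_mem k v.
  apply: (hf_eq0C Hherm); apply: (orb_piece_orth PD oF lt _ (piece_mem _ _)).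
  by have /memv_capP[] := piece_mem l v.
have pos k : 0 <= (-1) ^+ sg (lev k) * hf H (piece k v) (piece k v).
  exact: (definite_semi (good_piece_definite PD oF indF (p := lev k)) (piece_mem _ _)).
have [k kK] : exists k : 'I_K, piece k v != 0.
  apply/existsP; apply: contraNT v0; rewrite negb_exists => /forallP v0.
  rewrite [v]sumE big1 // => k _; by have := v0 k; rewrite negbK => /eqP.
rewrite (bigD1 k) //=; apply: ltr_wpDr; first by apply: sumr_ge0 => l _; exact: pos.
exact: (good_piece_definite PD oF indF (piece_mem _ _)).
Qed.

Lemma good_phs : polarized_hodge_structure n h F.
Proof.
split; last split.
- split; first by move=> p; apply: (orb_decr PD oF); lia.
  - have [M Mtop] := o_top PD; have [L Lbot] := o_bot PD.
    split; [exists L; exact: Lbot F L oF (lexx _)|].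
    by exists M; exact: Mtop F M oF (lexx _).
  by move=> p; split; [exact: (good_sum PD oF indF)|exact: (good_cap PD oF indF)].
- exact: (good_dim_piece PD oF indF).
- by move=> p u v; apply: (orb_form PD oF); lia.
- exact: weil_operator_exists.
Qed.

End WeilOperator.

(** * Indices at points of the closure of D *)

Section PeriodDomainTopology.
Context {R : realType} {d : nat} {Q : 'M[R]_d} {n : int} {h : int -> nat} {o : flag Q}.
Hypothesis PD : period_datum n h o.
Local Notation H := (HQ (Q := Q) (n := n)).
Implicit Types (u v w : 'rV[R[i]]_d) (p q : int) (F : flag Q) (s : bool).

Let Hherm : H^T = conj_mx H := H_herm PD.
Let ho : polarized_hodge_structure n h o. Proof. by case: PD. Qed.
Let oo := orbC_refl (o := o).

Local Notation D := (period_domain n h o).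

Lemma period_domainP F : orbC o F ->
  D F <-> forall s p, (ind H s (o p) <= ind H s (F p))%N.
Proof.
move=> oF; split=> [[_ pF] s p|indF]; first by rewrite (phs_ind PD s p oF pF).
by split=> //; exact: (good_phs PD oF indF).
Qed.

Lemma ind_open_act F s p : exists2 e, 0 < e & forall g, close_to_1 e g ->
  (ind H s (F p) <= ind H s (act F g p))%N.
Proof. exact: (ind_open Hherm). Qed.

Lemma ind_closure F s p : orbC o F -> closure D F ->
  (ind H s (F p) <= ind H s (o p))%N.
Proof.
move=> oF clF; have [e e0 He] := ind_open_act F s p.
have [g [cg Gg [og pg]]] := closure_flagP clF e0.
by rewrite -(phs_ind PD s p og pg); exact: He.
Qed.

Lemma ind_total s p : (ind H s (o p) + ind H (~~ s) (o p))%N = \dim (o p).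
Proof. exact: (ind_nondeg Hherm s (phs_rad PD oo ho p)). Qed.

(** Semicontinuity bounds the index of the other sign from above, so whatever sign [s] loses has to
    appear in the radical. *)
Lemma ind_closure_ge F s p : orbC o F -> closure D F ->
  (ind H s (o p) <= ind H s (F p) + \dim (rad H (F p)))%N.
Proof.
move=> oF clF; have := ind_sum Hherm s (F p); rewrite (orb_dim _ oF).
have := ind_total s p; have := ind_closure (~~ s) p oF clF; lia.
Qed.

Lemma ind_step s p :
  ind H s (o p) = (ind H s (o (p + 1)%R) + (if sg p == s then h p else 0))%N.
Proof. exact: (phs_ind_step PD oo ho). Qed.

(* Only the sign of level p itself can be lost when passing to the boundary. *)
Lemma ind_closure_other F p : orbC o F -> closure D F -> rad H (F (p + 1)%R) = 0%VS ->
  (ind H (~~ sg p) (o p) <= ind H (~~ sg p) (F p))%N.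
Proof.
move=> oF clF r0; rewrite ind_step.
have -> : (sg p == ~~ sg p) = false by case: (sg p).
rewrite addn0; have := ind_closure_ge (~~ sg p) (p + 1) oF clF.
rewrite r0 dimv0 addn0 => le; apply: leq_trans le _.
by apply: indS; apply: (orb_decr PD oF); lia.
Qed.

Lemma orth_dual F p : orbC o F -> orth H (F p) (conjv (F (n - p + 1)%R)).
Proof.
move=> oF u v uF /mem_conjv cv; apply/hf_eq0E.
by apply: (orb_form PD oF _ uF cv); lia.
Qed.

Let Qsym : Q^T = (-1) ^ n *: Q. Proof. by case: PD. Qed.

(** F^p and conj F^(n-p+1) are orthogonal, which gives one inequality for each sign; both sides,
    summed over the signs, equal [d]. *)
Lemma ind_dual s p : (ind H s (o p) + ind H (s (+) sg n) (o (n - p + 1)%R))%N =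
  ind H s fullv.
Proof.
have le t : (ind H t (o p) + ind H (t (+) sg n) (o (n - p + 1)%R) <= ind H t fullv)%N.
  rewrite -(ind_conjv Qsym) (leq_trans (ind_orth Hherm t (orth_dual (p := p) oo))) //.
  by apply: indS; exact: subvf.
have rV : rad H fullv = 0%VS.
  have [L Lbot] := o_bot PD.
  by rewrite -(Lbot o L oo (lexx _)) (phs_rad PD oo ho).
have := ind_nondeg Hherm s rV; rewrite dimvf /dim /= mul1n.
have := le s; have := le (~~ s); rewrite addNb.
have := ind_total s p; have := ind_total (s (+) sg n) (n - p + 1).
have := dim_levels PD p; lia.
Qed.

(** When the dual level has its full indices, orthogonality leaves no room for an excess at level p.
    Without a radical there, no excess in either sign means no deficit. *)
Lemma ind_dual_good F p : orbC o F -> rad H (F p) = 0%VS ->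
  (forall s, (ind H s (o (n - p + 1)%R) <= ind H s (F (n - p + 1)%R))%N) ->
  forall s, (ind H s (o p) <= ind H s (F p))%N.
Proof.
move=> oF r0 good s.
have le t : (ind H t (F p) <= ind H t (o p))%N.
  have : (ind H t (F p) + ind H (t (+) sg n) (F (n - p + 1)%R) <= ind H t fullv)%N.
    rewrite -(ind_conjv Qsym) (leq_trans (ind_orth Hherm t (orth_dual (p := p) oF))) //.
    by apply: indS; exact: subvf.
  by have := ind_dual t p; have := good (t (+) sg n); lia.
have := ind_nondeg Hherm s r0; rewrite (orb_dim _ oF).
have := ind_total s p; have := le (~~ s); lia.
Qed.

(* Only finitely many levels matter, so local conditions at each level can be
   imposed at once. *)
Lemma all_levels (P : R[i] -> int -> Prop) :
  (forall e e' p, e' <= e -> P e p -> P e' p) ->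
  (forall p, exists2 e, 0 < e & P e p) ->
  exists2 e, 0 < e & forall p, P e p \/ forall F, orbC o F -> F p = o p.
Proof.
move=> Pmono Pex; have [M Mtop] := o_top PD; have [L Lbot] := o_bot PD.
have [e e0 He] : exists2 e, 0 < e & forall k : nat, (k < `|M - L|)%N -> P e (L + k%:Z).
  elim: `|M - L|%N => [|k [e e0 IH]]; first by exists 1.
  have [e' e'0 He'] := Pex (L + k%:Z).
  have cmp : e >=< e' by rewrite comparablerE realB // gtr0_real.
  exists (Order.min e e'); first by rewrite comparable_lt_min // e0.
  move=> j; rewrite ltnS leq_eqVlt => /orP[/eqP ->|jk].
    by apply: Pmono He'; rewrite comparable_ge_min // lexx orbT.
  by apply: Pmono (IH j jk); rewrite comparable_ge_min // lexx.
exists e => // p.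
have [pL|Lp] := lerP p L; first by right=> F oF; rewrite (Lbot F) // (Lbot o).
have [Mp|pM] := lerP M p; first by right=> F oF; rewrite (Mtop F) // (Mtop o).
left; have -> : p = L + `|p - L|%N%:Z by lia.
by apply: He; lia.
Qed.

Lemma close_mono (e e' : R[i]) (g : 'M[R[i]]_d) :
  e' <= e -> close_to_1 e' g -> close_to_1 e g.
Proof. by move=> le cg i j; exact: lt_le_trans (cg i j) le. Qed.

Lemma ind_open_act2 F p : exists2 e, 0 < e & forall s g, close_to_1 e g ->
  (ind H s (F p) <= ind H s (act F g p))%N.
Proof.
have [e1 e10 He1] := ind_open_act F true p.
have [e2 e20 He2] := ind_open_act F false p.
have cmp : e1 >=< e2 by rewrite comparablerE realB // gtr0_real.
exists (Order.min e1 e2); first by rewrite comparable_lt_min // e10.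
move=> s g cg; case: s.
  by apply: He1; apply: close_mono cg; rewrite comparable_ge_min // lexx.
by apply: He2; apply: close_mono cg; rewrite comparable_ge_min // lexx orbT.
Qed.

(** Used in contrapositive form: a boundary point has a nonzero radical at some level. *)
Lemma nondeg_interior F : orbC o F -> closure D F ->
  (forall p, rad H (F p) = 0%VS) -> D° F.
Proof.
move=> oF clF r0; apply/open_flagP.
have [|p|e e0 He] := @all_levels (fun e p => forall s g, close_to_1 e g ->
    (ind H s (F p) <= ind H s (act F g p))%N).
- by move=> e e' p le Pe s g cg; apply: Pe; exact: close_mono cg.
- exact: ind_open_act2.
exists e => // g cg Gg; have og := orbC_act oF Gg.
apply/(period_domainP og) => s p; have [Hp|Fo] := He p; last by rewrite Fo.
apply: leq_trans (Hp s g cg).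
have := ind_closure_ge s p oF clF; by rewrite r0 dimv0 addn0.
Qed.

End PeriodDomainTopology.

(** * Discs through the boundary *)

Section Disc.
Context {R : realType} {d : nat} {Q : 'M[R]_d} {n : int} {h : int -> nat} {o : flag Q}.
Hypothesis PD : period_datum n h o.
Local Notation H := (HQ (Q := Q) (n := n)).
Local Notation D := (period_domain n h o).
Implicit Types (p q : int) (s : bool).

Let Hherm : H^T = conj_mx H := H_herm PD.
Let Qnondeg : Q \in unitmx. Proof. by case: PD. Qed.

Context {F : flag Q} {X : 'M[R[i]]_d}.
Hypothesis XQ : X *m cplx Q + cplx Q *m X^T = 0.
Hypothesis X3 : X *m X *m X = 0.

Definition disc (r z : R[i]) : flag Q := act F (texp X (r * z)).

(** The group law reduces continuity and holomorphy at any point to the behaviour of [texp X] near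
    0. *)
Lemma disc_shift r z z' : disc r z' = act (disc r z) (texp X (r * (z' - z))).
Proof. by rewrite /disc act_comp texpD // -mulrDr addrCA subrr addr0. Qed.

Lemma disc_continuous r : continuous (disc r).
Proof.
move=> z A /nbhs_flagP[e e0 He].
have [r' r'0 close] := texp_close X e0.
have D0 : 0 < `|r| + 1 by rewrite ltr_wpDl.
apply/nbhs_ballP; exists (r' / (`|r| + 1)) => /=; first exact: divr_gt0.
move=> z'; rewrite -ball_normE /= distrC => zz'; rewrite /= (disc_shift r z).
apply: He (GC_texp Qnondeg _ XQ X3); apply: close; rewrite normrM.
apply: (@le_trans _ _ ((`|r| + 1) * (r' / (`|r| + 1)))).
  by rewrite ler_pM // ?lerDl // ltW.
by rewrite mulrC divfK // lt0r_neq0.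
Qed.

Lemma derivable_texp (r z0 z : R[i]) i j :
  derivable (fun w : R[i] => texp X (r * (w - z0)) i j) z 1.
Proof.
pose l : R[i] -> R[i] := cst r * (id - cst z0).
have -> : (fun w : R[i] => texp X (r * (w - z0)) i j) =
  cst ((1%:M : 'M[R[i]]_d) i j) + l * cst (X i j)
   + (l * l) * cst (2^-1 * (X *m X) i j).
  apply: funext => w; rewrite /texp !mxE /l /= expr2 !fctE; ring.
have dl : derivable l z 1.
  apply: derivableM; first exact: derivable_cst.
  by apply: derivableB; [exact: derivable_id | exact: derivable_cst].
have dc (c : R[i]) : derivable (cst c : R[i] -> R[i]) z 1 by exact: derivable_cst.
move: ((1%:M : 'M[R[i]]_d) i j) (X i j) (2^-1 * (X *m X) i j) => a b c.
have dlc := derivableM dl (dc b); have dll := derivableM dl dl.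
exact: derivableD (derivableD (dc a) dlc) (derivableM dll (dc c)).
Qed.

Lemma disc_holomorphic r (U : set R[i]) : flag_holomorphic U (disc r).
Proof.
move=> z0 _; exists (fun z => texp X (r * (z - z0))); apply/nbhs_ballP.
exists 1 => //= z _; split; [exact: GC_texp|exact: disc_shift|].
by move=> i j; exact: derivable_texp.
Qed.

Hypothesis oF : orbC o F.
Context {O : set (flag Q)} {j0 : int}.
Hypothesis hO : codim1_boundary_orbit n h o O.
Hypothesis OF : O F.
Hypothesis rad_other : forall p, p != j0 -> p != n - j0 + 1 -> rad H (F p) = 0%VS.
Hypothesis rad_j0 : (\dim (rad H (F j0)) <= 1)%N.
Hypothesis rad_j0S : rad H (F (j0 + 1)%R) = 0%VS.
Hypothesis X_gain : forall z, z != 0 -> exists P,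
  [/\ (P <= act F (texp X z) j0)%VS, definite H (sg j0) P
    & (ind H (sg j0) (F j0) < \dim P)%N].

Let clF : closure D F. Proof. by case: hO => _ /(_ F OF)[]. Qed.

Lemma disc_pseudoconcave : pseudoconcave_boundary_orbit n h o O.
Proof.
split=> //.
have [|p|e e0 He] := @all_levels _ _ _ _ _ _ PD (fun e p => forall s g,
    close_to_1 e g -> (ind H s (F p) <= ind H s (act F g p))%N).
- by move=> e e' p le Pe s g cg; apply: Pe; exact: close_mono cg.
- exact: (ind_open_act2 PD).
have [r r0 close] := texp_close X e0.
exists (disc r).
have inD z : `|z| <= 1 -> z != 0 -> D (disc r z).
  move=> z1 z0; pose g := texp X (r * z); pose G := act F g.
  have Gg : GC (Q := Q) g by exact: GC_texp.
  have oG : orbC o G := orbC_act oF Gg.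
  have cg : close_to_1 e g.
    by apply: close; rewrite normrM (gtr0_norm r0) ler_piMr // ltW.
  have rz0 : r * z != 0 by rewrite mulf_neq0 // lt0r_neq0.
  have up s p : (ind H s (F p) <= ind H s (G p))%N.
    have [Hp|Fo] := He p; first exact: Hp.
    by rewrite (Fo _ oF) (Fo _ oG).
  have good0 s : (ind H s (o j0) <= ind H s (G j0))%N.
    have [->|sE] : s = sg j0 \/ s = ~~ sg j0 by move: s (sg j0) => [] []; auto.
      (* The gain of one dimension makes up for the radical of [F j0], which is at most a line. *)
      have [P [PG dP ltP]] := X_gain rz0.
      apply: leq_trans (ind_max PG dP); apply: leq_trans ltP.
      rewrite -addn1 (leq_trans (ind_closure_ge PD _ _ oF clF)) // leq_add2l.
      exact: rad_j0.
    by rewrite sE; exact: leq_trans (ind_closure_other PD oF clF rad_j0S) (up _ _).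
  apply/(period_domainP PD oG) => s p.
  have [->|pj0] := eqVneq p j0; first exact: good0.
  have [pj0'|pj0'] := eqVneq p (n - j0 + 1); last first.
    apply: leq_trans (up s p); have := ind_closure_ge PD s p oF clF.
    by rewrite rad_other // dimv0 addn0.
  have nE : n - p + 1 = j0 by rewrite pj0'; lia.
  apply: (ind_dual_good PD oG); last by move=> t; rewrite nE.
  (* Full indices of both signs at [j0] leave no room for a radical there, hence none at the dual
     level. *)
  apply/eqP; rewrite -dimv_eq0 pj0' (rad_dual PD _ oG) dim_conjv.
  have := ind_sum Hherm true (G j0); rewrite (orb_dim _ oG) /=.
  have := ind_total PD true j0; have := good0 true; have := good0 false; rewrite /=.
  lia.
have disc0 : disc r 0 = F by rewrite /disc mulr0 texp0 act1.
split.
- by apply: continuous_subspaceT; exact: disc_continuous.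
- exact: disc_holomorphic.
- move=> z z1; have [->|z0] := eqVneq z 0; first by rewrite disc0.
  exact: subset_closure (inD z z1 z0).
- by rewrite disc0.
- move=> z z1; apply: inD; first by rewrite z1.
  by rewrite -normr_gt0 z1.
Qed.

End Disc.

(** * Directions that gain a definite vector *)

Section Projections.
Context {R : realType} {d : nat} (H : 'M[R[i]]_d).
Hypothesis Hherm : H^T = conj_mx H.
Implicit Types (u v e f : 'rV[R[i]]_d) (s : bool) (U P : {vspace 'rV[R[i]]_d}).

Lemma mulmx_rank1 u (c : 'cV[R[i]]_d) e :
  u *m (1%:M - c *m e) = u - (u *m c) 0 0 *: e.
Proof.
by rewrite mulmxBr mulmx1 mulmxA [X in X *m e]mx11_scalar mul_scalar_mx.
Qed.

(** Multiples of the radical vector [e] do not affect H, so a linear condition that is nonzero on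
    [e] can be imposed on [P] without loss. *)
Lemma project_rad s U P e (c : 'cV[R[i]]_d) : e \in rad H U -> (P <= U)%VS ->
  definite H s P -> (e *m c) 0 0 != 0 ->
  exists P', [/\ (P' <= U)%VS, definite H s P', \dim P' = \dim P &
    forall u, u \in P' -> (u *m c) 0 0 = 0 /\ exists2 v, v \in P & exists a, u = v - a *: e].
Proof.
move=> /mem_rad[eU er] PU dP ec0.
pose c' := ((e *m c) 0 0)^-1 *: c; pose M := 1%:M - c' *m e.
have ME u : u *m M = u - ((e *m c) 0 0)^-1 * (u *m c) 0 0 *: e.
  rewrite /M mulmx_rank1 /c' -scalemxAr; congr (_ - _ *: _).
  by rewrite mxE.
have [u uP u0|dP' dimP'] := @definite_image _ _ H s P M.
  have uU := subvP PU u uP.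
  rewrite ME; set a := _^-1 * _; rewrite hfBl !hfBr !hfZl !hfZr.
  rewrite (er u) // (er e) // (hf_eq0C Hherm (er u uU)) !(mulr0, subr0).
  exact: dP.
exists (linfun (mulmxr M) @: P)%VS; split=> //.
  apply/subvP => _ /memv_imgP[v vP ->]; rewrite lfunE /= ME.
  by rewrite memvB ?memvZ // (subvP PU).
move=> _ /memv_imgP[v vP ->]; rewrite lfunE /= ME; split.
  rewrite mulmxBl -scalemxAl; move: (v *m c) (e *m c) ec0 => x y y0.
  by rewrite !mxE mulrAC mulVf // mul1r subrr.
by exists v => //; eexists.
Qed.

(** Removing the component along a vector of the opposite sign can only increase the signed form. *)
Lemma project_neg s U P f : f \in U -> 0 < (-1) ^+ (~~ s) * hf H f f ->
  (P <= U)%VS -> definite H s P ->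
  exists P', [/\ (P' <= U)%VS, definite H s P', \dim P' = \dim P &
    forall u, u \in P' -> hf H u f = 0].
Proof.
move=> fU fneg PU dP.
have ff0 : hf H f f != 0 by apply: contraTneq fneg => ->; rewrite mulr0 ltxx.
pose c := (hf H f f)^-1 *: (H *m (conj_mx f)^T); pose M := 1%:M - c *m f.
have ME u : u *m M = u - (hf H u f / hf H f f) *: f.
  rewrite /M mulmx_rank1 /c -scalemxAr; congr (_ - _ *: _).
  by rewrite mxE mulmxA mulrC.
have orthM u : hf H (u *m M) f = 0 by rewrite ME hfBl hfZl divfK // subrr.
have [u uP u0|dP' dimP'] := @definite_image _ _ H s P M.
  have uE : u = u *m M + (hf H u f / hf H f f) *: f by rewrite ME subrK.
  set a := hf H u f / _ in uE.
  have uu : hf H u u = hf H (u *m M) (u *m M) + a * a^* * hf H f f.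
    by rewrite {1 2}uE (hf_add_orth Hherm) ?hfZ2 // hfZr orthM mulr0.
  have -> : (-1) ^+ s * hf H (u *m M) (u *m M) =
      (-1) ^+ s * hf H u u + a * a^* * ((-1) ^+ (~~ s) * hf H f f).
    by rewrite uu signN mulrN mulrDr mulrCA addrK.
  by rewrite ltr_pwDl ?dP // mulr_ge0 ?mul_conjC_ge0 // ltW.
exists (linfun (mulmxr M) @: P)%VS; split=> //.
  apply/subvP => _ /memv_imgP[v vP ->]; rewrite lfunE /= ME.
  by rewrite memvB ?memvZ // (subvP PU).
by move=> _ /memv_imgP[v vP ->]; rewrite lfunE /= orthM.
Qed.

Lemma definite_add s P w : definite H s P -> (forall u, u \in P -> hf H u w = 0) ->
  0 < (-1) ^+ s * hf H w w ->
  definite H s (P + <[w]>)%VS /\ \dim (P + <[w]>) = (\dim P).+1.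
Proof.
move=> dP oP wpos.
have w0 : w != 0 by apply: contraTneq wpos => ->; rewrite hf0l mulr0 ltxx.
have oPw : orth H P <[w]>%VS.
  by move=> u _ uP /vlineP[a ->]; rewrite hfZr oP // mulr0.
split; last by rewrite (dimv_disjoint_sum (orth_cap0 oPw dP)) dim_vline w0 addn1.
apply: (orth_definite Hherm oPw dP) => _ /vlineP[a ->].
rewrite scaler_eq0 negb_or => /andP[a0 _].
by rewrite hfZ2 mulrCA mulr_gt0 // mul_conjC_gt0.
Qed.

Lemma indefinite_plane s u v : 0 <= (-1) ^+ s * hf H u u -> hf H v u != 0 ->
  exists a, 0 < (-1) ^+ s * hf H (a *: u + v) (a *: u + v).
Proof.
move=> u_ge0 vu0; set c := hf H v u in vu0.
pose q := (-1) ^+ s * hf H v v.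
have cc0 : c * c^* != 0 by rewrite mulf_neq0 // conjC_eq0.
have qR : q^* = q by apply/CrealP; rewrite realM ?(hf_real Hherm) // realX ?realN ?real1.
(* With a = (-1)^s t c the cross terms contribute 2 t |c|^2, so together with the value [q] at [v]
   they make exactly 1; the contribution of [u] is nonnegative. *)
pose t := (1 - q) / (2 * (c * c^*)).
have tR : t^* = t.
  by rewrite /t !(cjM, cjV, cjB, cj1, cj_nat, qR, conjCK) [c^* * c]mulrC.
have tE : t * (2 * (c * c^*)) = 1 - q by rewrite divfK // mulf_neq0 ?pnatr_eq0.
clearbody t; exists ((-1) ^+ s * t * c).
set a := (-1) ^+ s * t * c.
have -> : (-1) ^+ s * hf H (a *: u + v) (a *: u + v) =
    a * a^* * ((-1) ^+ s * hf H u u) + 1.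
  have aE : a^* = (-1) ^+ s * t * c^* by rewrite /a !cjM tR cj_sign.
  have ss : (-1) ^+ s * (-1) ^+ s = 1 :> R[i] by rewrite -expr2 sqrr_sign.
  rewrite hfDl !hfDr hfZ2 hfZl hfZr -(hf_conj Hherm v u) -/c.
  have E (K : comNzRingType) (sn A A' C C' U V T : K) : sn * sn = 1 -> A = sn * T * C ->
      A' = sn * T * C' ->
      sn * (A * A' * U + A * C' + (A' * C + V)) =
      A * A' * (sn * U) + (T * (2 * (C * C')) + sn * V).
    move=> ss1 -> ->.
    have -> : sn * (sn * T * C * (sn * T * C') * U + sn * T * C * C' +
      (sn * T * C' * C + V)) = sn * T * C * (sn * T * C') * (sn * U) +
       (sn * sn) * (T * (2 * (C * C'))) + sn * V by ring.
    by rewrite ss1 mul1r addrA.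
  by rewrite (E _ _ _ _ c c^* _ _ t ss _ aE) // tE -/q subrK.
by rewrite ltr_wpDl // mulr_ge0 ?mul_conjC_ge0.
Qed.

End Projections.

Section PairingEndomorphism.
Context {R : realType} {d : nat} {Q : 'M[R]_d} {n : int}.
Hypothesis Qsym : Q^T = (-1) ^ n *: Q.
Implicit Types (u v a b : 'rV[R[i]]_d).
Local Notation form := (form (Q := Q)).

(* The element a b of the exterior (n even) or symmetric (n odd) square of V_C,
   which Q identifies with the Lie algebra. *)
Definition pair_mx a b : 'M[R[i]]_d :=
  cplx Q *m a^T *m b - (-1) ^+ sg n *: (cplx Q *m b^T *m a).

Lemma mul_pair_mx v a b :
  v *m pair_mx a b = form v a *: b - ((-1) ^+ sg n * form v b) *: a.
Proof.
have E x y : v *m (cplx Q *m x^T *m y) = form v x *: y.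
  by rewrite !mulmxA [X in X *m y]mx11_scalar mul_scalar_mx.
by rewrite /pair_mx mulmxBr -scalemxAr !E scalerA.
Qed.

Lemma pair_mx_lie a b : pair_mx a b *m cplx Q + cplx Q *m (pair_mx a b)^T = 0.
Proof.
have cQT : (cplx Q)^T = (-1) ^+ sg n *: cplx Q.
  by rewrite /cplx map_trmx Qsym signzE map_mxZ rmorph_sign.
have T : (pair_mx a b)^T = (-1) ^+ sg n *: (b^T *m (a *m cplx Q)) -
    a^T *m (b *m cplx Q).
  rewrite /pair_mx [LHS]linearB [X in _ - X]linearZ /= !trmx_mul !trmxK cQT.
  by rewrite -!scalemxAr scalerA -expr2 sqrr_sign scale1r.
rewrite T /pair_mx mulmxBl mulmxBr -!(scalemxAl, scalemxAr) !mulmxA.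
by rewrite addrA subrK subrr.
Qed.

Lemma mx_eq0_row (A : 'M[R[i]]_d) : (forall v : 'rV[R[i]]_d, v *m A = 0) -> A = 0.
Proof. by move=> A0; apply/row_matrixP => i; rewrite rowE A0 row0. Qed.

Lemma mul_texp v X z : v *m texp X z =
  v + z *: (v *m X) + (z ^+ 2 / 2) *: (v *m X *m X).
Proof. by rewrite /texp !mulmxDr mulmx1 -!scalemxAr mulmxA. Qed.

Lemma texp_fixed v X z : v *m X = 0 -> v *m texp X z = v.
Proof. by move=> vX; rewrite mul_texp vX mul0mx !scaler0 !addr0. Qed.

End PairingEndomorphism.

(** * Vectors of prescribed sign at a boundary point *)

Section LimitVectors.
Context {R : realType} {d : nat} {Q : 'M[R]_d} {n : int} {h : int -> nat} {o : flag Q}.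
Hypothesis PD : period_datum n h o.
Local Notation H := (HQ (Q := Q) (n := n)).
Local Notation D := (period_domain n h o).
Context {F : flag Q}.
Hypothesis oF : orbC o F.
Hypothesis clF : closure D F.
Implicit Types (u v w : 'rV[R[i]]_d) (p q t : int) (s : bool).

Let Hherm : H^T = conj_mx H := H_herm PD.
Let Qsym : Q^T = (-1) ^ n *: Q. Proof. by case: PD. Qed.

(* Without such a vector, the piece and definite subspaces of F^(t+1) and of the
   conjugate of F^(n-t+1), all orthogonal, would add up to a semidefinite
   subspace too large for the signature of H. *)
Lemma piece_vector_ind s t :
  (d < \dim (hodge_piece n F t) + ind H (~~ s) (F (t + 1)%R)
     + ind H (~~ s) (conjv (F (n - t + 1)%R)) + ind H s fullv)%N ->
  exists2 v, v \in hodge_piece n F t & 0 < (-1) ^+ s * hf H v v.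
Proof.
move=> dlt; apply: contrapT => no.
have [P1 [P1F dim1 d1]] := ind_ex H (~~ s) (F (t + 1)%R).
have [P2 [P2F dim2 d2]] := ind_ex H (~~ s) (conjv (F (n - t + 1)%R)).
have sE : semidefinite H (~~ s) (hodge_piece n F t).
  move=> v vE; rewrite signN oppr_ge0 real_leNgt ?real0 //.
    by apply/negP => v0; apply: no; exists v.
  by rewrite realM ?(hf_real Hherm) // realX ?realN ?real1.
have o12 : orth H P1 P2.
  move=> u v /(subvP P1F) uF /(subvP P2F)/mem_conjv cv; apply/hf_eq0E.
  by apply: (orb_form PD oF _ uF cv); lia.
have oE : orth H (P1 + P2) (hodge_piece n F t).
  move=> _ v /memv_addP[u1 u1P [u2 u2P ->]] vE; rewrite hfDl.
  rewrite (orb_piece_orth PD oF (_ : t < t + 1) (subvP P1F _ u1P) vE); last by lia.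
  rewrite add0r; apply: (hf_eq0C Hherm); apply/hf_eq0E.
  have /mem_conjv cu := subvP P2F _ u2P; have [vF _] := proj1 (mem_piece F t v) vE.
  by apply: (orb_form PD oF _ vF cu); lia.
have dP := orth_definite Hherm o12 d1 d2.
have sW := orth_semi Hherm oE (definite_semi dP) sE.
have := ind_semi (subvf _) sW.
rewrite (dimv_disjoint_sum (orth_cap0 oE dP)) (dimv_disjoint_sum (orth_cap0 o12 d1)) dim1 dim2.
by rewrite dimvf /dim /= mul1n; lia.
Qed.

(** The two definite subspaces of [piece_vector_ind] fall short of their dimensions in D by at most
    the radicals of their levels, while the piece has dimension at least [h t]. *)
Lemma piece_vector t :
  (\dim (rad H (F (t + 1)%R)) + \dim (rad H (F (n - t + 1)%R)) < h t)%N ->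
  exists2 v, v \in hodge_piece n F t & 0 < (-1) ^+ sg t * hf H v v.
Proof.
move=> hlt; apply: piece_vector_ind.
have := piece_dim_ge PD t oF.
have := ind_closure_ge PD (~~ sg t) (t + 1) oF clF.
have := ind_closure_ge PD (~~ sg t (+) sg n) (n - t + 1) oF clF.
rewrite (ind_conjv Qsym); have := ind_dual PD (~~ sg t) t.
have := ind_step PD (~~ sg t) t; have -> : (sg t == ~~ sg t) = false by case: (sg t).
have : (ind H (sg t) fullv + ind H (~~ sg t) fullv)%N = d.
  have := ind_dual PD (sg t) t; have := ind_dual PD (~~ sg t) t.
  have := ind_total PD (sg t) t; have := ind_total PD (sg t (+) sg n) (n - t + 1).
  rewrite -addNb; have := dim_levels PD t; lia.
lia.
Qed.

(** In even weight twice the real part [x] and, up to sign, twice the imaginary part [y] satisfy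
    H(x, x) + H(y, y) = 4 H(v, v), so one of them keeps the sign. *)
Lemma real_vector s (U : {vspace 'rV[R[i]]_d}) v : ~~ sg n -> (forall u, u \in U -> conj_mx u \in U) ->
  v \in U -> 0 < (-1) ^+ s * hf H v v ->
  exists x, [/\ x \in U, conj_mx x = x & 0 < (-1) ^+ s * hf H x x].
Proof.
move=> /negPf n0 Uc vU vpos.
pose x := v + conj_mx v; pose y := 'i%C *: (v - conj_mx v).
have ii : ('i%C : R[i]) * ('i%C)^* = 1 by rewrite -normCK normCi expr1n.
have sum4 : (-1) ^+ s * hf H x x + (-1) ^+ s * hf H y y = 4 * ((-1) ^+ s * hf H v v).
  rewrite /y hfZ2 ii mul1r /x !(hfDl, hfDr, hfNl, hfNr).
  by rewrite (hf_conj_mx Qsym v v) n0 expr0 mul1r; ring.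
have reals z : (-1) ^+ s * hf H z z \is Num.real.
  by rewrite realM ?(hf_real Hherm) // realX ?realN ?real1.
have xc : conj_mx x = x by rewrite /x conj_mxD conj_mxK addrC.
have yc : conj_mx y = y.
  by rewrite /y conj_mxZ conj_mxB conj_mxK conjCi scaleNr -scalerN opprB.
have [xpos|xneg] := real_ltP (real0 _) (reals x).
  by exists x; split=> //; rewrite /x memvD ?Uc.
exists y; split=> //; first by rewrite /y memvZ // memvB ?Uc.
have : 0 < 4 * ((-1) ^+ s * hf H v v) by rewrite mulr_gt0.
by rewrite -sum4 => /lt_le_trans; apply; rewrite gerDr.
Qed.

End LimitVectors.

Ltac level_lia := repeat match goal with
  | Hyp : ?T |- _ => lazymatch type of T with
    | Prop => lazymatch T with
      | is_true (@Order.le _ _ _ _) => fail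
      | is_true (@Order.lt _ _ _ _) => fail
      | is_true (negb (@eq_op ?A _ _)) =>
          tryif unify (Equality.sort A) int then fail else clear Hyp
      | @eq ?A _ _ => tryif unify A int then fail else clear Hyp
      | _ => clear Hyp
      end
    end
  end; lia.

(** * Gains from a piece above level [j0] *)

Section Gains.
Context {R : realType} {d : nat} {Q : 'M[R]_d} {n : int} {h : int -> nat} {o : flag Q}.
Hypothesis PD : period_datum n h o.
Local Notation H := (HQ (Q := Q) (n := n)).
Local Notation form := (form (Q := Q)).
Context {F : flag Q}.
Hypothesis oF : orbC o F.
Context {j0 : int} {e : 'rV[R[i]]_d}.
Hypothesis e_rad : e \in rad H (F j0).
Hypothesis e_neq0 : e != 0.
Implicit Types (u v w b f : 'rV[R[i]]_d) (p q t : int) (s : bool) (z : R[i]).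

Let Hherm : H^T = conj_mx H := H_herm PD.
Let Qsym : Q^T = (-1) ^ n *: Q. Proof. by case: PD. Qed.
Let Qnondeg : Q \in unitmx. Proof. by case: PD. Qed.

(* The hypothesis on the disc z |-> act F (texp X z) in disc_pseudoconcave. *)
Definition gains := exists X : 'M[R[i]]_d,
  [/\ X *m cplx Q + cplx Q *m X^T = 0, X *m X *m X = 0
    & forall z, z != 0 -> exists P,
      [/\ (P <= act F (texp X z) j0)%VS, definite H (sg j0) P
        & (ind H (sg j0) (F j0) < \dim P)%N]].

Let eF : e \in F j0. Proof. by case/(mem_radF PD _ _ oF): e_rad. Qed.
Let ceF : conj_mx e \in F (n - j0 + 1).
Proof. by case/(mem_radF PD _ _ oF): e_rad. Qed.
Let e_perp u : u \in F j0 -> hf H u e = 0.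
Proof.
by move=> uF; apply: (hf_eq0C Hherm); have /mem_rad[_] := e_rad; apply.
Qed.

Let fz p q u v : u \in F p -> v \in F q -> n + 1 <= p + q -> form u v = 0.
Proof. by move=> uF vF pq; exact: (orb_form PD oF pq uF vF). Qed.

Let fcj u v : form (conj_mx u) v = (form u (conj_mx v))^*.
Proof. by rewrite form_conj conj_mxK. Qed.

Lemma form_neq0_of_hf s f : 0 < (-1) ^+ s * hf H f f -> form f (conj_mx f) != 0.
Proof.
by move=> fpos; apply: contraTneq fpos => /hf_eq0E ->; rewrite mulr0 ltxx.
Qed.

Lemma mem_act_vec (u : 'rV[R[i]]_d) (g : 'M[R[i]]_d) p :
  u \in F p -> u *m g \in act F g p.
Proof. by move=> uF; apply/mem_act; exists u. Qed.

Lemma hf_colE u b : (u *m (H *m (conj_mx b)^T)) 0 0 = hf H u b.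
Proof. by rewrite mulmxA. Qed.

Lemma form_colE u b : (u *m (cplx Q *m b^T)) 0 0 = form u b.
Proof. by rewrite mulmxA. Qed.

(** If all of F^(n-j0+1) were orthogonal to conj [e], the latter would lie in the annihilator of
    that level, which is F^j0. *)
Lemma exists_partner : conj_mx e \notin F j0 ->
  exists2 b, b \in F (n - j0 + 1) & form b (conj_mx e) != 0.
Proof.
move=> ce; apply: contrapT => no; case/negP: ce.
have <- : n - (n - j0 + 1) + 1 = j0 by level_lia.
apply: (orb_perp PD oF) => u uF; apply: contrapT => /eqP u0; apply: no.
by exists u.
Qed.

Section Above.
Context {t : int} {f : 'rV[R[i]]_d}.
Hypothesis f_piece : f \in hodge_piece n F t.

Let fF : f \in F t. Proof. by case/mem_piece: f_piece. Qed.
Let cfF : conj_mx f \in F (n - t). Proof. by case/mem_piece: f_piece. Qed.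

(* X = conj f /\ b fixes a definite subspace P2 of F^j0 of maximal dimension and
   moves f off the orthogonal of the null vector e, so that the plane spanned by
   e and the image of f, orthogonal to P2, is indefinite. *)
Lemma gains_above : n + 2 <= 2 * j0 -> j0 + 1 <= t ->
  0 < (-1) ^+ (~~ sg j0) * hf H f f -> conj_mx e \notin F j0 -> gains.
Proof.
move=> nj jt fneg /exists_partner[b0 b0F b0e].
pose lam := form f (conj_mx f).
have lam0 : lam != 0 by exact: form_neq0_of_hf fneg.
have fFj p : p <= t -> f \in F p.
  by move=> pt; exact: subvP (orb_decr PD oF pt) f fF.
have fe : form f (conj_mx e) = 0 by apply: fz fF ceF _; level_lia.
have cff : form (conj_mx f) (conj_mx f) = 0.
  by rewrite -form_conj (fz fF fF) ?cj0 //; level_lia.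
(* [f] lies in F^(n-j0+1) and is orthogonal to conj [e], so the correction keeps both the level of
   [b] and its pairing with conj [e]. *)
pose b := b0 - (form b0 (conj_mx f) / lam) *: f.
have bF : b \in F (n - j0 + 1) by rewrite memvB // memvZ // fFj //; level_lia.
have be : form b (conj_mx e) != 0 by rewrite formBl formZl fe mulr0 subr0.
have bf : form b (conj_mx f) = 0 by rewrite formBl formZl divfK // subrr.
have fb : form (conj_mx f) b = 0 := form_eq0C Qsym bf.
pose X := pair_mx (Q := Q) (n := n) (conj_mx f) b.
have XE v := mul_pair_mx (n := n) v (conj_mx f) b : v *m X = _.
pose k := - ((-1) ^+ sg n * form b b).
have bX : b *m X = k *: conj_mx f by rewrite XE bf scale0r sub0r -scaleNr.
have cfX : conj_mx f *m X = 0 by rewrite XE cff fb mulr0 !scale0r subrr.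
exists X; split; first exact: pair_mx_lie.
  apply: mx_eq0_row => v; rewrite !mulmxA (XE v) !mulmxBl -!scalemxAl bX cfX.
  by rewrite -!scalemxAl cfX mul0mx !scaler0 subrr.
move=> z z0; have [P0 [P0F dimP0 dP0]] := ind_ex H (sg j0) (F j0).
have fFj0 : f \in F j0 by apply: fFj; level_lia.
(* The component along [f] is cleared thanks to its opposite sign, the one seen by [b] by
   subtracting multiples of [e]; as [e] is orthogonal to [f], the second step does not undo the
   first. *)
have [P1 [P1F dP1 dimP1 P1f]] := project_neg Hherm fFj0 fneg P0F dP0.
have eb : (e *m (H *m (conj_mx b)^T)) 0 0 != 0.
  rewrite hf_colE; apply: contraNneq be => /hf_eq0E eb.
  by rewrite (formC Qsym) fcj eb cj0 mulr0.
have [P2 [P2F dP2 dimP2 P2e]] := project_rad Hherm e_rad P1F dP1 eb.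
have ef : hf H e f = 0 by apply: (hf_eq0C Hherm); exact: e_perp.
have P2f u : u \in P2 -> hf H u f = 0.
  by move=> /P2e[_ [v vP [a ->]]]; rewrite hfBl hfZl P1f // ef mulr0 subrr.
have P2b u : u \in P2 -> hf H u b = 0 by move=> /P2e[<-]; rewrite hf_colE.
have fixed u : u \in F j0 -> hf H u f = 0 -> u *m texp X z = u.
  move=> uF /hf_eq0E uf; apply: texp_fixed; rewrite XE uf scale0r sub0r.
  by rewrite (fz uF bF) ?mulr0 ?scale0r ?oppr0 //; level_lia.
pose fT := f *m texp X z.
have fTE : fT = f + (z * lam) *: b + (z ^+ 2 / 2 * lam * k) *: conj_mx f.
  rewrite /fT mul_texp XE -/lam (fz fFj0 bF); last by level_lia.
  by rewrite mulr0 scale0r subr0 -scalemxAl bX !scalerA.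
have cfe u : u \in F j0 -> hf H u (conj_mx f) = 0.
  by move=> uF; apply/hf_eq0E; rewrite conj_mxK (fz uF fF) //; level_lia.
have fTe : hf H fT e != 0.
  rewrite fTE !hfDl !hfZl (e_perp fFj0) (hf_eq0C Hherm (cfe e eF)) mulr0 addr0 add0r.
  apply: mulf_neq0; first exact: mulf_neq0.
  by apply: contra be => /eqP/hf_eq0E ->.
have [|a wpos] := @indefinite_plane _ _ H Hherm (sg j0) e fT _ fTe.
  by rewrite e_perp // mulr0.
set w := a *: e + fT in wpos.
have wP u : u \in P2 -> hf H u w = 0.
  move=> uP; have uF := subvP P2F u uP.
  rewrite /w fTE !hfDr !hfZr e_perp // P2f // P2b // cfe //.
  by rewrite !mulr0 !addr0.
have [dP dimP] := definite_add Hherm dP2 wP wpos.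
exists (P2 + <[w]>)%VS; split=> //; last by rewrite dimP dimP2 dimP1 dimP0.
rewrite subv_add; apply/andP; split.
  apply/subvP => u uP; rewrite -(fixed u (subvP P2F u uP) (P2f u uP)).
  exact/mem_act_vec/(subvP P2F).
rewrite -memvE memvD ?mem_act_vec // memvZ //.
by rewrite -(fixed e eF ef) mem_act_vec.
Qed.

(* Here Q is alternating and F^j0 is its own dual level: b pairs with e itself,
   whose image e + B conj f has the sign of conj f. *)
Lemma gains_above_odd : n + 1 = 2 * j0 -> j0 + 1 <= t ->
  0 < (-1) ^+ (~~ sg j0) * hf H f f -> gains.
Proof.
move=> nj jt fneg.
have n1 : sg n = true by rewrite /sg; level_lia.
pose lam := form f (conj_mx f).
have lam0 : lam != 0 by exact: form_neq0_of_hf fneg.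
have fFj p : p <= t -> f \in F p.
  by move=> pt; exact: subvP (orb_decr PD oF pt) f fF.
have fFj0 : f \in F j0 by apply: fFj; level_lia.
have skew u : form u u = 0.
  have := formC Qsym u u; rewrite n1 expr1 mulN1r => /eqP.
  by rewrite -addr_eq0 -mulr2n mulrn_eq0 => /eqP.
have ef : form e f = 0 by apply: fz eF fF _; level_lia.
have ecf : form e (conj_mx f) = 0.
  by apply/hf_eq0E; apply: (hf_eq0C Hherm); exact: e_perp.
have cffE : form (conj_mx f) f = - lam by rewrite (formC Qsym) n1 expr1 mulN1r.
have [b0 b0e] : exists b0, form b0 e != 0.
  apply: contrapT => no; case/negP: e_neq0; apply/eqP.
  apply: form_nondeg Qnondeg _ => u; apply: contrapT => /eqP u0; apply: no.
  by exists u.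
(* Nondegeneracy alone supplies [b0]. Orthogonality to conj [f], with all vectors Q-isotropic, gives
   [X] square zero; the pairing with [e] survives because [e] is orthogonal to [f] and conj [f]. *)
pose b := b0 - (form b0 (conj_mx f) / lam) *: f - (form b0 f / - lam) *: conj_mx f.
have eb : form e b != 0.
  rewrite !formBr !formZr ef ecf !mulr0 !subr0.
  by apply: contra b0e => /eqP eb0; rewrite (form_eq0C Qsym eb0).
have bf : form b (conj_mx f) = 0.
  by rewrite !formBl !formZl skew mulr0 subr0 divfK // subrr.
have fb : form f b = 0.
  apply: (form_eq0C Qsym); rewrite !formBl !formZl skew mulr0 subr0 cffE.
  by rewrite divfK ?oppr_eq0 // subrr.
pose X := pair_mx (Q := Q) (n := n) (conj_mx f) b.
have XE v := mul_pair_mx (n := n) v (conj_mx f) b : v *m X = _.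
have bX : b *m X = 0 by rewrite XE bf skew mulr0 !scale0r subrr.
have cfX : conj_mx f *m X = 0.
  by rewrite XE skew (form_eq0C Qsym bf) mulr0 !scale0r subrr.
have XX v : v *m X *m X = 0.
  by rewrite (XE v) mulmxBl -!scalemxAl bX cfX !scaler0 subrr.
exists X; split; first exact: pair_mx_lie.
  by apply: mx_eq0_row => v; rewrite !mulmxA XX.
move=> z z0; have [P0 [P0F dimP0 dP0]] := ind_ex H (sg j0) (F j0).
have [P1 [P1F dP1 dimP1 P1f]] := project_neg Hherm fFj0 fneg P0F dP0.
rewrite -form_colE in eb.
have [P2 [P2F dP2 dimP2 P2e]] := project_rad Hherm e_rad P1F dP1 eb.
rewrite form_colE in eb.
have P2f u : u \in P2 -> hf H u f = 0.
  move=> /P2e[_ [v vP [a ->]]]; rewrite hfBl hfZl P1f //.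
  by have /hf_eq0E -> := ecf; rewrite mulr0 subrr.
have fixed u : u \in P2 -> u *m texp X z = u.
  move=> uP; have /hf_eq0E uf := P2f u uP; apply: texp_fixed.
  by have [] := P2e u uP; rewrite form_colE XE uf => -> _; rewrite mulr0 !scale0r subrr.
pose w := e *m texp X z; pose B := - (z * ((-1) ^+ sg n * form e b)).
have wE : w = e + B *: conj_mx f.
  rewrite /w mul_texp XX scaler0 addr0 XE ecf scale0r sub0r scalerN scalerA.
  by rewrite -scaleNr.
have B0 : B != 0 by rewrite oppr_eq0 !mulf_neq0 // signr_eq0.
have cfe u : u \in F j0 -> hf H u (conj_mx f) = 0.
  by move=> uF; apply/hf_eq0E; rewrite conj_mxK (fz uF fF) //; level_lia.
(* In odd weight conj [f] has the sign opposite to that of [f], which is the wanted one. *)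
have wpos : 0 < (-1) ^+ sg j0 * hf H w w.
  have ow : hf H e (B *: conj_mx f) = 0 by rewrite hfZr cfe // mulr0.
  rewrite wE (hf_add_orth Hherm ow) e_perp // add0r hfZ2 (hf_conj_mx Qsym) n1 expr1 mulrCA pmulr_rgt0 ?mul_conjC_gt0 //.
  by move: fneg; rewrite signN mulN1r mulrN.
have wP u : u \in P2 -> hf H u w = 0.
  move=> uP; have uF := subvP P2F u uP.
  by rewrite wE hfDr hfZr e_perp // cfe // mulr0 addr0.
have [dP dimP] := definite_add Hherm dP2 wP wpos.
exists (P2 + <[w]>)%VS; split=> //; last by rewrite dimP dimP2 dimP1 dimP0.
rewrite subv_add; apply/andP; split.
  apply/subvP => u uP; rewrite -(fixed u uP).
  exact/mem_act_vec/(subvP P2F).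
by rewrite -memvE mem_act_vec.
Qed.

End Above.
End Gains.

(** * Gains from a piece below level [j0] *)

Section GainsBelow.
Context {R : realType} {d : nat} {Q : 'M[R]_d} {n : int} {h : int -> nat} {o : flag Q}.
Hypothesis PD : period_datum n h o.
Local Notation H := (HQ (Q := Q) (n := n)).
Local Notation form := (form (Q := Q)).
Context {F : flag Q}.
Hypothesis oF : orbC o F.
Context {j0 : int} {e : 'rV[R[i]]_d}.
Hypothesis e_rad : e \in rad H (F j0).
Hypothesis e_neq0 : e != 0.
Implicit Types (u v w b f : 'rV[R[i]]_d) (p q t : int) (s : bool) (z : R[i]).

Let Hherm : H^T = conj_mx H := H_herm PD.
Let Qsym : Q^T = (-1) ^ n *: Q. Proof. by case: PD. Qed.
Let Qnondeg : Q \in unitmx. Proof. by case: PD. Qed.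

Let eF : e \in F j0. Proof. by case/(mem_radF PD _ _ oF): e_rad. Qed.
Let ceF : conj_mx e \in F (n - j0 + 1).
Proof. by case/(mem_radF PD _ _ oF): e_rad. Qed.
Let e_perp u : u \in F j0 -> hf H u e = 0.
Proof.
by move=> uF; apply: (hf_eq0C Hherm); have /mem_rad[_] := e_rad; apply.
Qed.

Let fz p q u v : u \in F p -> v \in F q -> n + 1 <= p + q -> form u v = 0.
Proof. by move=> uF vF pq; exact: (orb_form PD oF pq uF vF). Qed.

Let fcj u v : form (conj_mx u) v = (form u (conj_mx v))^*.
Proof. by rewrite form_conj conj_mxK. Qed.

Context {t : int} {f : 'rV[R[i]]_d}.
Hypothesis f_piece : f \in hodge_piece n F t.

Let fF : f \in F t. Proof. by case/mem_piece: f_piece. Qed.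
Let cfF : conj_mx f \in F (n - t). Proof. by case/mem_piece: f_piece. Qed.

Section Below.
Hypothesis nj : n + 2 <= 2 * j0.
Hypothesis tj : t <= j0 - 2.
Hypothesis f_isotropic_or_real : conj_mx f = f \/ form f f = 0.
Hypothesis ce : conj_mx e \notin F j0.
Hypothesis fpos : 0 < (-1) ^+ sg j0 * hf H f f.

Let Fle p q : p <= q -> (F q <= F p)%VS.
Proof. exact: (orb_decr PD oF). Qed.

Let ef : form e f = 0.
Proof.
have [jt|jt] := lerP (j0 + t) n; last by apply: fz eF fF _; level_lia.
have : form (conj_mx e) (conj_mx f) = 0 by apply: fz ceF cfF _; level_lia.
by rewrite -form_conj => /eqP; rewrite conjC_eq0 => /eqP.
Qed.

Let ecf : form e (conj_mx f) = 0. Proof. by apply: fz eF cfF _; level_lia. Qed.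
Let cef : form (conj_mx e) f = 0. Proof. by rewrite fcj ecf cj0. Qed.
Let cecf : form (conj_mx e) (conj_mx f) = 0. Proof. by rewrite -form_conj ef cj0. Qed.
Let ee : form e e = 0. Proof. by apply: fz eF eF _; level_lia. Qed.
Let cece : form (conj_mx e) (conj_mx e) = 0. Proof. by rewrite -form_conj ee cj0. Qed.
Let ece : form e (conj_mx e) = 0. Proof. by apply/hf_eq0E; exact: e_perp. Qed.

(** A partner of conj [e] is corrected along conj [f] and [f] for orthogonality, along conj [e] for
    Q-isotropy and along [e] for H-isotropy, each step keeping what was achieved before. Isotropy
    for both forms makes conj [c] a direction in which definite vectors can move without changing
    their norm. *)
Lemma isotropic_partner : exists c, [/\ c \in F (n - j0 + 1),
  form c (conj_mx e) != 0, form c f = 0 /\ form c (conj_mx f) = 0, form c c = 0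
  & form c (conj_mx c) = 0].
Proof.
have [c0 c0F c0e] := exists_partner PD oF ce.
have cfL : conj_mx f \in F (n - j0 + 1) by apply: subvP (Fle _) _ cfF; level_lia.
have lam0 : form f (conj_mx f) != 0 := form_neq0_of_hf fpos.
have lam0' : form (conj_mx f) f != 0 by rewrite fcj conjC_eq0.
have eC u : form u e = 0 -> form e u = 0 := form_eq0C Qsym (v := _).
pose c1 := c0 - (form c0 f / form (conj_mx f) f) *: conj_mx f.
have c1F : c1 \in F (n - j0 + 1) by rewrite memvB // memvZ.
have c1e : form c1 (conj_mx e) = form c0 (conj_mx e).
  by rewrite formBl formZl (form_eq0C Qsym cecf) mulr0 subr0.
have c1f : form c1 f = 0 by rewrite formBl formZl divfK // subrr.
have [c2 [c2F c2e c2f c2cf]] : exists c2, [/\ c2 \in F (n - j0 + 1),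
    form c2 (conj_mx e) = form c0 (conj_mx e), form c2 f = 0 & form c2 (conj_mx f) = 0].
  (* For real [f] the two conditions coincide. For Q-isotropic [f], either orthogonality to conj [f]
     follows from the levels, or [f] lies in F^(n-j0+1) and subtracting it does not disturb the
     pairing with [f]. *)
  case: f_isotropic_or_real => [cf|ff]; first by exists c1; rewrite cf.
  have [tn|tn] := lerP t (n - j0).
    by exists c1; split=> //; apply: fz c1F cfF _; level_lia.
  have fL : f \in F (n - j0 + 1) by apply: subvP (Fle _) _ fF; level_lia.
  exists (c1 - (form c1 (conj_mx f) / form f (conj_mx f)) *: f); split.
  - by rewrite memvB // memvZ.
  - by rewrite formBl formZl (form_eq0C Qsym cef) mulr0 subr0.
  - by rewrite formBl formZl c1f ff mulr0 subrr.
  - by rewrite formBl formZl divfK // subrr.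
have c2e0 : form c2 (conj_mx e) != 0 by rewrite c2e.
(* Since conj [e] is Q-isotropic, the equation for [k3] in even weight is linear; in odd weight
   [form c2 c2] is already 0. *)
pose k3 := - (form c2 c2 / (2 * form c2 (conj_mx e))); pose c3 := c2 + k3 *: conj_mx e.
have c3F : c3 \in F (n - j0 + 1) by rewrite memvD // memvZ.
have c3e : form c3 (conj_mx e) = form c2 (conj_mx e).
  by rewrite formDl formZl cece mulr0 addr0.
have c3f : form c3 f = 0 by rewrite formDl formZl c2f cef mulr0 addr0.
have c3cf : form c3 (conj_mx f) = 0 by rewrite formDl formZl c2cf cecf mulr0 addr0.
have c3c3 : form c3 c3 = 0.
  rewrite /c3 formDl !formDr !formZl !formZr cece (formC Qsym c2 (conj_mx e)) !mulr0 addr0.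
  have := formC Qsym c2 c2; case: (sg n); rewrite ?expr0 ?expr1.
    rewrite mulN1r => /eqP; rewrite -addr_eq0 -mulr2n mulrn_eq0 => /eqP cc.
    by rewrite /k3 cc !(mul0r, oppr0) !addr0.
  move=> _; rewrite mul1r -addrA -mulr2n -mulr_natl /k3.
  have -> (a b : R[i]) : 2 * (- (a / (2 * b)) * b) = - (a / (2 * b) * (2 * b)) by ring.
  by rewrite divfK ?subrr // mulf_neq0 ?pnatr_eq0.
clearbody c3; have c3e' : form c3 e = 0 by apply: fz c3F eF _; level_lia.
have hce : hf H c3 e != 0.
  by apply: contra c2e0 => /eqP/hf_eq0E; rewrite c3e => ->.
(* Each of the two cross terms becomes -H(c3, c3) / 2, and [e] is H-isotropic, so no quadratic term
   appears. *)
pose k := (- (hf H c3 c3 / (2 * hf H c3 e)))^*; pose c := c3 + k *: e.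
have eL : e \in F (n - j0 + 1) by apply: subvP (Fle _) _ eF; level_lia.
exists c; split.
- by rewrite memvD // memvZ.
- by rewrite formDl formZl ece mulr0 addr0 c3e.
- by split; rewrite formDl formZl ?c3f ?c3cf ?ef ?ecf mulr0 addr0.
- by rewrite formDl !formDr !formZl !formZr c3c3 ee c3e' (form_eq0C Qsym c3e') !mulr0 !addr0.
apply/(hf_eq0E (n := n)); have kE : k^* * hf H c3 e = - (hf H c3 c3 / 2).
  by rewrite /k conjCK mulNr invfM mulrA divfK.
have kE' : k * hf H e c3 = - (hf H c3 c3 / 2).
  rewrite -(hf_conj Hherm c3 e) -[k]conjCK -cjM kE cjN cjM cjV cj_nat.
  by rewrite (hf_conj Hherm).
rewrite /c hfDl !hfDr hfZ2 hfZl hfZr kE kE' (e_perp eF) mulr0 addr0.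
by rewrite addrAC -addrA -opprD -splitr addrN.
Qed.

(** [f] is orthogonal to F^j0. The exponential moves a suitable maximal definite subspace of F^j0
    only along the H-isotropic [b], which is orthogonal to it, while the image of [e] acquires a
    nonzero multiple of [f] and with it the sign of [f]. *)
Lemma gains_below : gains (n := n) (F := F) (j0 := j0).
Proof.
have [c [cF ce0 [cf ccf] cc ccc]] := isotropic_partner.
pose b := conj_mx c.
have be : form e b != 0.
  by apply: contra ce0 => /eqP eb; rewrite (formC Qsym) fcj eb cj0 mulr0.
have bf : form b f = 0 by rewrite fcj ccf cj0.
have bb : form b b = 0 by rewrite -form_conj cc cj0.
have ub u : u \in F j0 -> hf H u b = 0.
  by move=> uF; apply/hf_eq0E; rewrite conj_mxK (fz uF cF) //; level_lia.
have bbH : hf H b b = 0.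
  by apply/hf_eq0E; rewrite /b conj_mxK (form_eq0C Qsym ccc).
have fbH : hf H f b = 0 by apply/hf_eq0E; rewrite conj_mxK (form_eq0C Qsym cf).
pose X := pair_mx (Q := Q) (n := n) f b.
have XE v := mul_pair_mx (n := n) v f b : v *m X = _.
have bX : b *m X = 0 by rewrite XE bf bb mulr0 !scale0r subrr.
have fX : f *m X = form f f *: b.
  by rewrite XE (form_eq0C Qsym bf) mulr0 scale0r subr0.
have XX v : v *m X *m X = - ((-1) ^+ sg n * form v b * form f f) *: b.
  by rewrite (XE v) mulmxBl -!scalemxAl bX fX scaler0 sub0r scalerA scaleNr.
exists X; split; first exact: pair_mx_lie.
  by apply: mx_eq0_row => v; rewrite !mulmxA (XX v) -scalemxAl bX scaler0.
move=> z z0; have [P0 [P0F dimP0 dP0]] := ind_ex H (sg j0) (F j0).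
have eb := be; rewrite -form_colE in eb.
have [P1 [P1F dP1 dimP1 P1b]] := project_rad Hherm e_rad P0F dP0 eb.
have TE u : u \in P1 -> u *m texp X z = u + (z * form u f) *: b.
  move=> uP; have [ub0 _] := P1b u uP; rewrite form_colE in ub0.
  rewrite mul_texp XX XE ub0 mulr0 mul0r oppr0 !scale0r scaler0 addr0 subr0.
  by rewrite scalerA.
have [u uP u0|dP2 dimP2] := @definite_image _ _ H (sg j0) P1 (texp X z).
  have uF := subvP P1F u uP; rewrite TE //.
  rewrite hfDl !hfDr hfZ2 hfZl hfZr (ub u) // (hf_eq0C Hherm (ub u uF)) bbH.
  by rewrite !mulr0 !addr0; exact: dP1.
pose w := e *m texp X z; pose B := - (z * ((-1) ^+ sg n * form e b)).
pose A := - (z ^+ 2 / 2 * ((-1) ^+ sg n * form e b * form f f)).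
have wE : w = e + B *: f + A *: b.
  rewrite /w mul_texp XX XE ef scale0r sub0r scalerN scalerA -scaleNr.
  by rewrite scalerA mulrN.
have B0 : B != 0 by rewrite oppr_eq0 mulf_neq0 // mulf_neq0 // signr_eq0.
have ufH u : u \in F j0 -> hf H u f = 0.
  by move=> uF; apply/hf_eq0E; apply: fz uF cfF _; level_lia.
have wpos : 0 < (-1) ^+ sg j0 * hf H w w.
  have o1 : hf H (e + B *: f) (A *: b) = 0.
    by rewrite hfDl !hfZr hfZl (ub e) // fbH !mulr0 addr0.
  have o2 : hf H e (B *: f) = 0 by rewrite hfZr ufH // mulr0.
  rewrite wE (hf_add_orth Hherm o1) (hf_add_orth Hherm o2) (e_perp eF) !hfZ2 bbH.
  by rewrite mulr0 addr0 add0r mulrCA pmulr_rgt0 // mul_conjC_gt0.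
have wP u : u \in (linfun (mulmxr (texp X z)) @: P1)%VS -> hf H u w = 0.
  move=> /memv_imgP[v vP ->]; rewrite lfunE /= TE // wE.
  have vF := subvP P1F v vP.
  have bw : hf H b (e + B *: f + A *: b) = 0.
    rewrite !hfDr !hfZr bbH (hf_eq0C Hherm (ub e eF)) (hf_eq0C Hherm fbH).
    by rewrite !mulr0 !addr0.
  rewrite hfDl hfZl bw mulr0 addr0 !hfDr !hfZr e_perp // ufH // ub //.
  by rewrite !mulr0 !addr0.
have [dP dimP] := definite_add Hherm dP2 wP wpos.
exists (linfun (mulmxr (texp X z)) @: P1 + <[w]>)%VS.
split=> //; last by rewrite dimP dimP2 dimP1 dimP0.
rewrite subv_add; apply/andP; split; first exact: limgS.
by rewrite -memvE mem_act_vec.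
Qed.

End Below.
End GainsBelow.

(** * Gains when the null vector is real *)

Section GainsReal.
Context {R : realType} {d : nat} {Q : 'M[R]_d} {n : int} {h : int -> nat} {o : flag Q}.
Hypothesis PD : period_datum n h o.
Local Notation H := (HQ (Q := Q) (n := n)).
Local Notation form := (form (Q := Q)).
Context {F : flag Q}.
Hypothesis oF : orbC o F.
Context {m : int} {e e0 : 'rV[R[i]]_d}.
Hypothesis nm : n = 2 * m.
Hypothesis eF : e \in F (m + 1).
Hypothesis ce : conj_mx e = e.
Hypothesis e_neq0 : e != 0.
Hypothesis e0F : e0 \in F m.
Hypothesis ce0 : conj_mx e0 = e0.
Hypothesis e0pos : 0 < (-1) ^+ sg (m + 1) * hf H e0 e0.
Context {t : int} {f : 'rV[R[i]]_d}.
Hypothesis f_piece : f \in hodge_piece n F t.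
Hypothesis mt : m + 1 <= t.
Hypothesis fpos : 0 < (-1) ^+ sg (m + 1) * hf H f f.
Implicit Types (u v w b : 'rV[R[i]]_d) (p q : int) (z : R[i]).

Let Hherm : H^T = conj_mx H := H_herm PD.
Let Qsym : Q^T = (-1) ^ n *: Q. Proof. by case: PD. Qed.
Let Qnondeg : Q \in unitmx. Proof. by case: PD. Qed.

Let fz p q u v : u \in F p -> v \in F q -> n + 1 <= p + q -> form u v = 0.
Proof. by move=> uF vF pq; exact: (orb_form PD oF pq uF vF). Qed.

Let n0 : sg n = false. Proof. by rewrite nm sgM2. Qed.

Let sym u v : form v u = form u v.
Proof. by rewrite (formC Qsym) n0 expr0 mul1r. Qed.

Let fcj u v : form (conj_mx u) v = (form u (conj_mx v))^*.
Proof. by rewrite form_conj conj_mxK. Qed.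

Let fF : f \in F t. Proof. by case/mem_piece: f_piece. Qed.
Let fFm : f \in F (m + 1). Proof. exact: subvP (orb_decr PD oF mt) f fF. Qed.

(* In even weight H is a real multiple of form on real vectors. *)
Let kap : R[i] := 'i%C ^ (- n).

Let kapE : kap = (-1) ^+ sg m.
Proof.
have := @iCexp_weil R n m; have -> : m - (n - m) = 0 by level_lia.
rewrite expr0z => /esym e1; apply: (mulfI (_ : (-1) ^+ sg m != 0)).
  by rewrite signr_eq0.
by rewrite e1 -expr2 sqrr_sign.
Qed.

Let sk : (-1) ^+ sg (m + 1) * kap = -1.
Proof. by rewrite kapE -signr_addb sgD addbAC addbb. Qed.

Let hfk u v : (-1) ^+ sg (m + 1) * hf H u v = - form u (conj_mx v).
Proof. by rewrite hfE mulrA -/kap sk mulN1r. Qed.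

Let lam := form f (conj_mx f).
Let q0 := form e0 e0.

Let lam_lt0 : lam < 0.
Proof. by move: fpos; rewrite hfk oppr_gt0. Qed.

Let q0_lt0 : q0 < 0.
Proof. by move: e0pos; rewrite hfk ce0 oppr_gt0. Qed.

Let lamR : lam^* = lam. Proof. by apply/CrealP; exact: ltr0_real. Qed.
Let q0R : q0^* = q0. Proof. by apply/CrealP; exact: ltr0_real. Qed.

Let ee : form e e = 0. Proof. by apply: fz eF eF _; level_lia. Qed.
Let ee0 : form e e0 = 0. Proof. by apply: fz eF e0F _; level_lia. Qed.
Let ef : form e f = 0. Proof. by apply: fz eF fFm _; level_lia. Qed.
Let ecf : form e (conj_mx f) = 0. Proof. by rewrite -ce fcj conj_mxK ef cj0. Qed.
Let ff : form f f = 0. Proof. by apply: fz fFm fFm _; level_lia. Qed.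
Let cfcf : form (conj_mx f) (conj_mx f) = 0. Proof. by rewrite -form_conj ff cj0. Qed.
Let fe0 : form f e0 = 0. Proof. by apply: fz fFm e0F _; level_lia. Qed.
Let cfe0 : form (conj_mx f) e0 = 0. Proof. by rewrite fcj ce0 fe0 cj0. Qed.

(** Gram-Schmidt within the real vectors: the coefficients along [e0] and [e] are real, and the
    correction along [f] is accompanied by its conjugate. *)
Lemma real_partner : exists y, [/\ conj_mx y = y, form y e != 0, form y y = 0,
  form y e0 = 0 & form y (conj_mx f) = 0].
Proof.
have [x [xc xe]] : exists x, conj_mx x = x /\ form x e != 0.
  apply: contrapT => no; case/negP: e_neq0; apply/eqP.
  apply: form_nondeg Qnondeg _ => u; rewrite (row_sum_delta u).
  have fs (I : finType) (G : I -> 'rV[R[i]]_d) w :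
      form (\sum_i G i) w = \sum_i form (G i) w.
    exact: (big_morph (fun x => form x w) (fun x y => formDl x y w) (form0l w)).
  rewrite fs big1 // => i _; rewrite formZl.
  apply: contrapT => /eqP; rewrite mulf_eq0 negb_or => /andP[_ ie]; apply: no.
  exists (delta_mx 0 i); split=> //.
  by rewrite /conj_mx map_delta_mx.
have q00 : q0 != 0 by rewrite ltr0_neq0.
have lam0 : lam != 0 by rewrite ltr0_neq0.
have realform u v : conj_mx u = u -> conj_mx v = v -> (form u v)^* = form u v.
  by move=> cu cv; rewrite form_conj cu cv.
pose x1 := x - (form x e0 / q0) *: e0.
have x1c : conj_mx x1 = x1.
  by rewrite conj_mxB conj_mxZ xc ce0 cjM cjV q0R realform.
have x1e : form x1 e = form x e by rewrite formBl formZl [form e0 e]sym ee0 mulr0 subr0.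
have x1e0 : form x1 e0 = 0 by rewrite formBl formZl divfK // subrr.
clearbody x1.
pose c := form x1 (conj_mx f) / lam.
pose x2 := x1 - (c *: f + c^* *: conj_mx f).
have x2c : conj_mx x2 = x2.
  by rewrite conj_mxB conj_mxD !conj_mxZ conj_mxK conjCK x1c [in RHS]/x2 [X in _ - X]addrC.
have x2e : form x2 e = form x e.
  rewrite formBl formDl !formZl [form f e]sym [form _ e]sym ef.
  by rewrite [form (conj_mx f) e]sym ecf !mulr0 addr0 subr0 sym.
have x2e0 : form x2 e0 = 0.
  by rewrite formBl formDl !formZl x1e0 fe0 cfe0 !mulr0 addr0 subr0.
have x2cf : form x2 (conj_mx f) = 0.
  by rewrite formBl formDl !formZl cfcf mulr0 addr0 divfK // subrr.
clearbody x2.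
pose k := - (form x2 x2 / (2 * form x2 e)).
have x2e_neq0 : form x2 e != 0 by rewrite x2e.
have kc : k^* = k by rewrite /k cjN cjM cjV cjM cj_nat !realform.
exists (x2 + k *: e); split.
- by rewrite conj_mxD conj_mxZ x2c ce kc.
- by rewrite formDl formZl ee mulr0 addr0.
- rewrite formDl !formDr !formZl !formZr ee [form e x2]sym !mulr0 addr0.
  rewrite -addrA -mulr2n -mulr_natl /k.
  have -> (a b : R[i]) : 2 * (- (a / (2 * b)) * b) = - (a / (2 * b) * (2 * b)) by ring.
  by rewrite divfK ?subrr // mulf_neq0 ?pnatr_eq0.
- by rewrite formDl formZl x2e0 ee0 mulr0 addr0.
- by rewrite formDl formZl x2cf ecf mulr0 addr0.
Qed.

(* With b = y + i e0, the element conj f /\ b fixes the vectors of F^(m+1)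
   orthogonal to f and to y, and makes the plane spanned by e and f definite. *)
Lemma gains_real : gains (n := n) (F := F) (j0 := m + 1).
Proof.
have [y [yc ye yy ye0 ycf]] := real_partner.
pose c := form y e; have cR : c^* = c by rewrite /c form_conj yc ce.
have yf : form y f = 0 by rewrite -[form y f]conjCK form_conj yc ycf cj0.
have e_rad : e \in rad H (F (m + 1)).
  apply/(mem_radF PD _ _ oF); split=> //; rewrite ce.
  by apply: subvP (orb_decr PD oF _) e eF; level_lia.
have e_perp u : u \in F (m + 1) -> hf H u e = 0.
  by move=> uF; apply: (hf_eq0C Hherm); have /mem_rad[_] := e_rad; apply.
(* Without i [e0] the images of [e] and [f] would span a degenerate plane; it gives [form b b] and
   [form b b'] the opposite nonzero values - [q0] and [q0]. *)
pose b := y + 'i%C *: e0; pose b' := y - 'i%C *: e0.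
have cb : conj_mx b = b' by rewrite conj_mxD conj_mxZ yc ce0 conjCi scaleNr.
have ii : ('i%C : R[i]) * 'i%C = -1 by rewrite -expr2 sqrCi.
have eb : form e b = c by rewrite formDr formZr ee0 mulr0 addr0 sym.
have be : form b e = c by rewrite sym eb.
have by0 : form b y = 0 by rewrite formDl formZl yy [form e0 y]sym ye0 mulr0 addr0.
have be0 : form b e0 = 'i%C * q0 by rewrite formDl formZl ye0 add0r.
have bb : form b b = - q0 by rewrite formDr formZr by0 be0 add0r mulrA ii mulN1r.
have bb' : form b b' = q0.
  by rewrite formBr formZr by0 be0 sub0r mulrA ii mulN1r opprK.
have bcf : form b (conj_mx f) = 0.
  by rewrite formDl formZl ycf [form e0 _]sym cfe0 mulr0 addr0.
have fb : form f b = 0 by rewrite formDr formZr [form f y]sym yf fe0 mulr0 addr0.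
have fb' : form f b' = 0 by rewrite formBr formZr [form f y]sym yf fe0 mulr0 subr0.
have bf : form b f = 0 by rewrite sym.
have cfb : form (conj_mx f) b = 0 by rewrite sym.
pose X := pair_mx (Q := Q) (n := n) (conj_mx f) b.
have XE v : v *m X = form v (conj_mx f) *: b - form v b *: conj_mx f.
  by rewrite /X (mul_pair_mx (n := n)) n0 expr0 mul1r.
have bX : b *m X = q0 *: conj_mx f by rewrite XE bcf bb scale0r sub0r scaleNr opprK.
have cfX : conj_mx f *m X = 0 by rewrite XE cfcf cfb !scale0r subrr.
have eX : e *m X = - c *: conj_mx f by rewrite XE ecf eb scale0r sub0r scaleNr.
have fX : f *m X = lam *: b by rewrite XE fb scale0r subr0.
exists X; split; first exact: pair_mx_lie.
  apply: mx_eq0_row => v; rewrite !mulmxA (XE v) !mulmxBl -!scalemxAl bX cfX.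
  by rewrite -!scalemxAl cfX mul0mx !scaler0 subrr.
move=> z z0; have [P0 [P0F dimP0 dP0]] := ind_ex H (sg (m + 1)) (F (m + 1)).
(* Orthogonality to [f] costs at most one dimension; the plane of [w1] and [w2] returns two. *)
pose P1 := (P0 :&: perp H <[f]>)%VS.
have P1F : (P1 <= F (m + 1)%R)%VS by apply: subv_trans P0F; exact: capvSl.
have dP1 : definite H (sg (m + 1)) P1 by apply: definiteS dP0; exact: capvSl.
have dimP1 : (ind H (sg (m + 1)) (F (m + 1)%R) <= (\dim P1).+1)%N.
  have := dim_cap_perp H P0 <[f]>; have : (\dim <[f]> <= 1)%N.
    by rewrite dim_vline; case: (f != 0).
  move=> le1 le2; rewrite -dimP0; apply: leq_trans le2 _.
  by apply: (leq_trans (leq_add (leqnn _) le1)); rewrite addn1.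
have ey : (e *m (cplx Q *m y^T)) 0 0 != 0 by rewrite form_colE sym.
have [P2 [P2F dP2 dimP2 P2e]] := project_rad Hherm e_rad P1F dP1 ey.
have P2f u : u \in P2 -> hf H u f = 0.
  move=> /P2e[_ [v /memv_capP[_ /mem_perp vf] [a ->]]].
  by rewrite hfBl hfZl vf ?memv_line // (hf_eq0C Hherm (e_perp f fFm)) mulr0 subrr.
have P2b u a : u \in P2 -> form u (y + a *: e0) = 0.
  move=> uP; have [uy _] := P2e u uP; rewrite form_colE in uy.
  by rewrite formDr formZr uy (fz (subvP P2F u uP) e0F) ?mulr0 ?addr0 //; level_lia.
have fixed u : u \in P2 -> u *m texp X z = u.
  move=> uP; apply: texp_fixed; rewrite XE (P2b u 'i%C uP).
  by have /hf_eq0E -> := P2f u uP; rewrite !scale0r subrr.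
have ucf u : u \in F (m + 1) -> hf H u (conj_mx f) = 0.
  by move=> uF; apply/hf_eq0E; rewrite conj_mxK (fz uF fFm) //; level_lia.
have ubH u : u \in P2 -> hf H u b = 0.
  move=> uP; apply/hf_eq0E; rewrite cb /b' -scaleNr; exact: P2b.
pose w1 := e *m texp X z; pose fT := f *m texp X z.
have w1E : w1 = e - (z * c) *: conj_mx f.
  rewrite /w1 mul_texp eX -scalemxAl cfX !scaler0 addr0 scalerA mulrN.
  by rewrite scaleNr.
(* Positive because [lam] and [q0] are both negative. The Gram determinant of [w1] and [fT] is 2 x
   |z c lam|^2, so their plane is definite for every nonzero z. *)
pose x := z * z^* * lam * q0.
have zz : 0 < z * z^* by rewrite mul_conjC_gt0.
have x_gt0 : 0 < x by rewrite /x -mulrA mulr_gt0 // nmulr_rgt0.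
have fTE : fT = f + (z * lam) *: b + (z ^+ 2 / 2 * lam * q0) *: conj_mx f.
  by rewrite /fT mul_texp fX -scalemxAl bX !scalerA.
have cw1 : conj_mx w1 = e - (z^* * c) *: f.
  by rewrite w1E conj_mxB conj_mxZ conj_mxK ce cjM cR.
have cfT : conj_mx fT = conj_mx f + (z^* * lam) *: b' + (z^* ^+ 2 / 2 * lam * q0) *: f.
  rewrite fTE !conj_mxD !conj_mxZ conj_mxK cb !(cjM, cjX, cjV, cj_nat) lamR.
  by rewrite q0R.
have fcf : form (conj_mx f) f = lam by rewrite sym.
have cfe : form (conj_mx f) e = 0 by rewrite sym.
have fe : form f e = 0 by rewrite sym.
have cfb' : form (conj_mx f) b' = 0.
  by rewrite formBr formZr [form _ y]sym ycf cfe0 mulr0 subr0.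
have G11 : form w1 (conj_mx w1) = z * z^* * (c ^+ 2 * lam).
  rewrite cw1 w1E formBl !formBr !formZl !formZr ee ef cfe fcf !mulr0 !subr0 sub0r.
  by rewrite opprB subr0; ring.
have G22 : form fT (conj_mx fT) = lam * (1 + x / 2) ^+ 2.
  rewrite cfT fTE !formDl !formDr !formZl !formZr -/lam fb' ff bcf bb' bf cfcf cfb' fcf.
  by rewrite !(mulr0, addr0, add0r) /x; field.
have G21 : form fT (conj_mx w1) = z * lam * c * (1 - x / 2).
  rewrite cw1 fTE !formDl !formBr !formZl !formZr fe ff be bf cfe fcf.
  by rewrite !(mulr0, addr0, add0r, subr0, sub0r) /x; field.
have c0 : c != 0 by [].
clearbody x.
have c2 : 0 < c ^+ 2 by rewrite expr2 -{2}cR mul_conjC_gt0.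
have G11_lt0 : form w1 (conj_mx w1) < 0 by rewrite G11 pmulr_rlt0 // pmulr_rlt0.
have w1pos : 0 < (-1) ^+ sg (m + 1) * hf H w1 w1 by rewrite hfk oppr_gt0.
have hw1 : hf H w1 w1 != 0 by apply: contraTneq w1pos => ->; rewrite mulr0 ltxx.
pose a := hf H fT w1 / hf H w1 w1; pose w2 := fT - a *: w1.
have w2w1 : hf H w2 w1 = 0 by rewrite hfBl hfZl divfK // subrr.
have aE : a = (1 - x / 2) / (z^* * c).
  rewrite /a !hfE -/kap.
  have -> : kap * form fT (conj_mx w1) / (kap * form w1 (conj_mx w1)) =
    form fT (conj_mx w1) / form w1 (conj_mx w1).
    by rewrite -mulf_div divff ?mul1r // kapE signr_eq0.
  by rewrite G21 G11; field; rewrite conjC_eq0 z0 c0 ltr0_neq0.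
have xR : x^* = x by apply/CrealP; exact: gtr0_real.
have w2pos : 0 < (-1) ^+ sg (m + 1) * hf H w2 w2.
  have fTs : hf H fT fT = hf H w2 w2 + a * a^* * hf H w1 w1.
    have {1 2}-> : fT = w2 + a *: w1 by rewrite subrK.
    by rewrite (hf_add_orth Hherm) ?hfZ2 // hfZr w2w1 mulr0.
  have -> : hf H w2 w2 = hf H fT fT - a * a^* * hf H w1 w1 by rewrite fTs addrK.
  rewrite mulrBr mulrCA !hfk G11 G22 aE !(cjM, cjV, cjB, cj1, cj_nat) conjCK xR cR.
  have -> : - (lam * (1 + x / 2) ^+ 2) - (1 - x / 2) / (z^* * c) *
     ((1 - x / 2) / (z * c)) * - (z * z^* * (c ^+ 2 * lam)) = - (lam * (2 * x)).
    by field; rewrite conjC_eq0 z0 c0.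
  by rewrite oppr_gt0 nmulr_rlt0 // mulr_gt0.
have w1P u : u \in P2 -> hf H u w1 = 0.
  move=> uP; have uF := subvP P2F u uP.
  by rewrite w1E hfBr hfZr e_perp // ucf // mulr0 subrr.
have w2P u : u \in (P2 + <[w1]>)%VS -> hf H u w2 = 0.
  move=> /memv_addP[v vP [_ /vlineP[l ->] ->]]; have vF := subvP P2F v vP.
  rewrite hfDl hfZl (hf_eq0C Hherm w2w1) mulr0 addr0 hfBr hfZr w1P // mulr0 subr0.
  by rewrite fTE !hfDr !hfZr P2f // ubH // ucf // !mulr0 !addr0.
have [dP' dimP'] := definite_add Hherm dP2 w1P w1pos.
have [dP dimP] := definite_add Hherm dP' w2P w2pos.
exists (P2 + <[w1]> + <[w2]>)%VS; split=> //; last first.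
  by rewrite dimP dimP' dimP2 ltnS.
have w1F : w1 \in act F (texp X z) (m + 1) by exact: mem_act_vec.
rewrite !subv_add -!memvE w1F (memvB (mem_act_vec _ fFm) (memvZ _ w1F)) !andbT.
apply/subvP => u uP; rewrite -(fixed u uP).
exact/mem_act_vec/(subvP P2F).
Qed.

End GainsReal.

(** * Reduced limits and Deligne splittings *)

Section ComplexifiedSubspaces.
Context {R : realType} {d : nat}.
Implicit Types (U : {vspace 'rV[R]_d}) (v : 'rV[R[i]]_d) (A : 'M[R]_d).

Definition re_mx v : 'rV[R]_d := map_mx (@complex.Re R) v.
Definition im_mx v : 'rV[R]_d := map_mx (@complex.Im R) v.

Lemma re_im_mxE v : v = cplx (re_mx v) + 'i%C *: cplx (im_mx v).
Proof.
apply/matrixP => i j; rewrite !mxE; case: (v i j) => a b /=.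
by apply/eqP; rewrite eq_complex /= !(mul0r, mulr0, mul1r, subr0, addr0, add0r) !eqxx.
Qed.

Lemma re_mul v A : re_mx (v *m cplx A) = re_mx v *m A.
Proof.
apply/rowP => j; rewrite !mxE raddf_sum; apply: eq_bigr => i _.
by rewrite !mxE; case: (v 0 i) => a b /=; rewrite mulr0 subr0.
Qed.

Lemma im_mul v A : im_mx (v *m cplx A) = im_mx v *m A.
Proof.
apply/rowP => j; rewrite !mxE raddf_sum; apply: eq_bigr => i _.
by rewrite !mxE; case: (v 0 i) => a b /=; rewrite mulr0 add0r.
Qed.

Lemma re_im_eq0 v : re_mx v = 0 -> im_mx v = 0 -> v = 0.
Proof.
move=> r0 i0; rewrite (re_im_mxE v) r0 i0 /cplx !map_mx0 scaler0 addr0 //.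
Qed.

Lemma cplxM (m n p : nat) (A : 'M[R]_(m, n)) (B : 'M[R]_(n, p)) :
  cplx (A *m B) = cplx A *m cplx B.
Proof. exact: map_mxM. Qed.

Lemma cplxv_mul U U' A v : (forall x, x \in U -> x *m A \in U') ->
  v \in cplxv U -> v *m cplx A \in cplxv U'.
Proof.
move=> UU' /mem_cplxv[rU iU]; apply/mem_cplxv.
by rewrite -!/(re_mx _) -!/(im_mx _) re_mul im_mul; split; apply: UU'.
Qed.

Lemma mem_cplxv0 v : v \in cplxv 0%VS -> v = 0.
Proof.
move=> /mem_cplxv[]; rewrite !memv0 => /eqP r0 /eqP i0.
exact: re_im_eq0.
Qed.

Lemma mem_cplxvT v : v \in cplxv fullv.
Proof. by apply/mem_cplxv; rewrite !memvf. Qed.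

Lemma dim_limg_cplx A : (\dim (linfun (mulmxr (cplx A)) @: {:'rV[R[i]]_d})%VS <= \rank A)%N.
Proof.
have <- : \rank (cplx A) = \rank A by exact: mxrank_map.
set B := cplx A; pose rs := [seq row i (row_base B) | i <- enum 'I_(\rank B)].
have <- : size rs = \rank B by rewrite size_map size_enum_ord.
apply: leq_trans (dim_span _); apply/dimvS/subvP => _ /memv_imgP[v _ ->].
rewrite lfunE /= -{1}(mulmx_base B) mulmxA mulmx_sum_row; apply: rpred_sum => i _.
rewrite memvZ // memv_span //; apply/mapP; exists i => //.
by rewrite mem_enum.
Qed.

End ComplexifiedSubspaces.

(** * Vectors of the reduced limit *)

Section ReducedLimit.
Context {R : realType} {d : nat} {Q : 'M[R]_d}.
Hypothesis Qnondeg : Q \in unitmx.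
Context {N : 'M[R]_d} {F G : flag Q}.
Hypothesis d1 : (1 < d)%N.
Hypothesis N3 : N *m N *m N = 0.
Hypothesis FN : forall p v, v \in F p -> v *m cplx N \in F (p - 1).
Hypothesis Fdecr : forall p, (F (p + 1)%R <= F p)%VS.
Hypothesis lim : reduced_limit N F G.
Implicit Types (v : 'rV[R[i]]_d) (p : int).

Let cN3 : cplx N *m cplx N *m cplx N = 0.
Proof. by rewrite -!cplxM N3 /cplx map_mx0. Qed.

Let vN3 v : v *m cplx N *m cplx N *m cplx N = 0.
Proof. by rewrite -!mulmxA mulmxA -mulmxA (mulmxA (cplx N)) cN3 mulmx0. Qed.

(** Vectors of F^p may be chosen depending on z before the exponential acts. If the outcome is a
    quadratic polynomial in 1/z, its constant term lies in the limit; the lemmas below are choices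
    of [u]. *)
Lemma limit_mem_texp p (w0 x y : 'rV[R[i]]_d) (u : R[i] -> 'rV[R[i]]_d) :
  (forall z, z != 0 -> u z \in F p) ->
  (forall z, z != 0 -> u z *m texp (cplx N) z = w0 + z^-1 *: x + z^-1 ^+ 2 *: y) ->
  w0 \in G p.
Proof.
move=> uF uE; apply: (limit_mem Qnondeg im_pinfty_proper lim
    (w := fun z => u z *m texp (cplx N) z)).
  apply: filterS (im_pinfty_inv (ltr01 : 0 < (1 : R[i]))) => z [z0 _].
  by rewrite (texp_exp_nilp _ d1 cN3); apply/mem_act; exists (u z) => //; exact: uF.
exact: im_pinfty_lim uE.
Qed.

Lemma limit_ker p v : v \in F p -> v *m cplx N = 0 -> v \in G p.
Proof.
move=> vF vN; apply: (limit_mem_texp (x := 0) (y := 0) (u := fun=> v)) => // z _.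
by rewrite texp_fixed // !scaler0 !addr0.
Qed.

Lemma limit_N2 p v : v \in F p -> v *m cplx N *m cplx N \in G p.
Proof.
move=> vF; apply: (limit_mem_texp (x := 2 *: (v *m cplx N)) (y := 2 *: v)
  (u := fun z => (2 * z^-1 ^+ 2) *: v)) => [z _|z z0]; first exact: memvZ.
have E (K : fieldType) (V : lmodType K) (a b c : V) (x : K) : x != 0 -> 2 != 0 :> K ->
    (2 * x^-1 ^+ 2) *: (a + x *: b + (x ^+ 2 / 2) *: c) =
    c + x^-1 *: (2 *: b) + x^-1 ^+ 2 *: (2 *: a).
  move=> x0 n20; rewrite !scalerDr !scalerA [LHS]addrC [in RHS]addrAC -addrA.
  have -> : 2 * x^-1 ^+ 2 * (x ^+ 2 / 2) = 1 by field; rewrite ?x0 ?n20.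
  have -> : 2 * x^-1 ^+ 2 * x = x^-1 * 2 by field; rewrite ?x0 ?n20.
  by rewrite scale1r [x^-1 ^+ 2 * 2]mulrC addrA.
by rewrite -scalemxAl mul_texp E // pnatr_eq0.
Qed.

(** The divergent terms z v N^2 coming from 2 v / z and from v N cancel; horizontality places v N in
    F^p. *)
Lemma limit_N1 p v : v \in F (p + 1) -> v *m cplx N \in G p.
Proof.
move=> vF; have vF' := subvP (Fdecr p) v vF.
have vN := FN vF; rewrite addrK in vN.
apply: (limit_mem_texp (x := 2 *: v) (y := 0)
  (u := fun z => (2 * z^-1) *: v - v *m cplx N)) => [z _|z z0].
  by rewrite memvB ?memvZ.
have E (K : fieldType) (V : lmodType K) (a b c : V) (x : K) : x != 0 -> 2 != 0 :> K ->
    (2 * x^-1) *: (a + x *: b + (x ^+ 2 / 2) *: c) - (b + x *: c + (x ^+ 2 / 2) *: 0) =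
    b + x^-1 *: (2 *: a) + x^-1 ^+ 2 *: 0.
  move=> x0 n20; rewrite !scaler0 !addr0 !scalerDr !scalerA.
  have -> : 2 * x^-1 * (x ^+ 2 / 2) = x by field; rewrite ?x0 ?n20.
  have -> : 2 * x^-1 * x = 1 + 1 by field; rewrite ?x0 ?n20.
  by rewrite scalerDl scale1r opprD addrACA subrr addr0 addrA addrK addrC mulrC.
rewrite mulmxBl -scalemxAl (mul_texp v) (mul_texp (v *m cplx N)) vN3.
by rewrite E // pnatr_eq0.
Qed.

(** Applying exp(-zN) beforehand lowers the level by at most two and makes the family constant. *)
Lemma limit_F2 p v : v \in F (p + 2) -> v \in G p.
Proof.
move=> vF.
have vF1 : v \in F (p + 1).
  have pE : p + 2 = p + 1 + 1 by level_lia.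
  by rewrite pE in vF; exact: subvP (Fdecr _) v vF.
have vF0 := subvP (Fdecr p) v vF1.
have vN1 := FN vF; have vN0 := FN vF1; have vNN := FN vN1.
rewrite addrK in vN0.
have e : p + 2 - 1 - 1 = p by level_lia.
rewrite e in vNN.
apply: (limit_mem_texp (x := 0) (y := 0)
  (u := fun z => v *m texp (cplx N) (- z))) => [z _|z z0].
  by rewrite mul_texp !memvD ?memvZ.
by rewrite -mulmxA texpD // addNr texp0 mulmx1 !scaler0 !addr0.
Qed.

Section SquareZero.
Hypothesis N2 : N *m N = 0.

Let vN2 v : v *m cplx N *m cplx N = 0.
Proof. by rewrite -mulmxA -cplxM N2 /cplx map_mx0 mulmx0. Qed.

Lemma limit_N1_sq p v : v \in F p -> v *m cplx N \in G p.
Proof.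
move=> vF; apply: (limit_mem_texp (x := v) (y := 0) (u := fun z => z^-1 *: v)).
  by move=> z _; exact: memvZ.
move=> z z0; rewrite mul_texp -!scalemxAl vN2 !scaler0 !addr0.
by rewrite scalerA divff // scale1r addrC.
Qed.

Lemma limit_F1_sq p v : v \in F (p + 1) -> v \in G p.
Proof.
move=> vF; have vF0 := subvP (Fdecr p) v vF.
have vN := FN vF; rewrite addrK in vN.
apply: (limit_mem_texp (x := 0) (y := 0)
  (u := fun z => v - z *: (v *m cplx N))) => [z _|z z0].
  by rewrite memvB ?memvZ.
have uN : (v - z *: (v *m cplx N)) *m cplx N = v *m cplx N.
  by rewrite mulmxBl -scalemxAl vN2 scaler0 subr0.
by rewrite mul_texp uN vN2 !scaler0 !addr0 subrK.
Qed.

End SquareZero.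
End ReducedLimit.

(** * Dimension counts for the Deligne splitting *)

Section DeligneSplitting.
Context {R : realType} {d : nat} {Q : 'M[R]_d}.
Context {F : flag Q} {W : int -> {vspace 'rV[R]_d}}
  {I : int -> int -> {vspace 'rV[R[i]]_d}}.
Hypothesis hI : deligne_splitting W F I.
Implicit Types (a b p q l j k : int) (P : set (int * int)).

Definition pieces (ab : int * int) := I ab.1 ab.2.
Definition psum P := lsum P pieces.

Lemma psum_sub P U : (psum P <= U)%VS <-> forall a b, P (a, b) -> (I a b <= U)%VS.
Proof.
rewrite /psum (lsumP _ _ _).
by split=> [le a b Pab|le [a b] Pab]; [exact: (le (a, b))|exact: le].
Qed.

Lemma piece_psum P a b : P (a, b) -> (I a b <= psum P)%VS.
Proof. by move=> Pab; have /psum_sub := subvv (psum P); apply. Qed.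

Lemma psumS P P' : P `<=` P' -> (psum P <= psum P')%VS.
Proof. by move=> PP'; apply/psum_sub => a b /PP'; exact: piece_psum. Qed.

Lemma psum0 P : (forall a b, ~ P (a, b)) -> psum P = 0%VS.
Proof. by move=> P0; apply/eqP; rewrite -subv0; apply/psum_sub => a b /P0 []. Qed.

Lemma piece_cap a b P : ~ P (a, b) -> (I a b :&: psum P)%VS = 0%VS.
Proof.
move=> Pab; have [[_ ind] _ _ _] := hI; apply/eqP; rewrite -subv0 -(ind (a, b)).
by apply: capvS => //; apply: psumS => c Pc /= cab; apply: Pab; rewrite -cab.
Qed.

Lemma FE p : F p = psum [set ab | p <= ab.1].
Proof. by have [_ -> _ _] := hI. Qed.

Lemma WE l : cplxv (W l) = psum [set ab | ab.1 + ab.2 <= l].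
Proof. by have [_ _ -> _] := hI. Qed.

Lemma piece_F a b p : p <= a -> (I a b <= F p)%VS.
Proof. by move=> pa; rewrite FE; exact: piece_psum. Qed.

Lemma piece_W a b l : a + b <= l -> (I a b <= cplxv (W l))%VS.
Proof. by move=> abl; rewrite WE; exact: piece_psum. Qed.

Lemma piece_conj p q : (conjv (I p q) + psum [set k | k.1 < q /\ k.2 < p] =
  I q p + psum [set k | k.1 < q /\ k.2 < p])%VS.
Proof. by have [_ _ _ ->] := hI. Qed.

(** Conjugation exchanges the two pieces modulo [M], and [I a b] meets [M] only in 0. *)
Lemma piece_dim_sym p q : \dim (I p q) = \dim (I q p).
Proof.
suff le a b : (\dim (I a b) <= \dim (I b a))%N by apply/eqP; rewrite eqn_leq !le.
pose M := psum [set k | k.1 < a /\ k.2 < b].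
have c0 : (I a b :&: M)%VS = 0%VS by apply: piece_cap => /= -[]; rewrite ltxx.
have := dimv_disjoint_sum c0; rewrite -piece_conj => E.
have := dimv_sum_cap (conjv (I b a)) M; rewrite E dim_conjv; lia.
Qed.

(* The graded piece of weight l is a Hodge structure of weight l. *)
Lemma weight_hodge j k l : (cplxv (W l) <= F j :&: cplxv (W l)
  + conjv (F k :&: cplxv (W l)) + cplxv (W (l - 1)%R)
  + psum [set ab | [/\ (ab.1 + ab.2 = l)%R, (ab.1 < j)%R & (ab.2 < k)%R]])%VS.
Proof.
set T := psum [set ab | _]; set S := (_ + _ + _)%VS.
rewrite WE; apply/psum_sub => a b /= abl.
have [lt|ge] := ltrP (a + b) l.
  have le : (I a b <= cplxv (W (l - 1)))%VS by apply: piece_W; lia.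
  exact: subv_trans le (subv_trans (addvSr _ _) (addvSl _ _)).
have [ja|aj] := lerP j a.
  have le : (I a b <= F j :&: cplxv (W l))%VS by rewrite subv_cap piece_F ?piece_W.
  by apply: subv_trans le _; rewrite /S -!addvA addvSl.
have [kb|bk] := lerP k b; last first.
  have le : (I a b <= T)%VS by apply: piece_psum; split=> //=; lia.
  exact: subv_trans le (addvSr _ _).
have le : (I a b <= conjv (I b a) + psum [set k | k.1 < a /\ k.2 < b])%VS.
  by rewrite piece_conj addvSl.
apply: subv_trans le _; apply: subv_trans (addvSl _ _); apply: addvS; last first.
  by rewrite WE; apply: psumS => -[x y] /= [xa yb]; lia.
apply: subv_trans (addvSr _ _); apply: conjvS; rewrite subv_cap piece_F //=.
by rewrite piece_W //; lia.
Qed.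

Lemma psum_dim P (ks : seq (int * int)) U : uniq ks ->
  (forall ab, ab \in ks -> ~ P ab /\ (pieces ab <= U)%VS) -> (psum P <= U)%VS ->
  (\dim (psum P) + \sum_(ab <- ks) \dim (pieces ab) <= \dim U)%N.
Proof.
move=> uks ksP PU.
(* The induction carries an explicit subspace, whose containment in the span of the pieces used so
   far makes the next piece independent of it. *)
suff [V [VU Vsub <-]] : exists V, [/\ (V <= U)%VS,
    (V <= psum (fun ab => P ab \/ ab \in ks))%VS
  & \dim V = (\dim (psum P) + \sum_(ab <- ks) \dim (pieces ab))%N].
  exact: dimvS.
elim: ks uks ksP => [|ab ks IH] /=.
  by move=> _ _; exists (psum P); rewrite big_nil addn0; split=> //; apply: psumS; left.
move=> /andP[abks uks] ksP.
have [|V [VU Vsub dimV]] := IH uks.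
  by move=> c cks; apply: ksP; rewrite inE cks orbT.
have [nP abU] := ksP ab (mem_head _ _).
have c0 : (pieces ab :&: V)%VS = 0%VS.
  apply/eqP; rewrite -subv0; case: ab abks nP {ksP abU} => a b abks nP.
  rewrite -(@piece_cap a b (fun c => P c \/ c \in ks)) ?capvS //.
  by case=> //; rewrite (negPf abks).
exists (pieces ab + V)%VS; split.
- by rewrite subv_add abU.
- rewrite subv_add; apply/andP; split.
    by case: ab {abks ksP nP abU c0} => a b; apply: piece_psum; right; rewrite mem_head.
  apply: (subv_trans Vsub); apply: psumS => c [Pc|cks]; first by left.
  by right; rewrite inE cks orbT.
- by rewrite (dimv_disjoint_sum c0) dimV big_cons addnCA.
Qed.

End DeligneSplitting.

(** * Degenerations of type I *)

Section WeightFiltration.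
Context {K : fieldType} {d : nat} {n : int} {N : 'M[K]_d} {W : int -> {vspace 'rV[K]_d}}.
Hypothesis hW : weight_filtration n N W.
Implicit Types (l : int) (j J : nat) (v w : 'rV[K]_d).

Lemma weight_mono l l' : l <= l' -> (W l <= W l')%VS.
Proof.
have [Wm _ _ _ _] := hW => ll'; have -> : l' = l + `|l' - l|%N%:Z by lia.
elim: `|l' - l|%N => [|k IH]; first by rewrite addr0.
have -> : l + k.+1%:Z = l + k%:Z + 1 by lia.
exact: subv_trans IH (Wm _).
Qed.

(** Above weight n + J the power of N in question is zero, so its injectivity on the graded piece
    makes that piece vanish. [weight_bot] is the dual statement, from surjectivity. *)
Lemma weight_top J : (forall j, (J < j)%N -> N ^+ j = 0) -> W (n + J%:Z) = fullv.
Proof.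
move=> N0; have [_ [_ [l Wl]] _ inj _] := hW.
have step k : (W (n + (J + k)%:Z) <= W (n + J%:Z)%R)%VS.
  elim: k => [|k IH]; first by rewrite addn0.
  apply: subv_trans IH; apply/subvP => v vW.
  have := inj (J + k.+1)%N v vW; rewrite N0 ?mulmx0 ?mem0v; last by lia.
  by move=> /(_ isT); congr (_ \in W _); lia.
apply/eqP; rewrite eqEsubv subvf /= -Wl.
have [le|lt] := lerP l (n + J%:Z); first exact: weight_mono.
have st := step `|(l - (n + J%:Z))%R|%N.
apply: subv_trans st; apply: weight_mono; lia.
Qed.

Lemma weight_bot J : (forall j, (J < j)%N -> N ^+ j = 0) -> W (n - J%:Z - 1) = 0%VS.
Proof.
move=> N0; have [_ [[l Wl] _] _ _ surj] := hW.
have step k : (W (n - J%:Z - 1)%R <= W (n - (J + k)%:Z - 1)%R)%VS.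
  elim: k => [|k IH]; first by rewrite addn0.
  apply: subv_trans IH _; apply/subvP => v vW.
  have [|w _] := surj (J + k.+1)%N v.
    by move: vW; congr (_ \in W _); lia.
  by rewrite N0 ?mulmx0 ?subr0; last by lia.
apply/eqP; rewrite -subv0 -Wl.
have [le|lt] := lerP (n - J%:Z - 1) l; first exact: weight_mono.
have st := step `|(l - (n - J%:Z - 1))%R|%N.
apply: subv_trans st _; apply: weight_mono; lia.
Qed.

End WeightFiltration.

(** * Radicals at a limit point *)

Section LimitPoint.
Context {R : realType} {d : nat} {Q : 'M[R]_d} {n : int} {h : int -> nat} {o : flag Q}.
Hypothesis PD : period_datum n h o.
Local Notation H := (HQ (Q := Q) (n := n)).
Local Notation D := (period_domain n h o).
Local Notation form := (form (Q := Q)).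
Context {F G : flag Q}.
Hypothesis oG : orbC o G.
Implicit Types (p q j k t : int) (v u : 'rV[R[i]]_d).

Lemma GR_GC (g : 'M[R]_d) : GR (Q := Q) g -> GC (Q := Q) (cplx g).
Proof.
move=> [gQ dg]; split; first by rewrite /cplx map_trmx -!cplxM gQ.
by rewrite /cplx det_map_mx dg rmorph1.
Qed.

Lemma orbit_orbC O : codim1_boundary_orbit n h o O -> O G -> orbC o G.
Proof. by move=> [[F' [oF' -> _]] _] [g Gg ->]; exact: orbC_act (GR_GC Gg). Qed.

(** Turns the radical into the codimension of a sum, which can be bounded by exhibiting limit
    vectors. *)
Lemma rad_dim_sum p :
  (\dim (rad H (G p)) + \dim (G p + conjv (G (n - p + 1)%R)))%N = d.
Proof.
have := dimv_sum_cap (G p) (conjv (G (n - p + 1))).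
rewrite (radFE PD _ oG) dim_conjv !(orb_dim _ oG); have := dim_levels PD p.
by move=> dl sc; rewrite addnC sc.
Qed.

(** A vector lying in G^p together with its conjugate is Q-orthogonal to both summands of V. *)
Lemma cap_conj0 p : (G (n - p + 1)%R + conjv (G (n - p + 1)%R))%VS = fullv ->
  forall v, v \in G p -> conj_mx v \in G p -> v = 0.
Proof.
move=> full v vG cvG; have [Qnondeg _ _] := PD.
apply: (form_nondeg Qnondeg) => u.
have : u \in fullv by exact: memvf.
rewrite -full => /memv_addP[x xG [y /mem_conjv yG ->]]; rewrite formDl.
rewrite (orb_form PD oG _ xG vG); last by level_lia.
rewrite add0r -(conj_mxK v) -[form _ _]conjCK form_conj conj_mxK.
by rewrite (orb_form PD oG _ yG cvG) ?cj0 //; level_lia.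
Qed.

(** [G] is not interior to D, so some radical is nonzero; it sits at [p] or at the dual level, and
    these two radicals are conjugate. *)
Lemma deg_vector O p : codim1_boundary_orbit n h o O -> O G ->
  (forall q, q != p -> q != n - p + 1 -> rad H (G q) = 0%VS) ->
  exists2 e, e \in rad H (G p) & e != 0.
Proof.
move=> hO OG r0; exists (vpick (rad H (G p))); first exact: memv_pick.
rewrite vpick0; apply/eqP => rp0.
have [clG nint] : closure D G /\ ~ D° G by case: hO => _ /(_ G OG).
apply: nint; apply: (nondeg_interior PD oG clG) => q.
have [->|qp] := eqVneq q p; first by [].
have [->|qp'] := eqVneq q (n - p + 1); last exact: r0.
rewrite (rad_dual PD _ oG) rp0; apply/eqP; rewrite -dimv_eq0 dim_conjv.
by rewrite dimv0.
Qed.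

Lemma piece_conj_isotropic t v : 2 * t != n -> v \in hodge_piece n G t -> form v v = 0.
Proof.
move=> tn /mem_piece[vG cvG].
have [lt|ge] := ltrP n (2 * t); first by apply: (orb_form PD oG _ vG vG); level_lia.
have : form (conj_mx v) (conj_mx v) = 0 by apply: (orb_form PD oG _ cvG cvG); level_lia.
by rewrite -form_conj => /eqP; rewrite conjC_eq0 => /eqP.
Qed.

End LimitPoint.

Section TypeOne.
Context {R : realType} {d : nat} {Q : 'M[R]_d} {n : int} {h : int -> nat} {o : flag Q}.
Hypothesis PD : period_datum n h o.
Local Notation H := (HQ (Q := Q) (n := n)).
Local Notation D := (period_domain n h o).
Context {O : set (flag Q)} {N : 'M[R]_d} {F G : flag Q}
  {W : int -> {vspace 'rV[R]_d}} {I : int -> int -> {vspace 'rV[R[i]]_d}}.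
Hypothesis hO : codim1_boundary_orbit n h o O.
Hypothesis OG : O G.
Hypothesis oF : orbC o F.
Hypothesis FN : forall p v, v \in F p -> v *m cplx N \in F (p - 1).
Hypothesis lim : reduced_limit N F G.
Hypothesis hW : weight_filtration n N W.
Hypothesis hI : deligne_splitting W F I.
Implicit Types (p q j k t a b l : int) (v u : 'rV[R[i]]_d).

Let Qnondeg : Q \in unitmx. Proof. by case: PD. Qed.
Let oG : orbC o G. Proof. exact: orbit_orbC hO OG. Qed.
Let clG : closure D G. Proof. by case: hO => _ /(_ G OG)[]. Qed.
Let Fdecr p : (F (p + 1)%R <= F p)%VS.
Proof. by apply: (orb_decr PD oF); level_lia. Qed.

(** The pieces [I t b] stay independent modulo F^(t+1), and F^t / F^(t+1) has dimension [h t] on the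
    whole orbit. *)
Lemma h_ge t (ks : seq int) : uniq ks ->
  (\sum_(b <- ks) \dim (I t b) <= h t)%N.
Proof.
move=> uks; have := @psum_dim _ _ _ _ _ _ hI [set ab | t + 1 <= ab.1]
  [seq (t, b) | b <- ks] (F t).
rewrite map_inj_uniq ?uks; last by move=> x y [].
rewrite big_map /pieces /= -(FE hI) => /(_ isT).
have c1 : forall ab, ab \in [seq (t, b) | b <- ks] ->
    ~ (t + 1 <= ab.1) /\ (I ab.1 ab.2 <= F t)%VS.
  move=> _ /mapP[b _ ->] /=; split; first by level_lia.
  exact: (piece_F hI).
move=> /(_ c1 (Fdecr t)); rewrite !(orb_dim _ oF).
by have := hdim PD t; move: (\sum_(b <- ks) _)%N => s; level_lia.
Qed.

(* A injects the sum of the pieces of weight greater than l. *)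
Lemma upper_pieces_dim (A : 'M[R]_d) l (ks : seq (int * int)) :
  (forall v, v \in cplxv (W l) <-> v *m cplx A = 0) -> uniq ks ->
  (forall ab, ab \in ks -> l < ab.1 + ab.2) ->
  (\sum_(ab <- ks) \dim (I ab.1 ab.2) <= \rank A)%N.
Proof.
move=> kerA uks ksn.
have ksP ab : ab \in ks -> ~ [set ab | ab.1 + ab.2 <= l] ab /\
    (pieces (I := I) ab <= fullv)%VS.
  by move=> /ksn abn; split; [apply/negP; rewrite -ltNge | exact: subvf].
have := psum_dim hI uks ksP (subvf _).
rewrite -(WE hI) dimvf /dim /= mul1n.
have := limg_ker_dim (linfun (mulmxr (cplx A))) {:'rV[R[i]]_d}.
have := dim_limg_cplx A; rewrite capfv dimvf /dim /= mul1n.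
have -> : lker (linfun (mulmxr (cplx A))) = cplxv (W l).
  apply/vspaceP => v; rewrite memv_ker lfunE /=.
  by apply/eqP/idP => [/kerA|vW]; last exact/kerA.
rewrite /pieces => le1 eq1 le2.
rewrite -(leq_add2l (\dim (cplxv (W l)))); apply: leq_trans le2 _.
apply: leq_trans (leq_add (leqnn _) le1); apply: eq_leq; exact: (esym eq1).
Qed.

Section SquareZero.
Hypothesis N2 : N ^+ 2 = 0.
Hypothesis Nrank : (0 < \rank N <= 2)%N.

Let NN : N *m N = 0. Proof. by rewrite mulmxE -expr2. Qed.

Let d1 : (1 < d)%N.
Proof.
have := mulmx0_rank_max NN; case/andP: Nrank => r0 _ le.
by apply: leq_trans le; rewrite -[2%N]/(1 + 1)%N leq_add.
Qed.

Let N3 : N *m N *m N = 0. Proof. by rewrite NN mul0mx. Qed.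

Let Npow (j : nat) : (1 < j)%N -> N ^+ j = 0.
Proof. by case: j => [|[|j]] // _; rewrite -addn2 addnC exprD N2 mul0r. Qed.

Let Wtop : cplxv (W (n + 1)) = fullv.
Proof.
apply/vspaceP => v; rewrite memvf; have := weight_top hW Npow => ->.
exact: mem_cplxvT.
Qed.

Let Wbot : W (n - 2) = 0%VS.
Proof. by have := weight_bot hW Npow; have -> : n - 1%N%:Z - 1 = n - 2 by level_lia. Qed.

Let Wn v : v \in cplxv (W n) <-> v *m cplx N = 0.
Proof.
have [_ _ WN inj _] := hW; split=> [vW|vN].
  apply: mem_cplxv0; apply: cplxv_mul vW => x xW.
  by rewrite -Wbot; exact: WN.
have WnE x : x *m N = 0 -> x \in W n.
  move=> xN; have := inj 1%N x; rewrite addrK expr1 xN mem0v.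
  by rewrite (weight_top hW Npow) memvf => /(_ isT isT).
by apply/mem_cplxv; split; apply: WnE;
  rewrite -/(re_mx _) -/(im_mx _) -?re_mul -?im_mul vN /re_mx /im_mx;
  apply/matrixP => i j; rewrite !mxE.
Qed.

Let Wn1 v : v \in cplxv (W (n - 1)) -> exists y, v = y *m cplx N.
Proof.
have [_ _ _ _ surj] := hW.
have real x : x \in W (n - 1) -> exists y, x = y *m N.
  move=> /(surj 1%N)[y _]; have -> : n - 1%N%:Z - 1 = n - 2 by level_lia.
  by rewrite Wbot memv0 expr1 subr_eq0 => /eqP ->; exists y.
move=> /mem_cplxv[/real[x xE] /real[y yE]].
exists (cplx x + 'i%C *: cplx y).
by rewrite mulmxDl -scalemxAl -!cplxM -xE -yE -re_im_mxE.
Qed.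

(** Since j + k <= n + 1, F^j + conj F^k + ker N is V, so the sum contains the image of N; it then
    contains ker N, which F^j and conj F^k cover modulo that image. Only weight n + 1 can leave a
    gap, with indices shifted by one because F^(p+1) is contained in G^p. *)
Lemma limit_sum_sq j k : j + k <= n + 1 ->
  (fullv <= G j + conjv (G k) + psum (I := I)
    [set ab | [/\ (ab.1 + ab.2 = n + 1)%R, (ab.1 < j + 1)%R & (ab.2 < k + 1)%R]])%VS.
Proof.
move=> jk; set S := (G j + conjv (G k))%VS; set T := psum _.
have conjN v : conj_mx (v *m cplx N) = conj_mx v *m cplx N.
  by rewrite conj_mxM conj_cplx.
have limN p v := @limit_N1_sq _ _ _ Qnondeg N F G d1 N3 lim NN p v.
have limF p v := @limit_F1_sq _ _ _ Qnondeg N F G d1 N3 FN Fdecr lim NN p v.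
have limK p v := @limit_ker _ _ _ Qnondeg N F G d1 N3 lim p v.
have GS v : v \in G j -> v \in S by exact: subvP (addvSl _ _) v.
have cGS v : conj_mx v \in G k -> v \in S.
  by move=> cv; apply: (subvP (addvSr (G j) (conjv (G k)))); apply/mem_conjv.
have imN y : y *m cplx N \in S.
  have : y \in cplxv (W (n + 1)) by rewrite Wtop memvf.
  move=> /(subvP (weight_hodge hI j k (n + 1))).
  rewrite [X in (_ + X)%VS]psum0 ?addv0; last by move=> a b /= [ab aj bk]; level_lia.
  have -> : n + 1 - 1 = n by level_lia.
  move=> /memv_addP[_ /memv_addP[x /memv_capP[xF _] [w /mem_conjv/memv_capP[wF _] ->]]].
  move=> [y3 /Wn y3N ->]; rewrite !mulmxDl y3N addr0 memvD //.
    by apply: GS; exact: limN.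
  by apply: cGS; rewrite conjN; exact: limN.
have WnS v : v \in cplxv (W n) -> v \in S.
  move=> /(subvP (weight_hodge hI j k n)).
  rewrite [X in (_ + X)%VS]psum0 ?addv0; last by move=> a b /= [ab aj bk]; level_lia.
  move=> /memv_addP[_ /memv_addP[x /memv_capP[xF /Wn xN] [w /mem_conjv/memv_capP[wF wW] ->]]].
  move=> [_ /Wn1[y3 ->] ->]; rewrite !memvD ?imN //.
    by apply: GS; exact: limK.
  by apply: cGS; apply: limK wF _; exact/Wn.
apply/subvP => v _; have : v \in cplxv (W (n + 1)) by rewrite Wtop memvf.
move=> /(subvP (weight_hodge hI (j + 1) (k + 1) (n + 1))).
have -> : n + 1 - 1 = n by level_lia.
move=> /memv_addP[u uS [w wT ->]]; apply/memv_addP; exists u; last by exists w.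
move: uS => /memv_addP[_ /memv_addP[x /memv_capP[xF _] [y /mem_conjv/memv_capP[yF _] ->]]].
move=> [y3 /WnS y3S ->]; rewrite !memvD //.
  by apply: GS; exact: limF.
by apply: cGS; exact: limF.
Qed.

Lemma top_weight_dim (ks : seq (int * int)) : uniq ks ->
  (forall ab, ab \in ks -> ab.1 + ab.2 = n + 1) ->
  (\sum_(ab <- ks) \dim (I ab.1 ab.2) <= \rank N)%N.
Proof.
move=> uks ksn; apply: (upper_pieces_dim Wn uks) => ab /ksn ->.
by level_lia.
Qed.

Lemma rad_le q : (\dim (rad H (G q)) <= \dim (I q (n - q + 1)))%N.
Proof.
have jk : q + (n - q + 1) <= n + 1 by level_lia.
have := limit_sum_sq jk.
set T := psum _ => full.
have TI : (T <= I q (n - q + 1)%R)%VS.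
  apply/psum_sub => a b /= [ab aq bq].
  have -> : a = q by level_lia.
  by have -> : b = n - q + 1 by level_lia; exact: subvv.
have full' : (d <= \dim (G q + conjv (G (n - q + 1)%R) + T))%N.
  by apply: leq_trans (dimvS full); rewrite dimvf /dim /= mul1n.
rewrite -(leq_add2r (\dim (G q + conjv (G (n - q + 1)%R)))) (rad_dim_sum PD oG q).
apply: leq_trans full' _; rewrite addnC.
apply: leq_trans (dimv_add_leqif _ _) _; rewrite leq_add2l; exact: dimvS.
Qed.

Context {po : int}.
Hypothesis po_lt : 2 * po < n.
Hypothesis I_plus : \dim (I (po + 1) (n - po)) = 1%N.
Hypothesis I_minus : \dim (I po (n - po - 1)) = 1%N.

Let j0 : int := n - po.

(** Pieces of weight n + 1 inject under N, so their dimensions total at most 2. The given piece and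
    its conjugate use this up when they differ; when they coincide, any other piece would bring its
    own conjugate and exceed the rank. *)
Lemma top_pieces a b : a + b = n + 1 -> a != po + 1 -> a != n - po ->
  \dim (I a b) = 0%N.
Proof.
move=> abn a1 a2; apply/eqP; rewrite -leqn0 leqNgt; apply/negP => ab0.
have I_plus' : \dim (I (n - po) (po + 1)) = 1%N by rewrite (piece_dim_sym hI).
case/andP: Nrank => _ rk.
have [E|E] := eqVneq (po + 1) (n - po).
  have := @top_weight_dim [:: (po + 1, n - po); (a, b); (b, a)].
  rewrite /= !inE !xpair_eqE !big_cons big_nil /= I_plus -(piece_dim_sym hI a b).
  have -> : (po + 1 == a) = false by apply/eqP; move/eqP: a1; level_lia.
  have -> : (po + 1 == b) = false by apply/eqP; move/eqP: a1; level_lia.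
  have -> : (a == b) = false by apply/eqP; move/eqP: a1; level_lia.
  rewrite /= => /(_ isT) le.
  have /le : forall ab, ab \in [:: (po + 1, n - po); (a, b); (b, a)] -> ab.1 + ab.2 = n + 1.
    by move=> c; rewrite !inE => /or3P[] /eqP -> /=; level_lia.
  by move: (\dim (I a b)) ab0 rk => x; level_lia.
have := @top_weight_dim [:: (po + 1, n - po); (n - po, po + 1); (a, b)].
rewrite /= !inE !xpair_eqE !big_cons big_nil /= I_plus I_plus' (negPf E).
rewrite ![_ == a]eq_sym (negPf a1) (negPf a2) /= => /(_ isT) le.
have /le : forall ab, ab \in [:: (po + 1, n - po); (n - po, po + 1); (a, b)] ->
    ab.1 + ab.2 = n + 1.
  by move=> c; rewrite !inE => /or3P[] /eqP -> /=; level_lia.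
by move: (\dim (I a b)) ab0 rk => x; level_lia.
Qed.

Lemma rad_other q : q != j0 -> q != n - j0 + 1 -> rad H (G q) = 0%VS.
Proof.
move=> q1 q2; apply/eqP; rewrite -dimv_eq0 -leqn0 (leq_trans (rad_le q)) //.
rewrite leqn0; apply/eqP; apply: top_pieces; rewrite /j0 in q1 q2 *; level_lia.
Qed.

Lemma rad_le1 q : (\dim (rad H (G q)) <= 1)%N.
Proof.
have [->|q1] := eqVneq q j0.
  apply: leq_trans (rad_le _) _; rewrite (piece_dim_sym hI) /j0.
  have -> : n - (n - po) + 1 = po + 1 by level_lia.
  by rewrite I_plus.
have [->|q2] := eqVneq q (n - j0 + 1); last by rewrite rad_other // dimv0.
apply: leq_trans (rad_le _) _; rewrite /j0.
have -> : n - (n - po) + 1 = po + 1 by level_lia.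
have -> : n - (po + 1) + 1 = n - po by level_lia.
by rewrite I_plus.
Qed.

(** The level k = n - j0 + 1 satisfies 2 k <= n, so G^k + conj G^k leaves no gap in V. *)
Lemma conj_deg e : n + 2 <= 2 * j0 -> e \in G j0 -> e != 0 -> conj_mx e \notin G j0.
Proof.
move=> nj eG e0; apply/negP => ceG; case/negP: e0; apply/eqP.
apply: (cap_conj0 PD oG _ eG ceG).
have jk : (n - j0 + 1) + (n - j0 + 1) <= n + 1 by level_lia.
have := limit_sum_sq jk; rewrite [X in (_ + X)%VS]psum0 ?addv0 => [le|a b /= [ab aj bk]].
  by apply/eqP; rewrite eqEsubv subvf le.
level_lia.
Qed.

(** For r = po - 2 l + 1 the index n - r lies above j0 with the opposite parity. For r = po + 2 l it
    is j0 - 2 l, below j0 with the same parity, except that when 2 j0 = n + 1 the index r itself is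
    used: it lies above j0 with the opposite parity. *)
Lemma typeI_pseudoconcave r (l : int) : \dim (I r (n - r)) <> 0%N -> 1 <= l ->
  r = po + 2 * l \/ r = po - 2 * l + 1 -> pseudoconcave_boundary_orbit n h o O.
Proof.
move=> hr l1 rE.
have [e e_rad e0] := deg_vector PD oG hO OG rad_other.
have [eG ceG] := proj1 (mem_radF PD _ _ oG) e_rad.
suff [X [XQ X3 gain]] : gains (n := n) (F := G) (j0 := j0).
  apply: (disc_pseudoconcave PD XQ X3 oG hO OG rad_other (rad_le1 _) _ gain).
  by apply: rad_other; rewrite /j0; level_lia.
have Irev : \dim (I (n - r) r) <> 0%N by rewrite (piece_dim_sym hI).
have above t : j0 + 1 <= t -> sg t = ~~ sg j0 -> \dim (I t (n - t)) <> 0%N ->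
    gains (n := n) (F := G) (j0 := j0).
  move=> jt st It.
  have [|f f_piece] := @piece_vector _ _ _ _ _ _ PD _ oG clG t.
    rewrite !rad_other ?dimv0; try (rewrite /j0 in jt *; level_lia).
    have := @h_ge t [:: n - t] isT; rewrite big_cons big_nil addn0 lt0n => le.
    by apply/eqP => h0; move: le; rewrite h0 leqn0 => /eqP.
  rewrite st => fneg.
  have [nj|nj] := eqVneq (n + 1) (2 * j0).
    exact: (gains_above_odd PD oG e_rad e0 f_piece nj jt fneg).
  have nj' : n + 2 <= 2 * j0 by rewrite /j0 in nj *; level_lia.
  exact: (gains_above PD oG e_rad f_piece nj' jt fneg (conj_deg nj' eG e0)).
have sgE a b : sg (a + 2 * b) = sg a by rewrite sgD sgM2 addbF.
case: rE => rE; last first.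
  apply: (above (n - r)); first by rewrite rE /j0; level_lia.
    have -> : n - r = j0 + 1 + 2 * (l - 1) by rewrite rE /j0; level_lia.
    by rewrite sgE sgD sg1 addbT.
  by have -> : n - (n - r) = r by level_lia.
have [nj|nj] := eqVneq (n + 1) (2 * j0).
  apply: (above r) => //; first by rewrite rE; rewrite /j0 in nj *; level_lia.
  have -> : r = j0 + 1 + 2 * (l - 1) by rewrite rE; rewrite /j0 in nj *; level_lia.
  by rewrite sgE sgD sg1 addbT.
have nj' : n + 2 <= 2 * j0 by rewrite /j0 in nj *; level_lia.
pose t := n - r; have tj : t <= j0 - 2 by rewrite /t rE /j0; level_lia.
have st : sg t = sg j0.
  have -> : t = j0 + 2 * - l by rewrite /t rE /j0; level_lia.
  by rewrite sgE.
have It : (0 < \dim (I t r))%N by rewrite lt0n; apply/eqP.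
(* One of the levels t + 1 and n - t + 1 carries a radical only for t = po or t = po + 1. There
   [I po (n - po - 1)] or [I (po + 1) (n - po)] adds a further dimension to [h t]. *)
have ht : (\dim (rad H (G (t + 1)%R)) + \dim (rad H (G (n - t + 1)%R)) < h t)%N.
  have h1 := @h_ge t [:: r] isT; rewrite big_cons big_nil addn0 in h1.
  have [t1|t1] := eqVneq t po.
    rewrite (rad_other (q := n - t + 1)) ?dimv0 ?addn0; try (rewrite /j0 in tj *; level_lia).
    apply: leq_ltn_trans (rad_le1 _) _.
    have := @h_ge t [:: r; n - po - 1]; rewrite /= inE andbT !big_cons big_nil addn0.
    have I1 : \dim (I t (n - po - 1)) = 1%N by rewrite t1.
    rewrite I1 => le; apply: leq_trans (le _); first by rewrite addn1 ltnS.
    by rewrite /t in t1; level_lia.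
  have [t2|t2] := eqVneq t (po + 1).
    rewrite (rad_other (q := t + 1)) ?dimv0 ?add0n; try (rewrite /j0 in tj *; level_lia).
    apply: leq_ltn_trans (rad_le1 _) _.
    have := @h_ge t [:: r; n - po]; rewrite /= inE andbT !big_cons big_nil addn0.
    have I1 : \dim (I t (n - po)) = 1%N by rewrite t2.
    rewrite I1 => le; apply: leq_trans (le _); first by rewrite addn1 ltnS.
    by rewrite /t in t2; level_lia.
  rewrite !rad_other ?dimv0 ?addn0 ?(leq_trans It) //; rewrite /j0 in tj *; level_lia.
have [g0 g0_piece g0pos] := piece_vector PD oG clG ht.
(* For 2 t = n the piece is its own conjugate and contains a real vector of the same sign; for other
   t all its vectors are Q-isotropic. *)
have [g [g_piece greal gpos]] : exists g, [/\ g \in hodge_piece n G t,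
    conj_mx g = g \/ form (Q := Q) g g = 0 & 0 < (-1) ^+ sg j0 * hf H g g].
  rewrite -st; have [tn|tn] := eqVneq (2 * t) n; last first.
    by exists g0; split=> //; right; exact: (piece_conj_isotropic PD oG tn).
  have [|u uE|g [gE gc gp]] := real_vector PD _ _ g0_piece g0pos.
  - by rewrite -tn sgM2.
  - apply/(mem_piece G); rewrite conj_mxK; have [uG cuG] := proj1 (mem_piece G t u) uE.
    have tE : n - t = t by level_lia.
    by rewrite tE in cuG *.
  - by exists g; split=> //; left.
exact: (gains_below PD oG e_rad g_piece nj' tj greal (conj_deg nj' eG e0) gpos).
Qed.

End SquareZero.
End TypeOne.

(** * Degenerations of type II *)

Section RankTwo.
Context {K : fieldType} {d : nat} {A : 'M[K]_d} {x : 'rV[K]_d}.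
Hypothesis rankA : \rank A = 2%N.
Hypothesis A3 : A *m A *m A = 0.
Hypothesis xAA : x *m A *m A != 0.
Implicit Types (v : 'rV[K]_d).

Let A3v v : v *m A *m A *m A = 0.
Proof. by rewrite -(mulmxA v) -(mulmxA v) A3 mulmx0. Qed.

(** The vectors x A and x A^2 are independent, as applying A to a relation shows, hence form a basis
    of the image. *)
Lemma rank2_cube0_image v :
  exists a b, v *m A = a *: (x *m A) + b *: (x *m A *m A).
Proof.
pose B : 'M[K]_(1 + 1, d) := col_mx (x *m A) (x *m A *m A).
have combE (c : 'rV[K]_(1 + 1)) :
    c *m B = lsubmx c 0 0 *: (x *m A) + rsubmx c 0 0 *: (x *m A *m A).
  rewrite -{1}(hsubmxK c) mul_row_col [X in X *m _]mx11_scalar mul_scalar_mx.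
  by rewrite [X in _ + X *m _]mx11_scalar mul_scalar_mx.
have BA : (B <= A)%MS by rewrite col_mx_sub !submxMl.
have rB : row_free B.
  rewrite -kermx_eq0; apply/eqP/row_matrixP => i; rewrite row0.
  have : row i (kermx B) *m B = 0 by rewrite -row_mul mulmx_ker row0.
  set c := row i _ => cB; have := cB; rewrite combE => E.
  have E2 : lsubmx c 0 0 *: (x *m A *m A) = 0.
    have := congr1 (mulmxr A) E.
    by rewrite /= mulmxDl -!scalemxAl mul0mx A3v scaler0 addr0.
  move/eqP: E2; rewrite scaler_eq0 (negPf xAA) orbF => /eqP a0.
  move/eqP: E; rewrite a0 scale0r add0r scaler_eq0 (negPf xAA) orbF => /eqP b0.
  rewrite -(hsubmxK c) [lsubmx c]mx11_scalar [rsubmx c]mx11_scalar a0 b0.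
  by rewrite !raddf0 row_mx0.
have AB : (A <= B)%MS.
  by have := mxrank_leqif_sup BA; rewrite rankA (eqP rB) => -[_ <-].
have /submxP[c ->] : (v *m A <= B)%MS by exact: submx_trans (submxMl _ _) AB.
by rewrite combE; do 2!eexists.
Qed.

Lemma rank2_cube0_square v : exists c, v *m A *m A = c *: (x *m A *m A).
Proof.
have [a [b ->]] := rank2_cube0_image v.
by exists a; rewrite mulmxDl -!scalemxAl A3v scaler0 addr0.
Qed.

Lemma rank2_cube0_ker v : v *m A *m A = 0 -> exists c, v *m A = c *: (x *m A *m A).
Proof.
have [a [b ->]] := rank2_cube0_image v; rewrite mulmxDl -!scalemxAl A3v scaler0 addr0.
move/eqP; rewrite scaler_eq0 (negPf xAA) orbF => /eqP ->.
by exists b; rewrite scale0r add0r.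
Qed.

End RankTwo.

Section TypeTwo.
Context {R : realType} {d : nat} {Q : 'M[R]_d} {n : int} {h : int -> nat} {o : flag Q}.
Hypothesis PD : period_datum n h o.
Local Notation H := (HQ (Q := Q) (n := n)).
Local Notation D := (period_domain n h o).
Local Notation form := (form (Q := Q)).
Context {O : set (flag Q)} {N : 'M[R]_d} {F G : flag Q}
  {W : int -> {vspace 'rV[R]_d}} {I : int -> int -> {vspace 'rV[R[i]]_d}}.
Hypothesis hO : codim1_boundary_orbit n h o O.
Hypothesis OG : O G.
Hypothesis oF : orbC o F.
Hypothesis FN : forall p v, v \in F p -> v *m cplx N \in F (p - 1).
Hypothesis lim : reduced_limit N F G.
Hypothesis hW : weight_filtration n N W.
Hypothesis hI : deligne_splitting W F I.
Hypothesis NQ : N \in lie_algebra Q.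
Hypothesis N3 : N ^+ 3 = 0.
Hypothesis Nrank : \rank N = 2%N.
Context {m : int} {x : 'rV[R]_d}.
Hypothesis nm : n = 2 * m.
Hypothesis xNN : x *m N *m N != 0.
Implicit Types (p q j k t a b l : int) (v u : 'rV[R[i]]_d).

Let Qnondeg : Q \in unitmx. Proof. by case: PD. Qed.
Let oG : orbC o G. Proof. exact: orbit_orbC hO OG. Qed.
Let clG : closure D G. Proof. by case: hO => _ /(_ G OG)[]. Qed.
Let Fdecr p : (F (p + 1)%R <= F p)%VS.
Proof. by apply: (orb_decr PD oF); level_lia. Qed.
Let d1 : (1 < d)%N. Proof. by rewrite -Nrank rank_leq_row. Qed.
Let NNN : N *m N *m N = 0. Proof. by rewrite -N3 !mulmxE !exprS mulr1 mulrA. Qed.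
Let cNNN : cplx N *m cplx N *m cplx N = 0.
Proof. by rewrite -!cplxM NNN /cplx map_mx0. Qed.
Let crank : \rank (cplx N) = 2%N. Proof. by rewrite mxrank_map. Qed.

Let conjN v : conj_mx (v *m cplx N) = conj_mx v *m cplx N.
Proof. by rewrite conj_mxM conj_cplx. Qed.

Let Npow (j : nat) : (2 < j)%N -> N ^+ j = 0.
Proof. by case: j => [|[|[|j]]] // _; rewrite -addn3 addnC exprD N3 mul0r. Qed.

(** A real generator of the line im N^2; it turns out to span the radicals at levels m and m + 1. *)
Let e : 'rV[R[i]]_d := cplx (x *m N *m N).

Let eE : e = cplx x *m cplx N *m cplx N. Proof. by rewrite /e !cplxM. Qed.

Let ce : conj_mx e = e. Proof. exact: conj_cplx. Qed.

Let e_neq0 : e != 0. Proof. by rewrite /e /cplx map_mx_eq0. Qed.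

Let cxNN : cplx x *m cplx N *m cplx N != 0. Proof. by rewrite -eE. Qed.

Let im_square v : exists c, v *m cplx N *m cplx N = c *: e.
Proof. by rewrite eE; exact: rank2_cube0_square. Qed.

Let ker_square v : v *m cplx N *m cplx N = 0 -> exists c, v *m cplx N = c *: e.
Proof. by rewrite eE; exact: rank2_cube0_ker. Qed.

Let Wtop : cplxv (W (n + 2)) = fullv.
Proof.
apply/vspaceP => v; rewrite memvf; have := weight_top hW Npow => ->.
exact: mem_cplxvT.
Qed.

Let Wbot : W (n - 3) = 0%VS.
Proof. by have := weight_bot hW Npow; have -> : n - 2%N%:Z - 1 = n - 3 by level_lia. Qed.

Let Wn1 v : v \in cplxv (W (n + 1)) <-> v *m cplx N *m cplx N = 0.
Proof.
have [_ _ WN inj _] := hW; split=> [vW|vN].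
  apply: mem_cplxv0; rewrite -mulmxA -cplxM; apply: cplxv_mul vW => y yW.
  rewrite mulmxA -Wbot; have := WN _ _ (WN _ _ yW).
  by congr (_ \in W _); level_lia.
have WE y : y *m N *m N = 0 -> y \in W (n + 1).
  move=> yN; have := inj 2%N y.
  have -> : n + 2%N%:Z - 1 = n + 1 by level_lia.
  rewrite expr2 -mulmxE mulmxA yN mem0v (weight_top hW Npow) memvf.
  by move=> /(_ isT isT).
by apply/mem_cplxv; split; apply: WE;
  rewrite -/(re_mx _) -/(im_mx _) -?re_mul -?im_mul vN /re_mx /im_mx;
  apply/matrixP => i j; rewrite !mxE.
Qed.

Let xNN_W : x *m N *m N \in W (n - 2).
Proof.
have [_ _ WN _ _] := hW; have xW : x \in W (n + 2) by rewrite (weight_top hW Npow) memvf.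
by have := WN _ _ (WN _ _ xW); congr (_ \in W _); level_lia.
Qed.

(** A vector killed by N^2 is sent by N into im N^2, which lies in W_(n-2), and N is injective on
    the graded piece of weight n + 1. That piece is therefore zero. *)
Let Wn1n : (W (n + 1)%R <= W n)%VS.
Proof.
have [_ _ WN inj _] := hW; apply/subvP => y yW.
have yNN : y *m N *m N = 0.
  apply/eqP; rewrite -memv0 -Wbot; have := WN _ _ (WN _ _ yW).
  by congr (_ \in W _); level_lia.
have [c yN] := rank2_cube0_ker Nrank NNN xNN yNN.
have := inj 1%N y yW; rewrite addrK expr1 yN; apply.
have -> : n - 1%N%:Z - 1 = n - 2 by level_lia.
exact: memvZ.
Qed.

Let Wn1_e v : v \in cplxv (W (n - 1)) -> exists c, v = c *: e.
Proof.
have [_ _ WN _ surj] := hW.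
have real2 y : y \in W (n - 2) -> exists c : R, y = c *: (x *m N *m N).
  move=> /(surj 2%N)[w _]; have -> : n - 2%N%:Z - 1 = n - 3 by level_lia.
  rewrite Wbot memv0 subr_eq0 expr2 -mulmxE mulmxA => /eqP ->.
  exact: rank2_cube0_square.
have real y : y \in W (n - 1) -> exists c : R, y = c *: (x *m N *m N).
  move=> /(surj 1%N)[w wW]; have -> : n - 1%N%:Z - 1 = n - 2 by level_lia.
  move=> /real2[c1]; rewrite expr1 => /eqP; rewrite subr_eq => /eqP ->.
  have wNN : w *m N *m N = 0.
    apply/eqP; rewrite -memv0 -Wbot; have := WN _ _ (WN _ _ wW).
    by congr (_ \in W _); level_lia.
  by have [c2 ->] := rank2_cube0_ker Nrank NNN xNN wNN; exists (c1 + c2); rewrite scalerDl.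
move=> /mem_cplxv[/real[a aE] /real[b bE]].
exists (real_complex R a + 'i%C * real_complex R b).
rewrite [LHS]re_im_mxE /re_mx /im_mx aE bE /cplx !map_mxZ /=.
by rewrite scalerDl scalerA.
Qed.

Let rank_square : (\rank (N *m N) <= 1)%N.
Proof.
apply: leq_trans (rank_leq_row (x *m N *m N)); apply/mxrankS/row_subP => i.
have [c cE] := rank2_cube0_square Nrank NNN xNN (delta_mx 0 i).
by rewrite rowE mulmxA cE scalemx_sub.
Qed.

Let ker_cplx_square v : v \in cplxv (W (n + 1)) <-> v *m cplx (N *m N) = 0.
Proof. by rewrite cplxM mulmxA; exact: Wn1. Qed.

Let top_dim (ks : seq (int * int)) : uniq ks ->
  (forall ab, ab \in ks -> ab.1 + ab.2 = n + 2) ->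
  (\sum_(ab <- ks) \dim (I ab.1 ab.2) <= 1)%N.
Proof.
move=> uks ksn; apply: leq_trans rank_square.
apply: (upper_pieces_dim hI ker_cplx_square uks) => ab /ksn ->.
by level_lia.
Qed.

(** Weight n + 2 injects under N^2, of rank at most one, whereas off the diagonal pieces come in
    conjugate pairs. *)
Lemma square_top_piece a b : a + b = n + 2 -> a != b -> I a b = 0%VS.
Proof.
move=> abn ab; apply/eqP; rewrite -dimv_eq0.
have := @top_dim [:: (a, b); (b, a)].
rewrite /= inE xpair_eqE (negPf ab) /= !big_cons big_nil addn0 /=.
rewrite (piece_dim_sym hI b a) => /(_ isT) le.
have /le : forall c, c \in [:: (a, b); (b, a)] -> c.1 + c.2 = n + 2.
  by move=> c; rewrite !inE => /orP[] /eqP -> /=; level_lia.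
by case: (\dim (I a b)) => // k; rewrite addSn addnS.
Qed.

Lemma square_top_piece_neq0 : (0 < \dim (I (m + 1) (m + 1)))%N.
Proof.
rewrite lt0n dimv_eq0; apply/negP => /eqP I0.
have : e != 0 by []; rewrite eE; apply/negP; rewrite negbK; apply/eqP/Wn1.
have : cplx x \in cplxv (W (n + 2)) by rewrite Wtop memvf.
rewrite (WE hI); apply/subvP; apply/psum_sub => a b /= abn.
have [abl|abg] := lerP (a + b) (n + 1); first exact: (piece_W hI).
have [ab|ab] := eqVneq a b; last by rewrite square_top_piece ?sub0v //; level_lia.
have -> : a = m + 1 by level_lia.
have -> : b = m + 1 by level_lia.
by rewrite I0 sub0v.
Qed.

Let top_vector : exists2 w, w \in F (m + 1) & w *m cplx N *m cplx N != 0.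
Proof.
apply: contrapT => no.
have F0 v : v \in F (m + 1) -> v *m cplx N *m cplx N = 0.
  by move=> vF; apply/eqP; apply: contrapT => /negP vN; apply: no; exists v.
case/negP: e_neq0; apply/eqP; rewrite eE.
have : cplx x \in cplxv (W (n + 2)) by rewrite Wtop memvf.
move=> /(subvP (weight_hodge hI (m + 1) (m + 1) (n + 2))).
rewrite [X in (_ + X)%VS]psum0 ?addv0; last by move=> a b /= [ab aj bk]; level_lia.
have -> : n + 2 - 1 = n + 1 by level_lia.
move=> /memv_addP[_ /memv_addP[u /memv_capP[uF _] [w /mem_conjv/memv_capP[wF _] ->]]].
move=> [y /Wn1 yN ->]; rewrite !mulmxDl F0 // add0r yN addr0.
by apply/eqP; rewrite -conj_mx_eq0 !conjN F0.
Qed.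

Lemma square_real_limit : e \in G (m + 1).
Proof.
have [w wF wN] := top_vector; have [c cE] := im_square w.
have c0 : c != 0 by apply: contraNneq wN => c0; rewrite cE c0 scale0r.
rewrite -(scale1r e) -(mulVf c0) -scalerA -cE memvZ //.
exact: (@limit_N2 _ _ _ Qnondeg N F G d1 NNN lim).
Qed.

Let formN u v : form (u *m cplx N) v = - form u (v *m cplx N).
Proof.
have E : cplx N *m cplx Q + cplx Q *m (cplx N)^T = 0.
  have /mem_lie_algebra NQ0 := NQ.
  by rewrite /cplx map_trmx -!map_mxM -map_mxD NQ0 map_mx0.
have E' : u *m cplx N *m cplx Q *m v^T + u *m cplx Q *m (v *m cplx N)^T = 0.
  rewrite trmx_mul !mulmxA -mulmxDl -(mulmxA u) -(mulmxA u) -mulmxDr E.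
  by rewrite mulmx0 mul0mx.
have := congr1 (fun M : 'M[R[i]]_1 => M 0 0) E'; rewrite [LHS]mxE [RHS]mxE.
by move/eqP; rewrite addr_eq0 => /eqP.
Qed.

(** F^(m+1), its conjugate and ker N^2 span V. As N is skew, [e] is orthogonal to ker N^2; were it
    in F^m, it would, being real, be orthogonal to the other two as well. *)
Let eF : e \notin F m.
Proof.
apply/negP => eFm; case/negP: e_neq0; apply/eqP.
apply: (form_nondeg Qnondeg) => u; apply: (form_eq0C (n := n)); first by case: PD.
have : u \in cplxv (W (n + 2)) by rewrite Wtop memvf.
move=> /(subvP (weight_hodge hI (m + 1) (m + 1) (n + 2))).
rewrite [X in (_ + X)%VS]psum0 ?addv0; last by move=> a b /= [ab aj bk]; level_lia.
have -> : n + 2 - 1 = n + 1 by level_lia.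
move=> /memv_addP[_ /memv_addP[v /memv_capP[vF _] [w /mem_conjv/memv_capP[wF _] ->]]].
have F0 v' : v' \in F (m + 1) -> form e v' = 0.
  by move=> vF'; apply: (orb_form PD oF _ eFm vF'); level_lia.
move=> [y /Wn1 yN ->]; rewrite !formDr F0 // add0r.
have -> : form e w = 0.
  by rewrite -(conj_mxK w) -ce -form_conj F0 // cj0.
by rewrite add0r eE !formN yN form0r !oppr0.
Qed.

(** As in the square-zero case, but only F^(p+2) is known to lie in G^p, so the gap in weight n + 2
    has indices shifted by two. The image of N is spanned by [e] and by w N with w = w0 or its
    conjugate, chosen according to which of j, k is at most m. *)
Lemma limit_sum j k : j + k <= n + 1 ->
  (fullv <= G j + conjv (G k) + psum (I := I)
    [set ab | [/\ (ab.1 + ab.2 = n + 2)%R, (ab.1 < j + 2)%R & (ab.2 < k + 2)%R]])%VS.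
Proof.
move=> jk; set S := (G j + conjv (G k))%VS; set T := psum _.
have GS v : v \in G j -> v \in S by exact: subvP (addvSl _ _) v.
have cGS v : conj_mx v \in G k -> v \in S.
  by move=> cv; apply: (subvP (addvSr (G j) (conjv (G k)))); apply/mem_conjv.
have Gdecr p q : p <= q -> (G q <= G p)%VS by move=> pq; exact: (orb_decr PD oG pq).
have FdecrE p q : p <= q -> (F q <= F p)%VS by move=> pq; exact: (orb_decr PD oF pq).
have eG := square_real_limit.
have jmkm : j <= m \/ k <= m by case: (lerP j m) => jm; [left | right; level_lia].
have eS : e \in S.
  case: jmkm => le; [apply: GS | apply: cGS; rewrite ce];
  by apply: subvP eG; apply: Gdecr; level_lia.
have [w0 w0F w0N] := top_vector.
have w0G : w0 *m cplx N \in G m.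
  exact: (@limit_N1 _ _ _ Qnondeg N F G d1 NNN FN Fdecr lim).
have imN y : y *m cplx N \in S.
  have [w [wS wN]] : exists w, w *m cplx N \in S /\ w *m cplx N *m cplx N != 0.
    case: jmkm => le; [exists w0 | exists (conj_mx w0)]; split.
    - by apply: GS; apply: subvP w0G; exact: Gdecr.
    - exact: w0N.
    - by apply: cGS; rewrite -conjN conj_mxK; apply: subvP w0G; exact: Gdecr.
    - by rewrite -!conjN conj_mx_eq0.
  have [a [b ->]] := rank2_cube0_image crank cNNN wN y.
  have [c ->] := im_square w.
  by rewrite memvD ?memvZ.
have [g gE] := im_square w0.
have g0 : g != 0 by apply: contraNneq w0N => g0; rewrite gE g0 scale0r.
(* N sends [v] into the line of [e] rather than to 0, so a multiple of w0 N is added to reach ker N.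
   When this is needed, [e] lies in F^(p-1), so p <= m by [eF] and the correction stays in F^p. *)
have FWn p v : v \in F p -> v \in cplxv (W n) ->
    exists y, v + y *m cplx N \in G p.
  move=> vF vW.
  have [|c cE] := @ker_square v.
    apply/Wn1; move: vW => /mem_cplxv[vr vi]; apply/mem_cplxv.
    by split; [move: vr | move: vi]; apply/subvP/(weight_mono hW); level_lia.
  have [c0|c0] := eqVneq c 0.
    exists 0; rewrite mul0mx addr0.
    by apply: (@limit_ker _ _ _ Qnondeg N F G d1 NNN lim); rewrite // cE c0 scale0r.
  have pm : p <= m.
    rewrite leNgt; apply/negP => mp; case/negP: eF.
    have : e \in F (p - 1).
      by rewrite -(scale1r e) -(mulVf c0) -scalerA -cE memvZ // FN.
    by apply/subvP/FdecrE; level_lia.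
  exists ((- c / g) *: w0); rewrite -scalemxAl.
  apply: (@limit_ker _ _ _ Qnondeg N F G d1 NNN lim).
    rewrite memvD // memvZ //; have := FN w0F; rewrite addrK.
    by apply/subvP; exact: FdecrE.
  by rewrite mulmxDl -scalemxAl gE cE scalerA divfK // -scalerDl subrr scale0r.
have WnS v : v \in cplxv (W n) -> v \in S.
  move=> /(subvP (weight_hodge hI j k n)).
  rewrite [X in (_ + X)%VS]psum0 ?addv0; last by move=> a b /= [ab aj bk]; level_lia.
  move=> /memv_addP[_ /memv_addP[u /memv_capP[uF uW] [w /mem_conjv/memv_capP[wF wW] ->]]].
  move=> [_ /Wn1_e[c ->] ->].
  have [y1 y1G] := FWn _ _ uF uW; have [y2 y2G] := FWn _ _ wF wW.
  rewrite (memvD _ (memvZ _ eS)) //.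
  rewrite -(addrK (y1 *m cplx N) u) -(addrK (conj_mx y2 *m cplx N) w).
  rewrite memvD // memvB ?imN //; first exact: GS.
  by apply: cGS; rewrite conj_mxD conjN conj_mxK.
apply/subvP => v _; have : v \in cplxv (W (n + 2)) by rewrite Wtop memvf.
move=> /(subvP (weight_hodge hI (j + 2) (k + 2) (n + 2))).
have -> : n + 2 - 1 = n + 1 by level_lia.
move=> /memv_addP[u uS [w wT ->]]; apply/memv_addP; exists u; last by exists w.
move: uS => /memv_addP[_ /memv_addP[y /memv_capP[yF _] [w' /mem_conjv/memv_capP[wF _] ->]]].
have limF p v' := @limit_F2 _ _ _ Qnondeg N F G d1 NNN FN Fdecr lim p v'.
move=> [y3 /mem_cplxv[r3 i3] ->]; rewrite !memvD //.
- by apply: GS; exact: limF.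
- by apply: cGS; exact: limF.
- by apply: WnS; apply/mem_cplxv; split; [apply: subvP r3 | apply: subvP i3].
Qed.

(** The only possible gap is [I (m + 1) (m + 1)], at most a line, and its indices meet the bounds of
    [limit_sum] only for these q. *)
Lemma square_rad_le q : (\dim (rad H (G q)) <= ((q == m) || (q == (m + 1)%R)))%N.
Proof.
have jk : q + (n - q + 1) <= n + 1 by level_lia.
have := limit_sum jk; set T := psum _ => full.
have TI : (T <= if (q == m) || (q == (m + 1)%R) then I (m + 1)%R (m + 1)%R else 0)%VS.
  apply/psum_sub => a b /= [ab aq bq].
  have [abE|abE] := eqVneq a b; last by rewrite square_top_piece // sub0v.
  have -> : a = m + 1 by level_lia.
  have -> : b = m + 1 by level_lia.
  have -> : (q == m) || (q == m + 1).
    by have [//|qm] := eqVneq q m; apply/eqP; level_lia.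
  exact: subvv.
have TI' : (\dim T <= ((q == m) || (q == (m + 1)%R)))%N.
  apply: leq_trans (dimvS TI) _; case: ifP => _; last by rewrite dimv0.
  have := @top_dim [:: (m + 1, m + 1)] isT; rewrite big_cons big_nil addn0 /=; apply.
  by move=> c; rewrite !inE => /eqP -> /=; level_lia.
have full' : (d <= \dim (G q + conjv (G (n - q + 1)%R) + T))%N.
  by apply: leq_trans (dimvS full); rewrite dimvf /dim /= mul1n.
rewrite -(leq_add2r (\dim (G q + conjv (G (n - q + 1)%R)))) (rad_dim_sum PD oG q).
apply: leq_trans full' _; rewrite addnC.
apply: leq_trans (dimv_add_leqif _ _) _; by rewrite leq_add2l.
Qed.

Lemma square_rad_other q : q != m -> q != m + 1 -> rad H (G q) = 0%VS.
Proof.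
move=> q1 q2; apply/eqP; rewrite -dimv_eq0 -leqn0.
by apply: leq_trans (square_rad_le q) _; rewrite (negPf q1) (negPf q2).
Qed.

(** This sign is opposite to the one that level m has in D. As [e] is real and lies in G^(m+1), G^m
    + conj G^m is not V, so the piece at level m is larger than [h m], which is just enough for the
    count of [piece_vector_ind]. *)
Lemma square_real_piece : exists e0, [/\ e0 \in hodge_piece n G m, conj_mx e0 = e0
  & 0 < (-1) ^+ sg (m + 1) * hf H e0 e0].
Proof.
have n0 : sg n = false by rewrite nm sgM2.
have mE : n - m + 1 = m + 1 by level_lia.
have mE' : n - m = m by level_lia.
have [|v vE vpos] := @piece_vector_ind _ _ _ _ _ _ PD _ oG (sg (m + 1)) m.
  rewrite mE ind_conjv ?n0 ?addbF; last by case: PD.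
  have r0 : rad H (G (m + 1 + 1)%R) = 0%VS.
    by apply: square_rad_other; apply/eqP; level_lia.
  have := ind_closure_other PD oG clG r0.
  have := ind_dual PD (sg (m + 1)) m; rewrite mE n0 addbF => <-.
  rewrite (ind_step PD _ m) sgD sg1 addbT.
  have -> : (sg m == ~~ sg m) = false by case: (sg m).
  rewrite addn0; have := ind_total PD (~~ sg m) (m + 1).
  have := hdim PD m; have := dim_levels PD m; rewrite mE.
  have := dimv_sum_cap (G m) (conjv (G m)); rewrite dim_conjv !(orb_dim _ oG).
  rewrite /hodge_piece mE'.
  have : (\dim (G m + conjv (G m)) < d)%N.
    rewrite ltnNge; apply/negP => full; case/negP: e_neq0; apply/eqP.
    apply: (cap_conj0 PD oG (p := m + 1)); rewrite ?ce ?square_real_limit //.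
    have -> : n - (m + 1) + 1 = m by level_lia.
    by apply/eqP; rewrite eqEdim subvf dimvf /dim /= mul1n.
  move: (\dim (_ + _)) (\dim (_ :&: _)) => A B; rewrite negbK.
  move: (ind _ _ _) (ind _ _ _) (ind _ _ _); clear => *; lia.
have [|u uE|e0 [eE0 ec ep]] := real_vector PD _ _ vE vpos; last by exists e0.
  by rewrite n0.
apply/(mem_piece G); rewrite conj_mxK; have [uG cuG] := proj1 (mem_piece G m u) uE.
by rewrite mE' in cuG *.
Qed.

Lemma typeII_pseudoconcave r l : \dim (I r (n - r)) <> 0%N -> r = m + 2 * l + 1 ->
  pseudoconcave_boundary_orbit n h o O.
Proof.
move=> Ir rE.
have [e0 [/mem_piece[e0G _] ce0 e0pos]] := square_real_piece.
have rad_other q : q != m + 1 -> q != n - (m + 1) + 1 -> rad H (G q) = 0%VS.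
  by move=> q1 q2; apply: square_rad_other => //; move: q2; level_lia.
(* Replacing r by n - r turns l into - l - 1, so t can be taken at or above m + 1. *)
have [t [k [mt k0 It]]] : exists t k, [/\ t = m + 1 + 2 * k, 0 <= k
    & (0 < \dim (I t (n - t)))%N].
  have [l0|l0] := lerP 0 l.
    by exists r, l; split=> //; [level_lia | rewrite lt0n; apply/eqP].
  exists (n - r), (- l - 1); split; try level_lia.
  rewrite (piece_dim_sym hI); have -> : n - (n - r) = r by level_lia.
  by rewrite lt0n; apply/eqP.
have ht : (\dim (rad H (G (t + 1)%R)) + \dim (rad H (G (n - t + 1)%R)) < h t)%N.
  rewrite (square_rad_other (q := t + 1)) ?dimv0 ?add0n; try level_lia.
  (* For t = m + 1 the level n - t + 1 = m may carry a radical line, and [I (m + 1) (m + 1)] brings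
     [h t] to at least 2. *)
  have [t1|t1] := eqVneq t (m + 1).
    have := h_ge PD oF hI t (ks := [:: n - t; m + 1]).
    rewrite /= inE andbT !big_cons big_nil addn0 => le.
    have le1 : (\dim (rad H (G (n - t + 1)%R)) <= 1)%N.
      by apply: leq_trans (square_rad_le _) _; case: (_ || _).
    apply: leq_ltn_trans le1 _; apply: leq_trans (le _); last by level_lia.
    by apply: (leq_add It); rewrite t1; exact: square_top_piece_neq0.
  rewrite square_rad_other ?dimv0; try level_lia.
  have := h_ge PD oF hI t (ks := [:: n - t]) isT.
  by rewrite big_cons big_nil addn0; exact: leq_trans.
have [f f_piece fpos] := piece_vector PD oG clG ht.
have st : sg t = sg (m + 1) by rewrite mt sgD sgM2 addbF.
rewrite st in fpos; have mt' : m + 1 <= t by level_lia.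
have [X [XQ X3 gain]] := gains_real PD oG nm square_real_limit ce e_neq0 e0G ce0 e0pos
  f_piece mt' fpos.
apply: (disc_pseudoconcave PD XQ X3 oG hO OG rad_other _ _ gain).
  by apply: leq_trans (square_rad_le _) _; case: (_ || _).
by apply: square_rad_other; apply/eqP; level_lia.
Qed.

End TypeTwo.

Unset Implicit Arguments.

Theorem theorem4p4 (R : realType) (d : nat) (n : int) (h : int -> nat)
    (Q : 'M[R]_d) (Qnondeg : Q \in unitmx) (Qsym : Q^T = (-1) ^ n *: Q)
    (o : flag Q) (ho : polarized_hodge_structure n h o)
    (O : set (flag Q)) (hO : codim1_boundary_orbit n h o O)
    (N : 'M[R]_d) (F : flag Q) (hNF : minimal_degeneration n h o N F)
    (Finf : flag Q) (hFinf : reduced_limit N F Finf) (OFinf : O Finf)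
    (W : int -> {vspace 'rV[R]_d}) (hW : weight_filtration n N W)
    (I : int -> int -> {vspace 'rV[R[i]]_d}) (hI : deligne_splitting W F I)
    (r : int) (hr : \dim (I r (n - r)) <> 0%N)
    (hcond :
      (typeI N /\
       exists po : int,
         [/\ 2 * po < n,
             \dim (I (po + 1) (n - po)) = 1%N,
             \dim (I po (n - po - 1)) = 1%N
           & exists l : int,
               1 <= l /\ (r = po + 2 * l \/ r = po - 2 * l + 1)]) \/
      (typeII N /\
       exists m : int, n = 2 * m /\ exists l : int, r = m + 2 * l + 1)) :
  pseudoconcave_boundary_orbit n h o O.
Proof.
have [[[NQ _] oF FN _] _] := hNF.
have PD : period_datum n h o by split.
case: hcond => [[[N0 N2 Nrk] [po [po_lt Ip Im [l [l1 rE]]]]]|[[N2 N3 Nrk] [m [nm [l rE]]]]].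
  have Nrank : (0 < \rank N <= 2)%N by case: Nrk => ->.
  exact: (typeI_pseudoconcave PD hO OFinf oF FN hFinf hW hI N2 Nrank po_lt Ip Im hr l1 rE).
have [x xNN] : exists x : 'rV[R]_d, x *m N *m N != 0.
  have [i Ni] : exists i, row i (N *m N) != 0.
    apply: contrapT => no; apply: N2; rewrite expr2 -mulmxE; apply/row_matrixP => i.
    by rewrite row0; apply/eqP; apply: contrapT => /negP Ni; apply: no; exists i.
  by exists (delta_mx 0 i); rewrite -mulmxA -rowE.
exact: (typeII_pseudoconcave PD hO OFinf oF FN hFinf hW hI NQ N3 Nrk nm xNN hr rE).
Qed.
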